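(* There is no algorithm that constructs the abelian compatibility JSJ tree of $vGBS$ groups; that is, there is no algorithm which, given as input a finite graph of groups with finitely generated free abelian vertex and edge groups, with fundamental group $G$, outputs (the graph of groups decomposition of $G$ associated to) the abelian compatibility JSJ tree of $G$.
   Context: A $vGBS$ group is a group $G$ that is the fundamental group of a finite graph of groups with all vertex and edge groups finitely generated free abelian. A $G$-tree is a simplicial tree with a minimal action of $G$ without inversion; it is abelian if its edge stabilizers are abelian. A $G$-tree $T$ refines $T'$ if $T'$ is obtained from $T$ by equivariantly collapsing edges; two $G$-trees are compatible if some $G$-tree refines both; $T$ dominates $T'$ if every subgroup of $G$ fixing a vertex of $T$ fixes a vertex of $T'$. An abelian $G$-tree is universally compatible if it is compatible with every abelian $G$-tree. An abelian compatibility JSJ tree of $G$ is a universally compatible abelian $G$-tree which dominates every universally compatible abelian $G$-tree. *)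

(* Defs.v *)
From HB Require Import structures.
From mathcomp Require Import all_boot all_algebra.
From mathcomp Require Import boolp.

Set Implicit Arguments.
Unset Strict Implicit.
Unset Printing Implicit Defensive.

Inductive rec_fun : nat -> Type :=
| rec_zero n : rec_fun n
| rec_succ : rec_fun 1
| rec_proj n (i : 'I_n) : rec_fun n
| rec_comp k n (f : rec_fun k) (g : 'I_k -> rec_fun n) : rec_fun n
| rec_prim n (f : rec_fun n) (g : rec_fun n.+2) : rec_fun n.+1
| rec_min n (f : rec_fun n.+1) : rec_fun n.

(* [rec_eval f x y]: the computation of [f] on [x] halts with result [y].
   In the [rec_prim] case, [s] is the sequence of the intermediate values. *)
Fixpoint rec_eval n (f : rec_fun n) : n.-tuple nat -> nat -> Prop :=
  match f in rec_fun n return n.-tuple nat -> nat -> Prop with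
  | rec_zero _ => fun _ y => y = 0
  | rec_succ => fun x y => y = (thead x).+1
  | rec_proj _ i => fun x y => y = tnth x i
  | rec_comp k _ f g => fun x y =>
      exists z : k.-tuple nat,
        (forall i, rec_eval (g i) x (tnth z i)) /\ rec_eval f z y
  | rec_prim _ f g => fun x y =>
      exists s : nat -> nat,
        [/\ rec_eval f [tuple of behead x] (s 0),
            forall m, m < thead x ->
              rec_eval g [tuple of m :: s m :: behead x] (s m.+1)
          & y = s (thead x)]
  | rec_min _ f => fun x y =>
      rec_eval f [tuple of y :: x] 0 /\
      forall m, m < y -> exists z, rec_eval f [tuple of m :: x] z.+1
  end.

Local Open Scope group_scope.

Definition is_subgroup (G : groupType) (H : G -> Prop) : Prop :=
  H 1 /\ forall x y, H x -> H y -> H (x * y^-1).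

Definition generated (G : groupType) (S : seq G) (g : G) : Prop :=
  forall H, is_subgroup H -> (forall s, s \in S -> H s) -> H g.

(* Graphs in the sense of Serre: each geometric edge is a pair [e], [erev e]
   of oriented edges. *)
Record graph := Graph {
  vert : Type;
  edge : Type;
  orig : edge -> vert;
  erev : edge -> edge;
  erevK : involutive erev;
  erev_neq : forall e, erev e <> e
}.

Definition ter (X : graph) (e : edge X) : vert X := orig (erev e).

Fixpoint path_in (X : graph) (P : edge X -> Prop)
    (u : vert X) (s : seq (edge X)) (v : vert X) : Prop :=
  if s is e :: s' then [/\ orig e = u, P e & path_in P (ter e) s' v]
  else u = v.

Fixpoint reduced (X : graph) (s : seq (edge X)) : Prop :=
  if s is e :: s' then
    (if s' is e' :: _ then e' <> erev e else True) /\ reduced s'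
  else True.

Definition is_tree (X : graph) : Prop :=
  [/\ inhabited (vert X),
      forall u v : vert X, exists s, path_in (fun=> True) u s v
    & forall (u : vert X) s, path_in (fun=> True) u s u -> reduced s -> s = [::]].

Record gaction (G : groupType) (X : graph) := GAction {
  actV : G -> vert X -> vert X;
  actE : G -> edge X -> edge X;
  actV1 : forall v, actV 1 v = v;
  actVM : forall g h v, actV (g * h) v = actV g (actV h v);
  actE1 : forall e, actE 1 e = e;
  actEM : forall g h e, actE (g * h) e = actE g (actE h e);
  act_orig : forall g e, orig (actE g e) = actV g (orig e);
  act_rev : forall g e, erev (actE g e) = actE g (erev e)
}.

Definition no_inversion (G : groupType) (X : graph) (a : gaction G X) : Prop :=
  forall g e, actE a g e <> erev e.

Definition invariant_subtree (G : groupType) (X : graph) (a : gaction G X)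
    (PV : vert X -> Prop) (PE : edge X -> Prop) : Prop :=
  [/\ (exists v, PV v) /\ (forall e, PE e -> PE (erev e) /\ PV (orig e)),
      forall u v, PV u -> PV v -> exists s, path_in PE u s v,
      forall g v, PV v -> PV (actV a g v)
    & forall g e, PE e -> PE (actE a g e)].

Definition minimal_action (G : groupType) (X : graph) (a : gaction G X) : Prop :=
  forall PV PE, invariant_subtree a PV PE ->
    (forall v, PV v) /\ (forall e, PE e).

Record gtree (G : groupType) := GTree {
  gtree_graph :> graph;
  gtree_act : gaction G gtree_graph;
  gtree_tree : is_tree gtree_graph;
  gtree_noinv : no_inversion gtree_act;
  gtree_min : minimal_action gtree_act
}.

Definition vact (G : groupType) (T : gtree G) : G -> vert T -> vert T :=
  actV (gtree_act T).
Definition eact (G : groupType) (T : gtree G) : G -> edge T -> edge T :=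
  actE (gtree_act T).

Definition vstab (G : groupType) (T : gtree G) (v : vert T) (g : G) : Prop :=
  vact g v = v.
Definition estab (G : groupType) (T : gtree G) (e : edge T) (g : G) : Prop :=
  eact g e = e.

Definition abelian_gtree (G : groupType) (T : gtree G) : Prop :=
  forall (e : edge T) g h, estab e g -> estab e h -> commute g h.

(* [T'] is the quotient of [T] by the equivariant collapse of the edges [e]
   with [fE e = None]. *)
Record is_collapse (G : groupType) (T T' : gtree G)
    (fV : vert T -> vert T') (fE : edge T -> option (edge T')) : Prop := {
  collapse_actV : forall g v, fV (vact g v) = vact g (fV v);
  collapse_actE : forall g e, fE (eact g e) = omap (eact g) (fE e);
  collapse_rev : forall e, fE (erev e) = omap (@erev T') (fE e);
  collapse_orig : forall e e', fE e = Some e' -> orig e' = fV (orig e);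
  collapse_surjV : forall v', exists v, fV v = v';
  collapse_surjE : forall e', exists e, fE e = Some e';
  collapse_injE : forall e1 e2 e', fE e1 = Some e' -> fE e2 = Some e' -> e1 = e2;
  collapse_fiberV : forall u v,
    fV u = fV v <-> exists s, path_in (fun e => fE e = None) u s v
}.

Definition refines (G : groupType) (T T' : gtree G) : Prop :=
  exists fV fE, @is_collapse G T T' fV fE.

Definition compatible (G : groupType) (T1 T2 : gtree G) : Prop :=
  exists T : gtree G, refines T T1 /\ refines T T2.

Definition fixes_vertex (G : groupType) (T : gtree G) (H : G -> Prop) : Prop :=
  exists v : vert T, forall g, H g -> vact g v = v.

Definition dominates (G : groupType) (T T' : gtree G) : Prop :=
  forall H : G -> Prop, is_subgroup H -> fixes_vertex T H -> fixes_vertex T' H.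

Definition universally_compatible (G : groupType) (T : gtree G) : Prop :=
  abelian_gtree T /\ forall T' : gtree G, abelian_gtree T' -> compatible T T'.

Definition abelian_compatibility_JSJ (G : groupType) (T : gtree G) : Prop :=
  universally_compatible T /\
  forall T' : gtree G, universally_compatible T' -> dominates T T'.

(* The graph is finite, connected and non-empty.  The group at a vertex or edge
   of rank [r] is Z^r, written as row vectors; the two monomorphisms out of an
   edge group are right multiplications by integer matrices.  Each geometric
   edge is listed once, with an orientation. *)
Record vgbs := VGBS {
  nV : nat;
  nE : nat;
  eorg : 'I_nE -> 'I_nV.+1;
  eter : 'I_nE -> 'I_nV.+1;
  vrank : 'I_nV.+1 -> nat;
  erank : 'I_nE -> nat;
  inc_org : forall e, 'M[int]_(erank e, vrank (eorg e));
  inc_ter : forall e, 'M[int]_(erank e, vrank (eter e));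
  inc_org_inj : forall e, injective (fun c : 'rV[int]_(erank e) => c *m inc_org e)%R;
  inc_ter_inj : forall e, injective (fun c : 'rV[int]_(erank e) => c *m inc_ter e)%R;
  vgbs_connected : forall u v : 'I_nV.+1,
    connect (fun u v => [exists e, [|| (eorg e == u) && (eter e == v)
                                     | (eorg e == v) && (eter e == u)]]) u v
}.

(* Either an element of a vertex group, or an edge, to be followed
   from [eorg] to [eter] if the boolean is [true], backwards otherwise. *)
Definition letter (X : vgbs) : Type :=
  ({v : 'I_(nV X).+1 & 'rV[int]_(vrank v)} + 'I_(nE X) * bool)%type.

Definition vlet (X : vgbs) (v : 'I_(nV X).+1) (x : 'rV[int]_(vrank v)) : letter X :=
  inl (Tagged (fun v => 'rV[int]_(vrank v)) x).
Definition elet (X : vgbs) (e : 'I_(nE X)) (b : bool) : letter X := inr (e, b).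

Definition lsrc (X : vgbs) (l : letter X) : 'I_(nV X).+1 :=
  match l with
  | inl x => tag x
  | inr (e, b) => if b then eorg e else eter e
  end.
Definition linv (X : vgbs) (l : letter X) : letter X :=
  match l with
  | inl x => vlet (- tagged x)%R
  | inr (e, b) => elet e (~~ b)
  end.
Definition ltgt (X : vgbs) (l : letter X) : 'I_(nV X).+1 := lsrc (linv l).

Fixpoint is_wpath (X : vgbs) (u : 'I_(nV X).+1) (w : seq (letter X))
    (v : 'I_(nV X).+1) : bool :=
  if w is l :: w' then (lsrc l == u) && is_wpath (ltgt l) w' v else u == v.

(* Equality of two words in the path group F(X) of Serre ("Trees", I.5.1),
   generated by the vertex groups and the edges. *)
Inductive weq (X : vgbs) : seq (letter X) -> seq (letter X) -> Prop :=
| weq_refl w : weq w w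
| weq_sym w1 w2 : weq w1 w2 -> weq w2 w1
| weq_trans w1 w2 w3 : weq w1 w2 -> weq w2 w3 -> weq w1 w3
| weq_cat w1 w1' w2 w2' : weq w1 w1' -> weq w2 w2' -> weq (w1 ++ w2) (w1' ++ w2')
| weq_one (v : 'I_(nV X).+1) : weq [:: vlet (0 : 'rV[int]_(vrank v))%R] [::]
| weq_add v (x y : 'rV[int]_(vrank v)) : weq [:: vlet x; vlet y] [:: vlet (x + y)%R]
| weq_edge (e : 'I_(nE X)) b : weq [:: elet e b; elet e (~~ b)] [::]
| weq_conj e (c : 'rV[int]_(erank e)) :
    weq [:: elet e true; vlet (c *m inc_ter e)%R; elet e false]
        [:: vlet (c *m inc_org e)%R].

(* The fundamental group based at the vertex 0: the subgroup of F(X) of the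
   elements represented by loops. *)
Definition loop (X : vgbs) : Type := {w : seq (letter X) | is_wpath ord0 w ord0}.

Definition loop_eq (X : vgbs) : rel (loop X) :=
  fun p q => `[< weq (val p) (val q) >].

Lemma loop_eq_refl X : reflexive (@loop_eq X).
Proof. by move=> p; apply/asboolP/weq_refl. Qed.
Lemma loop_eq_sym X : symmetric (@loop_eq X).
Proof. by move=> p q; apply/asboolP/asboolP => /weq_sym. Qed.
Lemma loop_eq_trans X : transitive (@loop_eq X).
Proof.
by move=> p q r /asboolP qp /asboolP pr; apply/asboolP; apply: weq_trans pr.
Qed.

Canonical loop_equiv X :=
  EquivRel (@loop_eq X) (@loop_eq_refl X) (@loop_eq_sym X) (@loop_eq_trans X).

Definition pi1 (X : vgbs) : Type := {eq_quot (loop_equiv X)}%qT.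
HB.instance Definition _ (X : vgbs) := Choice.on (pi1 X).

Lemma linvK X : involutive (@linv X).
Proof.
case=> [[v x]|[e b]] /=; last by rewrite /elet negbK.
by rewrite /vlet /= GRing.opprK.
Qed.

Lemma is_wpath_cat X u v w (s t : seq (letter X)) :
  is_wpath u s v -> is_wpath v t w -> is_wpath u (s ++ t) w.
Proof.
elim: s u => [|l s IHs] u /=; first by move=> /eqP->.
by move=> /andP[-> /IHs]; apply.
Qed.

Definition winv (X : vgbs) (w : seq (letter X)) : seq (letter X) :=
  rev (map (@linv X) w).

Lemma winvK X : involutive (@winv X).
Proof.
by move=> w; rewrite /winv map_rev revK -map_comp (eq_map (@linvK X)) map_id.
Qed.

Lemma is_wpath_inv X u v (s : seq (letter X)) :
  is_wpath u s v -> is_wpath v (winv s) u.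
Proof.
elim: s u => [|l s IHs] u /=; first by rewrite eq_sym.
move=> /andP[/eqP<- /IHs sv]; rewrite /winv map_cons rev_cons -cats1.
by apply: is_wpath_cat sv _; rewrite /= /ltgt linvK !eqxx.
Qed.

Lemma weq_inv X (s : seq (letter X)) : weq (winv s ++ s) [::].
Proof.
elim: s => [|l s IHs]; first exact: weq_refl.
rewrite /winv map_cons rev_cons cat_rcons -/(winv s).
apply: weq_trans IHs; apply: weq_cat; first exact: weq_refl.
rewrite -[linv l :: _]/([:: linv l; l] ++ s) -[X in weq _ X]/([::] ++ s).
apply: weq_cat; last exact: weq_refl.
case: l => [[v x]|[e b]] /=.
  by apply: weq_trans (weq_one v); have := weq_add (- x)%R x; rewrite GRing.addNr.
by rewrite -[X in [:: _; inr (e, X)]]negbK; exact: weq_edge.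
Qed.

Lemma weq_winv X (s t : seq (letter X)) : weq s t -> weq (winv s) (winv t).
Proof.
move=> st.
have sV : weq (winv s ++ t) [::].
  by apply: weq_trans (weq_inv s); apply: weq_cat (weq_refl _) (weq_sym st).
have tV : weq (t ++ winv t) [::].
  by have := weq_inv (winv t); rewrite winvK.
apply: weq_trans (_ : weq (winv s ++ t ++ winv t) _).
  rewrite -[X in weq X _]cats0; apply: weq_cat (weq_refl _) _.
  exact: weq_sym.
by rewrite catA -[X in weq _ X]cat0s; apply: weq_cat (weq_refl _).
Qed.

Definition loop1 (X : vgbs) : loop X := exist _ [::] (eqxx ord0).
Definition loopM (X : vgbs) (p q : loop X) : loop X :=
  exist _ (val p ++ val q) (is_wpath_cat (valP p) (valP q)).
Definition loopV (X : vgbs) (p : loop X) : loop X :=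
  exist _ (winv (val p)) (is_wpath_inv (valP p)).

Definition to_pi1 (X : vgbs) (p : loop X) : pi1 X := (\pi_(pi1 X) p)%qT.

Definition pi1_one (X : vgbs) : pi1 X := to_pi1 (loop1 X).
Definition pi1_mul (X : vgbs) (x y : pi1 X) : pi1 X :=
  to_pi1 (loopM (repr x) (repr y)).
Definition pi1_inv (X : vgbs) (x : pi1 X) : pi1 X := to_pi1 (loopV (repr x)).

Lemma to_pi1P X (p q : loop X) : to_pi1 p = to_pi1 q <-> weq (val p) (val q).
Proof.
split=> [/eqP|pq]; first by rewrite /to_pi1 eqmodE => /asboolP.
by apply/eqP; rewrite /to_pi1 eqmodE; apply/asboolP.
Qed.

Lemma repr_pi1 X (p : loop X) : weq (val (repr (to_pi1 p))) (val p).
Proof. by apply/to_pi1P; rewrite /to_pi1 reprK. Qed.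

Lemma to_pi1M X (p q : loop X) : to_pi1 (loopM p q) = pi1_mul (to_pi1 p) (to_pi1 q).
Proof. by apply/to_pi1P; apply: weq_cat; apply/weq_sym/repr_pi1. Qed.
Lemma to_pi1V X (p : loop X) : to_pi1 (loopV p) = pi1_inv (to_pi1 p).
Proof. by apply/to_pi1P; apply/weq_winv/weq_sym/repr_pi1. Qed.

Lemma pi1_mulA X : associative (@pi1_mul X).
Proof.
move=> x y z; rewrite -[x]reprK -[y]reprK -[z]reprK -!/(to_pi1 _) -!to_pi1M.
by apply/to_pi1P; rewrite /= catA; apply: weq_refl.
Qed.
Lemma pi1_mul1l X : left_id (pi1_one X) (@pi1_mul X).
Proof.
move=> x; rewrite -[x]reprK -!/(to_pi1 _) -!to_pi1M.
by apply/to_pi1P; apply: weq_refl.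
Qed.
Lemma pi1_mulVl X : left_inverse (pi1_one X) (@pi1_inv X) (@pi1_mul X).
Proof.
move=> x; rewrite -[x]reprK -!/(to_pi1 _) -to_pi1V -!to_pi1M.
by apply/to_pi1P; apply: weq_inv.
Qed.
Lemma pi1_mul1r X : right_id (pi1_one X) (@pi1_mul X).
Proof.
move=> x; rewrite -[x]reprK -!/(to_pi1 _) -!to_pi1M.
by apply/to_pi1P; rewrite /= cats0; apply: weq_refl.
Qed.
Lemma pi1_mulVr X : right_inverse (pi1_one X) (@pi1_inv X) (@pi1_mul X).
Proof.
move=> x; rewrite -[x]reprK -!/(to_pi1 _) -to_pi1V -!to_pi1M.
by apply/to_pi1P; have := weq_inv (winv (val (repr x))); rewrite winvK.
Qed.

HB.instance Definition _ (X : vgbs) :=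
  isGroup.Build (pi1 X) (@pi1_mulA X) (@pi1_mul1l X) (@pi1_mul1r X)
    (@pi1_mulVl X) (@pi1_mulVr X).

(* A finite graph with, for each vertex and each edge, finitely many elements
   generating the vertex or edge group as a subgroup of [pi1 X].  The edge group
   of [e] embeds into the vertex group of [dorg e] by g |-> a^-1 g a where
   a = [dconj_org e], and likewise at the other end of [e]. *)
Record decomposition (X : vgbs) := Decomposition {
  dV : nat;
  dE : nat;
  dorg : 'I_dE -> 'I_dV;
  dter : 'I_dE -> 'I_dV;
  dvgen : 'I_dV -> seq (loop X);
  degen : 'I_dE -> seq (loop X);
  dconj_org : 'I_dE -> loop X;
  dconj_ter : 'I_dE -> loop X
}.

(* Bass-Serre quotient data: [lv] and [le] lift the vertices and edges of [D]
   to orbit representatives in [T]. *)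
Record is_quotient_gog (X : vgbs) (D : decomposition X) (T : gtree (pi1 X))
    (lv : 'I_(dV D) -> vert T) (le : 'I_(dE D) -> edge T) : Prop := {
  quo_surjV : forall v, exists g i, v = vact g (lv i);
  quo_injV : forall g i j, vact g (lv i) = lv j -> i = j;
  quo_surjE : forall e, exists g i, e = eact g (le i) \/ e = erev (eact g (le i));
  quo_injE : forall g i j,
    eact g (le i) = le j \/ erev (eact g (le i)) = le j -> i = j;
  quo_vstab : forall i g,
    vstab (lv i) g <-> generated (map (@to_pi1 X) (dvgen i)) g;
  quo_estab : forall i g,
    estab (le i) g <-> generated (map (@to_pi1 X) (degen i)) g;
  quo_org : forall i, orig (le i) = vact (to_pi1 (dconj_org i)) (lv (dorg i));
  quo_ter : forall i, ter (le i) = vact (to_pi1 (dconj_ter i)) (lv (dter i))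
}.

Definition decomposition_of (X : vgbs) (D : decomposition X)
    (T : gtree (pi1 X)) : Prop :=
  exists lv le, @is_quotient_gog X D T lv le.

Definition enc_seq (A : Type) (f : A -> nat) (s : seq A) : nat :=
  CodeSeq.code (map f s).

Definition enc_fam n (f : 'I_n -> nat) : nat := enc_seq f (enum 'I_n).

Definition enc_int (z : int) : nat :=
  match z with Posz n => n.*2 | Negz n => n.*2.+1 end.

Definition enc_mx m n (A : 'M[int]_(m, n)) : nat :=
  enc_fam (fun i => enc_fam (fun j => enc_int (A i j))).

Definition enc_vgbs (X : vgbs) : nat :=
  CodeSeq.code
    [:: nV X; nE X;
        enc_fam (fun e => @eorg X e : nat); enc_fam (fun e => @eter X e : nat);
        enc_fam (@vrank X); enc_fam (@erank X);
        enc_fam (fun e => enc_mx (@inc_org X e));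
        enc_fam (fun e => enc_mx (@inc_ter X e))].

Definition enc_letter (X : vgbs) (l : letter X) : nat :=
  match l with
  | inl x => CodeSeq.code [:: 0%N; tag x : nat; enc_mx (tagged x)]
  | inr (e, b) => CodeSeq.code [:: 1%N; e : nat; b : nat]
  end.

Definition enc_loop (X : vgbs) (p : loop X) : nat :=
  enc_seq (@enc_letter X) (val p).

Definition enc_decomposition (X : vgbs) (D : decomposition X) : nat :=
  CodeSeq.code
    [:: dV D; dE D;
        enc_fam (fun e => @dorg X D e : nat); enc_fam (fun e => @dter X D e : nat);
        enc_fam (fun v => enc_seq (@enc_loop X) (@dvgen X D v));
        enc_fam (fun e => enc_seq (@enc_loop X) (@degen X D e));
        enc_fam (fun e => enc_loop (@dconj_org X D e));
        enc_fam (fun e => enc_loop (@dconj_ter X D e))].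

(* Main.v *)
From HB Require Import structures.
From mathcomp Require Import all_boot all_order all_algebra.
From mathcomp Require Import boolp zify ring.
Require Import Defs.

(** An affine rule exchanges the integers m k + r and m' k + r', for all
    integers k. Finite lists of such rules simulate counter machines, so that
    the equivalence which they generate on the integers is undecidable. The idea
    is to hide an instance of this problem, a list of rules and two integers v
    and w, in a graph of free abelian groups whose compatibility JSJ tree solves
    it.

    The group [machine_vgbs] has a vertex group Z^2, where the integer x is
    represented by the vector (x, 1); one stable letter for each rule, which
    conjugates the vectors on one side of the rule to those on the other side;
    and two elements b_0 and b_1 with b_0^2 = (v, 1) and b_1^2 = (w, 1). A
    further letter, conjugating 5 u to 3 u for all u in Z^2, makes Z^2 elliptic
    in every tree, hence also b_0 and b_1.

    If v and w are connected by the rules, then some conjugate c of b_1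
    satisfies b_0^2 = c^2. This square centralises b_0 and c, whence
    automorphisms conjugating c by b_0, or b_0 by c, and fixing Z^2 and the
    stable letters. Let T be compatible with the twists, by these automorphisms,
    of the trees that only remember the edge of b_0 or the edge of b_1. Each of
    these trees gives a subtree of T, and comparing the two subtrees with the
    fixed sets of b_0 and c shows that these fixed sets meet: b_0 and c fix a
    common vertex of every universally compatible tree ([halting_vertex]).

    If v and w are not connected, then the tree which remembers precisely the
    edges of b_0 and b_1 is universally compatible ([nonhalting_compatible]).
    Indeed its vertices of the two kinds are rigid enough in any abelian tree S
    to attach to them subtrees of S that fit together into a common refinement
    ([rigid_compatible]). Thus the JSJ tree dominates it, and no vertex group of
    the JSJ tree contains conjugates of both b_0 and b_1.

    Counting the letters b_j modulo 2 is a homomorphism to Z/2 for each j, and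
    it tells the two cases apart: v and w are connected if and only if some
    vertex group of the JSJ decomposition contains elements of odd parity for
    b_0 and elements of odd parity for b_1 ([readsP]). This is read off from
    generators.

    Suppose now that f computes JSJ decompositions. A counter program can, from
    an integer m, compute the code of the group given by certain parameters
    encoded in m and by the integer v = S 3^m, apply f, and stop if and only if
    the answer is that v and w are not connected. Translate this program into
    rules; its start on the input m is S 3^m, and w is taken to be its halting
    number. When m encodes the parameters of the resulting group itself, the
    program stops if and only if it does not stop. *)

Set Implicit Arguments.
Unset Strict Implicit.
Unset Printing Implicit Defensive.

Local Open Scope group_scope.

(** * Geodesics, medians and convex sets in trees *)

Section Walks.
Variable X : graph.
Implicit Types (u v w : vert X) (e f : edge X) (s t : seq (edge X)).

Definition walk u s v := path_in (fun=> True) u s v.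
Definition wend u s : vert X := last u (map (@ter X) s).
Definition wrev s : seq (edge X) := rev (map (@erev X) s).
Fixpoint on_walk e s : Prop := if s is f :: s' then f = e \/ on_walk e s' else False.

Lemma ter_rev e : ter (erev e) = orig e.
Proof. by rewrite /ter erevK. Qed.

Lemma on_walk_cat e s t : on_walk e (s ++ t) <-> on_walk e s \/ on_walk e t.
Proof. by elim: s => [|f s IHs] /=; [|rewrite IHs]; tauto. Qed.

Lemma on_walk_wrev e s : on_walk e (wrev s) <-> on_walk (erev e) s.
Proof.
rewrite /wrev; elim: s => [|f s IHs] //=.
rewrite rev_cons -cats1 on_walk_cat IHs /=; split.
  by case=> [|[<-|//]]; [right|left; rewrite erevK].
by case=> [->|]; [right; left; rewrite erevK|left].
Qed.

Lemma on_walk_split e s : on_walk e s -> exists s1 s2, s = s1 ++ e :: s2.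
Proof.
elim: s => [//|f s IHs] /= [->|/IHs[s1 [s2 ->]]]; first by exists [::], s.
by exists (f :: s1), s2.
Qed.

Lemma path_inP P u s v :
  path_in P u s v <-> walk u s v /\ (forall e, on_walk e s -> P e).
Proof.
elim: s u => [|f s IHs] u /=; first by split=> [->|[]].
split=> [[fu Pf /IHs[sv sP]]|[[fu _ sv] sP]].
  by split=> // e [<-|/sP].
split=> //; first by apply: sP; left.
by apply/IHs; split=> // e es; apply: sP; right.
Qed.

Lemma walk_end u s v : walk u s v -> v = wend u s.
Proof. by elim: s u => [|f s IHs] u /= => [<-|[_ _ /IHs]]. Qed.

Lemma walk_cat u s t w :
  walk u (s ++ t) w <-> exists2 v, walk u s v & walk v t w.
Proof.
elim: s u => [|f s IHs] u /=.
  by split=> [uw|[v <-]] //; exists u.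
split=> [[fu _ /IHs[v sv vt]]|[v [fu _ sv] vt]]; first by exists v.
by split=> //; apply/IHs; exists v.
Qed.

Lemma walk_catI u v w s t : walk u s v -> walk v t w -> walk u (s ++ t) w.
Proof. by move=> us vt; apply/walk_cat; exists v. Qed.

Lemma walk_wrev u s v : walk u s v -> walk v (wrev s) u.
Proof.
rewrite /wrev; elim: s u => [|f s IHs] u /=; first by move->.
move=> [<- _ /IHs sv]; rewrite rev_cons -cats1.
by apply: walk_catI sv _ => /=; split=> //; rewrite ter_rev.
Qed.

Lemma wrev_cat s t : wrev (s ++ t) = wrev t ++ wrev s.
Proof. by rewrite /wrev map_cat rev_cat. Qed.

Lemma wrev_cons e s : wrev (e :: s) = wrev s ++ [:: erev e].
Proof. by rewrite -cat1s wrev_cat. Qed.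

Lemma size_wrev s : size (wrev s) = size s.
Proof. by rewrite size_rev size_map. Qed.

Lemma reduced_catl s t : reduced (s ++ t) -> reduced s.
Proof.
elim: s => [//|e s IHs]; rewrite cat_cons /= => -[h /IHs rs]; split=> //.
by case: s h {IHs rs}.
Qed.

Lemma reduced_catr s t : reduced (s ++ t) -> reduced t.
Proof. by elim: s => [//|e s IHs] /= [_ /IHs]. Qed.

Lemma reduced_junction s e f t :
  reduced ((s ++ [:: e]) ++ f :: t) <->
  [/\ reduced (s ++ [:: e]), reduced (f :: t) & f <> erev e].
Proof.
elim: s => [|g s IHs].
  rewrite /=; split=> [[h1 [h2 h3]]|[_ [h2 h3] h1]]; first by do !split.
  by do !split.
rewrite !cat_cons; case: s IHs => [|g' s] IHs.
  rewrite /=; split=> [[h0 [h1 [h2 h3]]]|[[h0 _] [h2 h3] h1]]; by do !split.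
split=> [[h /IHs[h1 h2 h3]]|[[h h1] h2 h3]]; first by split=> //; split.
by split=> //; apply/IHs.
Qed.

Lemma reduced_wrev s : reduced s -> reduced (wrev s).
Proof.
elim: s => [//|e [|f s] IHs] rs //.
have [fe rfs] : f <> erev e /\ reduced (f :: s) by case: rs.
move: (IHs rfs); rewrite !wrev_cons => rfs'.
apply/reduced_junction; split=> //.
by rewrite erevK => h; apply: fe; rewrite h.
Qed.

(** Deleting backtracks shortens a walk and uses no new edge. *)
Lemma reduce_walk P u s v : path_in P u s v ->
  exists2 t, path_in P u t v & reduced t.
Proof.
elim: s u => [|e s IHs] u /=; first by exists [::].
move=> [eu Pe /IHs[[|f t] /= tv rt]]; first by exists [:: e] => //=; split.
case: (EM (f = erev e)) => [fe|fe]; last first.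
  by exists (e :: f :: t) => //=; split.
exists t; last by case: rt.
by move: tv => [_ _]; rewrite fe ter_rev eu.
Qed.

End Walks.

Section Trees.
Variable X : graph.
Hypothesis tX : is_tree X.
Implicit Types (u v w m : vert X) (e f : edge X) (s t : seq (edge X)).

Lemma closed_nil u s : walk u s u -> reduced s -> s = [::].
Proof. by case: tX => _ _; apply. Qed.

(** If the first edges differ, then the inverse of one walk followed by the
    other one is a reduced closed walk. *)
Lemma reduced_walk_uniq u v s t :
  walk u s v -> walk u t v -> reduced s -> reduced t -> s = t.
Proof.
elim: s u t => [|e s IHs] u [|f t] //.
- by move=> /= -> tv _ rt; rewrite (closed_nil tv rt).
- by move=> sv /= h rs _; rewrite -h in sv; move: (closed_nil sv rs).
move=> sv tv rs rt; case: (EM (f = e)) => [fe|fe]; last first.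
  have := closed_nil (walk_catI (walk_wrev sv) tv).
  rewrite wrev_cons => h; have {}h : wrev s ++ [:: erev e] ++ f :: t = [::].
    rewrite catA; apply: h; apply/reduced_junction; split=> //.
      by rewrite -wrev_cons; apply: reduced_wrev.
    by rewrite erevK.
  by move: (congr1 size h); rewrite size_cat /= addnS.
move: fe sv tv rs rt => -> /= [_ _ sv] [_ _ tv] [_ rs] [_ rt].
by rewrite (IHs _ _ sv tv rs rt).
Qed.

Lemma geod_ex u v : exists s, walk u s v /\ reduced s.
Proof.
case: tX => _ conn _; have [s /reduce_walk[t tv rt]] := conn u v.
by exists t.
Qed.

Definition geod u v : seq (edge X) := proj1_sig (cid (geod_ex u v)).

Lemma geodP u v : walk u (geod u v) v.
Proof. by case: (proj2_sig (cid (geod_ex u v))). Qed.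
Lemma geod_red u v : reduced (geod u v).
Proof. by case: (proj2_sig (cid (geod_ex u v))). Qed.
Lemma geod_eq u v s : walk u s v -> reduced s -> geod u v = s.
Proof. by move=> sv; apply: reduced_walk_uniq (geodP u v) sv (geod_red u v). Qed.

Lemma geod_in P u s v : path_in P u s v -> path_in P u (geod u v) v.
Proof.
move=> /reduce_walk[t tv rt]; rewrite (@geod_eq _ _ t) //.
by case/path_inP: tv.
Qed.

Lemma geod_id u : geod u u = [::].
Proof. exact: geod_eq. Qed.

Lemma geod_nil u v : geod u v = [::] -> u = v.
Proof. by move=> h; have := geodP u v; rewrite h. Qed.

Lemma geodC u v : geod v u = wrev (geod u v).
Proof.
by apply: geod_eq; [apply/walk_wrev/geodP|apply/reduced_wrev/geod_red].
Qed.

Lemma geod_edge e : geod (orig e) (ter e) = [:: e].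
Proof. by apply: geod_eq. Qed.

Definition dist u v := size (geod u v).

Lemma distC u v : dist u v = dist v u.
Proof. by rewrite /dist geodC size_wrev. Qed.

Lemma dist0 u v : dist u v = 0 -> u = v.
Proof. by move=> /size0nil/geod_nil. Qed.

Lemma distid u : dist u u = 0.
Proof. by rewrite /dist geod_id. Qed.

(** Betweenness, said with geodesics: [m] is a vertex of the geodesic from [u]
    to [v]. *)
Definition btw u m v := geod u v = geod u m ++ geod m v.

Lemma btwl u v : btw u u v.
Proof. by rewrite /btw geod_id. Qed.
Lemma btwr u v : btw u v v.
Proof. by rewrite /btw geod_id cats0. Qed.
Lemma btwC u m v : btw u m v -> btw v m u.
Proof. by rewrite /btw => h; rewrite geodC h wrev_cat -!geodC. Qed.

Lemma btw_dist u m v : btw u m v -> dist u v = dist u m + dist m v.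
Proof. by rewrite /dist => ->; rewrite size_cat. Qed.

Lemma geod_split u v s t m :
  geod u v = s ++ t -> walk u s m -> geod u m = s /\ geod m v = t.
Proof.
move=> h sm; have := geodP u v; rewrite h => /walk_cat[m' sm' mt].
have em : m = m' by rewrite (walk_end sm) (walk_end sm').
rewrite -{m'}em in sm' mt.
have r := geod_red u v; rewrite h in r.
by split; apply: geod_eq => //; [apply: reduced_catl r|apply: reduced_catr r].
Qed.

Lemma geod_splitE u v s t : geod u v = s ++ t ->
  exists m, [/\ btw u m v, geod u m = s & geod m v = t].
Proof.
move=> h; have := geodP u v; rewrite h => /walk_cat[m sm _].
by have [h1 h2] := geod_split h sm; exists m; rewrite /btw h1 h2.
Qed.

Lemma geod_on_walk u v e : on_walk e (geod u v) ->
  [/\ btw u (orig e) v, btw u (ter e) v &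
      geod u v = geod u (orig e) ++ e :: geod (ter e) v].
Proof.
move=> /on_walk_split[s1 [s2 h]].
have [m [bm h1 h2]] := geod_splitE h.
have em : orig e = m by have := geodP m v; rewrite h2 => -[].
rewrite -{m}em in bm h1 h2.
have h' : geod u v = (s1 ++ [:: e]) ++ s2 by rewrite h -catA.
have [m [bm' h1' h2']] := geod_splitE h'.
have em : ter e = m.
  by have := geodP u m; rewrite h1' => /walk_cat[? _ /= [_ _]].
rewrite -{m}em in bm' h1' h2'.
by split=> //; rewrite h1 h2'.
Qed.

Lemma btw_trans u m n v : btw u m v -> btw u n m -> btw u n v.
Proof.
rewrite /btw => h1 h2; rewrite h2 -catA in h1.
have [_ ->] := geod_split h1 (geodP u n); by rewrite h1.
Qed.

Lemma btw_mid u m n v : btw u m v -> btw u n m -> btw n m v.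
Proof.
rewrite /btw => h1 h2; rewrite h2 -catA in h1.
by have [_ ->] := geod_split h1 (geodP u n).
Qed.

Lemma btw_antisym v y z : btw v y z -> btw v z y -> y = z.
Proof.
move=> /btw_dist h1 /btw_dist h2; apply: dist0.
by move: h1; rewrite h2 -addnA => /eqP; rewrite -[X in X == _]addn0 eqn_add2l
  eq_sym addn_eq0 => /andP[_ /eqP].
Qed.

Lemma btw_same u m : btw u m u -> m = u.
Proof.
by move=> /btw_dist; rewrite distid => /esym/eqP; rewrite addn_eq0 =>
  /andP[/eqP/dist0->].
Qed.

(** The concatenation is reduced, and reduced walks are geodesics. *)
Lemma geod_join u m v s e f t : geod u m = s ++ [:: e] -> geod m v = f :: t ->
  f <> erev e -> btw u m v.
Proof.
move=> h1 h2 fe; rewrite /btw; apply: geod_eq.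
  exact: walk_catI (geodP _ _) (geodP _ _).
rewrite h1 h2; apply/reduced_junction; split=> //.
  by rewrite -h1; apply: geod_red.
by rewrite -h2; apply: geod_red.
Qed.

Lemma common_prefix s t : exists p s' t', [/\ s = p ++ s', t = p ++ t' &
  forall e f s1 t1, s' = e :: s1 -> t' = f :: t1 -> e <> f].
Proof.
elim: s t => [|e s IHs] t; first by exists [::], [::], t.
case: t => [|f t]; first by exists [::], (e :: s), [::].
case: (EM (e = f)) => [->|ef].
  have [p [s' [t' [-> -> h]]]] := IHs t.
  by exists (f :: p), s', t'.
by exists [::], (e :: s), (f :: t); split=> // ? ? ? ? [<- _] [<- _].
Qed.

(** The three geodesics issued from [u], [v] and [w] meet at the end of the
    common initial segment of the geodesics from [u] to [v] and to [w]. *)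
Lemma median u v w : exists m, [/\ btw u m v, btw u m w & btw v m w].
Proof.
have [p [s [t [h1 h2 st]]]] := common_prefix (geod u v) (geod u w).
have [m [b1 g1 g1']] := geod_splitE h1.
have [_ g2'] := geod_split h2 (eq_ind _ (fun p => walk u p m) (geodP u m) _ g1).
exists m; split=> //; first by rewrite /btw g1 g2'.
have [sE|[e [s1 sE]]] : s = [::] \/ exists e s1, s = e :: s1.
  by case: s {h1 st g1'} => [|e s1]; [left|right; exists e, s1].
  by rewrite -g1' in sE; rewrite -(geod_nil sE); apply: btwl.
have [tE|[f [t1 tE]]] : t = [::] \/ exists f t1, t = f :: t1.
  by case: t {h2 st g2'} => [|f t1]; [left|right; exists f, t1].
  by rewrite -g2' in tE; rewrite -(geod_nil tE); apply: btwr.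
have ef := st _ _ _ _ sE tE.
apply: (@geod_join _ _ _ (wrev s1) (erev e) f t1).
- by rewrite geodC g1' sE wrev_cons.
- by rewrite g2' tE.
- by rewrite erevK => h; apply: ef.
Qed.

Lemma dist_tri u v w : dist u w <= dist u v + dist v w.
Proof.
have [m [/btw_dist-> /btw_dist-> /btw_dist->]] := median u v w.
rewrite -addnA leq_add2l addnA; exact: leq_addl.
Qed.

Definition conv (Y : vert X -> Prop) :=
  forall u v w, Y u -> Y v -> btw u w v -> Y w.
Definition edge_in (Y : vert X -> Prop) e := Y (orig e) /\ Y (ter e).

(** The projection of [v] to a convex set: the gate through which every geodesic
    from [v] into the set passes. It is the vertex of the set nearest to [v]. *)
Lemma proj_ex Y v y0 : conv Y -> Y y0 ->
  exists2 y, Y y & forall z, Y z -> btw v y z.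
Proof.
move=> cY; have [n] := ubnP (dist v y0); elim: n y0 => // n IHn y0 lt_n Yy0.
case: (EM (forall z, Y z -> btw v y0 z)) => [h|/existsNP[z]]; first by exists y0.
move=> /not_implyP[Yz nb].
have [m [b1 b2 b3]] := median v y0 z.
have Ym : Y m by apply: cY b3.
apply: (IHn m) => //; have := btw_dist b1.
have : dist m y0 != 0 by apply/eqP => /dist0 h; apply: nb; rewrite -h.
by move: lt_n; rewrite -lt0n => lt_n d0 dE; rewrite dE in lt_n;
  apply: leq_trans (_ : dist v m + dist m y0 <= n); rewrite // -[_.+1]addn1 leq_add2l.
Qed.

Lemma proj_uniq (Y : vert X -> Prop) v y z : Y y -> Y z ->
  (forall x, Y x -> btw v y x) -> (forall x, Y x -> btw v z x) -> y = z.
Proof. by move=> Yy Yz hy hz; apply: btw_antisym (hy _ Yz) (hz _ Yy). Qed.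

(** The median of one vertex from each pairwise intersection is in all three
    sets. *)
Lemma helly3 Y1 Y2 Y3 a b c : conv Y1 -> conv Y2 -> conv Y3 ->
  Y1 a -> Y2 a -> Y1 b -> Y3 b -> Y2 c -> Y3 c -> exists m, [/\ Y1 m, Y2 m & Y3 m].
Proof.
move=> c1 c2 c3 a1 a2 b1 b3 d2 d3; have [m [h1 h2 h3]] := median a b c.
by exists m; split; [apply: c1 h1|apply: c2 h2|apply: c3 h3].
Qed.

(** The geodesic uses only edges of the given walk. *)
Lemma conv_walk (Y : vert X -> Prop) :
  (forall u v, Y u -> Y v -> exists s, path_in (edge_in Y) u s v) -> conv Y.
Proof.
move=> h u v w Yu Yv b; have [s /geod_in/path_inP[_ gP]] := h u v Yu Yv.
rewrite b in gP; have := geodP u w.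
case: (lastP (geod u w)) gP => [_ <- //|t e gP].
rewrite -cats1 => /walk_cat[m _ /= [_ _ <-]].
by have [] : edge_in Y e by apply: gP; rewrite -cats1 !on_walk_cat /=; tauto.
Qed.

Lemma geod_conv (Y : vert X -> Prop) u v e : conv Y -> Y u -> Y v ->
  on_walk e (geod u v) -> edge_in Y e.
Proof. by move=> cY Yu Yv /geod_on_walk[b1 b2 _]; split; apply: cY Yu Yv _. Qed.

Lemma edge_neq e : orig e <> ter e.
Proof.
move=> h; have w : walk (orig e) [:: e] (orig e) by split.
by have := closed_nil w; move=> /(_ (conj I I)).
Qed.

Lemma edge_ends e f : orig e = orig f -> ter e = ter f -> e = f.
Proof. by move=> h1 h2; have := geod_edge e; rewrite h1 h2 geod_edge => -[]. Qed.

Lemma geod_cons u v e t : geod u v = e :: t ->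
  [/\ orig e = u, geod (ter e) v = t & btw u (ter e) v].
Proof.
move=> h; have [b1 b2 h'] : [/\ btw u (orig e) v, btw u (ter e) v &
    geod u v = geod u (orig e) ++ e :: geod (ter e) v].
  by apply: geod_on_walk; rewrite h; left.
have ou : orig e = u by have := geodP u v; rewrite h => -[].
by split=> //; move: h'; rewrite ou geod_id h => -[].
Qed.

(** Either the geodesic from the origin of [e] to [v] starts with [e], or [e]
    reversed can be put in front of it without backtrack. *)
Lemma adj_side e v : btw (orig e) (ter e) v \/ btw (ter e) (orig e) v.
Proof.
case E: (geod (ter e) v) => [|f t].
  by left; rewrite -(geod_nil E); apply: btwr.
case: (EM (f = erev e)) => [fe|fe].
  right; have [_ _] := geod_cons E; by rewrite fe ter_rev.
by left; apply: (@geod_join _ _ _ [::] e f t) => //; rewrite geod_edge.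
Qed.

Lemma not_btw_both e v : btw (orig e) (ter e) v -> btw (ter e) (orig e) v -> False.
Proof.
move=> /btw_dist; rewrite /dist geod_edge => h1 /btw_dist.
rewrite /dist (_ : geod (ter e) (orig e) = [:: erev e]); last first.
  by rewrite geodC geod_edge.
rewrite h1 => /eqP; rewrite !add1n => /eqP h2.
by move: (leqnSn (size (geod (ter e) v)).+1); rewrite -h2 ltnn.
Qed.

End Trees.

(** * Group actions on trees: fixed points and axes *)

Section Actions.
Variables (G : groupType) (X : graph) (a : gaction G X).

Lemma act_ter g e : ter (actE a g e) = actV a g (ter e).
Proof. by rewrite /ter act_rev act_orig. Qed.

Lemma walk_act g u s v :
  walk u s v -> walk (actV a g u) (map (actE a g) s) (actV a g v).
Proof.
elim: s u => [|e s IHs] u /=; first by move->.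
by move=> [<- _ /IHs]; rewrite -act_ter; split=> //; rewrite act_orig.
Qed.

Lemma actE_inj g : injective (actE a g).
Proof.
by apply: (can_inj (g := actE a g^-1)) => e; rewrite -actEM mulVg actE1.
Qed.

Lemma reduced_act g (s : seq (edge X)) : reduced s -> reduced (map (actE a g) s).
Proof.
elim: s => [//|e [|f s] IHs] //= [fe rs]; split; last exact: IHs.
by rewrite act_rev => /actE_inj.
Qed.

End Actions.

Section GTrees.
Variables (G : groupType) (T : gtree G).
Implicit Types (u v w : vert T) (e f : edge T) (g h : G).

Local Notation tT := (gtree_tree T).
Local Notation gd := (geod tT).
Local Notation btwT := (btw tT).
Local Notation distT := (dist tT).

Lemma vact1 v : vact 1 v = v. Proof. exact: actV1. Qed.
Lemma vactM g h v : vact (g * h) v = vact g (vact h v). Proof. exact: actVM. Qed.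
Lemma eact1 e : eact 1 e = e. Proof. exact: actE1. Qed.
Lemma eactM g h e : eact (g * h) e = eact g (eact h e). Proof. exact: actEM. Qed.
Lemma vactK g v : vact g^-1 (vact g v) = v.
Proof. by rewrite -vactM mulVg vact1. Qed.
Lemma vactVK g v : vact g (vact g^-1 v) = v.
Proof. by rewrite -vactM mulgV vact1. Qed.
Lemma eactK g e : eact g^-1 (eact g e) = e.
Proof. by rewrite -eactM mulVg eact1. Qed.
Lemma eactVK g e : eact g (eact g^-1 e) = e.
Proof. by rewrite -eactM mulgV eact1. Qed.
Lemma orig_eact g e : orig (eact g e) = vact g (orig e).
Proof. exact: act_orig. Qed.
Lemma erev_eact g e : erev (eact g e) = eact g (erev e).
Proof. exact: act_rev. Qed.
Lemma ter_eact g e : ter (eact g e) = vact g (ter e).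
Proof. by rewrite /ter erev_eact orig_eact. Qed.

Lemma eact_inj g : injective (eact (T := T) g).
Proof. exact: actE_inj. Qed.

Lemma walk_eact g u s v :
  walk u s v -> walk (vact g u) (map (eact g) s) (vact g v).
Proof. exact: walk_act. Qed.

Lemma geod_eact g u v : gd (vact g u) (vact g v) = map (eact g) (gd u v).
Proof.
apply: geod_eq; first exact: walk_eact (geodP _ _ _).
exact: reduced_act (geod_red _ _ _).
Qed.

Lemma btw_vact g u m v : btwT u m v -> btwT (vact g u) (vact g m) (vact g v).
Proof. by rewrite /btw !geod_eact => ->; rewrite map_cat. Qed.

Lemma btw_vactE g u m v : btwT (vact g u) (vact g m) (vact g v) <-> btwT u m v.
Proof. by split; [move/(btw_vact g^-1); rewrite !vactK|apply: btw_vact]. Qed.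

Lemma dist_vact g u v : distT (vact g u) (vact g v) = distT u v.
Proof. by rewrite /dist geod_eact size_map. Qed.

Lemma on_walk_map g e s : on_walk (eact g e) (map (eact g) s) <-> on_walk e (s : seq (edge T)).
Proof.
elim: s => [|f s IHs] //=; rewrite IHs.
by split=> -[]; [move/eact_inj; left|right|move->; left|right].
Qed.

Lemma fix_edge g e : vact g (orig e) = orig e -> vact g (ter e) = ter e ->
  eact g e = e.
Proof.
by move=> h1 h2; apply: (edge_ends tT); rewrite ?orig_eact ?ter_eact.
Qed.

Lemma estab_ends e g : estab e g ->
  vact g (orig e) = orig e /\ vact g (ter e) = ter e.
Proof. by rewrite /estab => h; rewrite -orig_eact -ter_eact h. Qed.

Lemma conv_fix g : conv tT (fun v => vact g v = v).
Proof.
move=> u v w gu gv b; have := geod_eact g u v; rewrite gu gv b map_cat => h.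
have h1 : gd u w = map (eact g) (gd u w).
  have := congr1 (take (size (gd u w))) h.
  by rewrite take_size_cat // take_size_cat // size_map.
have := walk_eact g (geodP tT u w); rewrite gu -h1 => /walk_end ->.
exact/esym/walk_end/geodP.
Qed.

Lemma fix_geod g u v e : vact g u = u -> vact g v = v -> on_walk e (gd u v) ->
  estab e g.
Proof.
move=> gu gv /(geod_conv (@conv_fix g) gu gv)[]; exact: fix_edge.
Qed.

(** The image of the projection is again a gate of the set as seen from [v], and
    gates are unique. *)
Lemma fix_proj g (Y : vert T -> Prop) v y : (forall z, Y z -> Y (vact g z)) ->
  (forall z, Y z -> Y (vact g^-1 z)) -> vact g v = v -> Y y ->
  (forall z, Y z -> btwT v y z) -> vact g y = y.
Proof.
move=> Yg Yg' gv Yy hy; apply: (proj_uniq (Y := Y) (v := v) (tX := tT)) => //.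
  exact: Yg.
by move=> z /Yg'/hy/(btw_vact g); rewrite gv vactVK.
Qed.

Lemma fix_in_conv g (Y : vert T -> Prop) v y : conv tT Y -> Y y ->
  (forall z, Y z -> Y (vact g z)) -> (forall z, Y z -> Y (vact g^-1 z)) ->
  vact g v = v -> exists2 z, Y z & vact g z = z.
Proof.
move=> cY Yy Yg Yg' gv; have [z Yz hz] := proj_ex v cY Yy.
by exists z => //; apply: fix_proj Yg Yg' gv Yz hz.
Qed.

(** Powers of [g] translate a vertex of least displacement along an axis: a
    backtrack there would give a vertex of smaller displacement or an
    inversion. *)
Lemma axis g : exists2 u, (forall k, distT u (vact (g ^+ k) u) = k * distT u (vact g u))%N
  & (distT u (vact g u) = 0%N -> vact g u = u).
Proof.
have [u0] : inhabited (vert T) by case: tT.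
have [u hu] : exists u, forall v, distT u (vact g u) <= distT v (vact g v).
  have [n] := ubnP (distT u0 (vact g u0)); elim: n u0 => // n IHn u0 lt_n.
  case: (EM (forall v, distT u0 (vact g u0) <= distT v (vact g v))).
    by exists u0.
  move=> /existsNP[v /negP]; rewrite -ltnNge => h; apply: (IHn v).
  exact: leq_trans h _.
exists u; last by move/dist0.
have [l0|/eqP lN0] := eqVneq (distT u (vact g u)) 0%N.
  have gu := esym (dist0 l0); rewrite l0 => k; rewrite muln0.
  suff -> : vact (g ^+ k) u = u by rewrite distid.
  by elim: k => [|k IHk]; rewrite ?expg0 ?vact1 // expgS vactM IHk.
(* The translates of the segment from u to g u fit together without backtrack:
   a backtrack either inverts an edge or exhibits a smaller displacement. *)
have join v t : gd u v = gd u (vact g u) ++ t -> btwT u (vact g u) (vact g v).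
  move=> hv; case E: (gd u (vact g u)) => [|e1 q].
    by move: lN0; rewrite /dist E.
  have Ev : gd (vact g u) (vact g v) = eact g e1 :: map (eact g) (q ++ t).
    by rewrite geod_eact hv E.
  have [s [e E']] : exists s e, e1 :: q = s ++ [:: e].
    by exists (belast e1 q), (last e1 q); rewrite cats1 -lastI.
  apply: (geod_join (s := s) (e := e)) Ev _; first by rewrite E.
  move=> back; case: s E' => [[ee _]|_ s [_ qE]].
    by apply: (@gtree_noinv _ T g e1); rewrite [in RHS]ee -back.
  have [o1 g1 _] := geod_cons E.
  rewrite qE in g1.
  have [m [b2 g2 g3]] := geod_splitE g1.
  have om : m = orig e by have := geodP tT m (vact g u); rewrite g3 => -[].
  have hm : vact g (ter e1) = m by rewrite om -ter_eact back ter_rev.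
  have := hu (ter e1); rewrite hm /dist g2 E qE /= size_cat /= addn1.
  by move=> /ltnW; rewrite ltnn.
have pre k : exists t, gd u (vact (g ^+ k.+1) u) = gd u (vact g u) ++ t.
  elim: k => [|k [t IHk]]; first by exists [::]; rewrite cats0.
  by have := join _ _ IHk; rewrite -vactM -expgS => h; eexists; exact: h.
elim=> [|[|k] IHk]; first by rewrite expg0 vact1 distid.
  by rewrite mul1n.
have [t ht] := pre k; have := join _ _ ht; rewrite -vactM -expgS.
by move=> /btw_dist->; rewrite (expgS g k.+1) vactM dist_vact IHk.
Qed.

Lemma dist_move g h u :
  distT u (vact (g * h * g^-1) u) <= distT u (vact g u) + distT u (vact g u) + distT u (vact h u).
Proof.
rewrite !vactM.
have e1 : distT u (vact g^-1 u) = distT u (vact g u).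
  by rewrite -(dist_vact g) vactVK distC.
apply: leq_trans (dist_tri _ _ (vact g u) _) _; rewrite dist_vact.
rewrite -addnA leq_add2l.
apply: leq_trans (dist_tri _ _ (vact h u) _) _; rewrite dist_vact e1.
by rewrite addnC.
Qed.

(** If x^m and x^n are conjugate then their translation lengths m l and n l
    agree, so l = 0. *)
Lemma elliptic_conj_pow (x t : G) m n : m < n -> t * x ^+ m * t^-1 = x ^+ n ->
  exists u, vact x u = u.
Proof.
move=> mn rel; have [u hk h0] := axis x; exists u; apply: h0.
set l := distT u (vact x u) in hk *.
have relk k : t * x ^+ (m * k) * t^-1 = x ^+ (n * k).
  elim: k => [|k IHk]; first by rewrite !muln0 mulg1 mulgV.
  by rewrite !mulnS !expgnDr -rel -IHk !mulgA mulgVK.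
set c := (distT u (vact t u) + distT u (vact t u))%N.
have bound k : n * k * l <= c + m * k * l.
  by rewrite -!hk -relk; apply: dist_move.
have := bound c.+1; case: l {hk bound} => // l h; exfalso.
have : c + m * c.+1 * l.+1 < n * c.+1 * l.+1.
  apply: leq_trans (_ : m.+1 * c.+1 * l.+1 <= _); last by rewrite !leq_mul2r mn !orbT.
  rewrite (mulSn m) mulnDl ltn_add2r; apply: leq_pmulr.
  by [].
by rewrite ltnNge h.
Qed.

(** The orbit of a vertex under a cyclic group with an elliptic non-trivial
    power is bounded, so the translation length is 0. *)
Lemma elliptic_root (x : G) n v : 0 < n -> vact (x ^+ n) v = v ->
  exists u, vact x u = u.
Proof.
move=> n0 xv; have [u hk h0] := axis x; exists u; apply: h0.
set l := distT u (vact x u) in hk *.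
have fixk k : vact (x ^+ (n * k)) v = v.
  elim: k => [|k IHk]; first by rewrite muln0 expg0 vact1.
  by rewrite mulnS expgnDr vactM IHk xv.
have bound k : n * k * l <= distT u v + distT u v.
  rewrite -hk; apply: leq_trans (dist_tri _ _ v _) _.
  by rewrite leq_add2l -[X in distT X _](fixk k) dist_vact distC.
case: l {hk} bound => // l /(_ (distT u v + distT u v).+1)%N.
set c := (_ + _)%N; rewrite leqNgt => /negP[].
apply: leq_trans (_ : n * c.+1 <= _); last exact: leq_pmulr.
exact: leq_pmull.
Qed.

(** Either element preserves the fixed tree of the other, and an elliptic
    element that preserves a convex set fixes a vertex of it. *)
Lemma elliptic_commute (x y : G) u v : commute x y -> vact x u = u ->
  vact y v = v -> exists w, vact x w = w /\ vact y w = w.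
Proof.
move=> xy xu yv.
have cV : commute x y^-1 by apply: commuteV.
have [w xw yw] := @fix_in_conv y (fun z => vact x z = z) v u (@conv_fix x) xu
  (fun z xz => etrans (etrans (esym (vactM _ _ _)) (etrans (congr1 (fun g => vact g z) xy) (vactM _ _ _))) (congr1 _ xz))
  (fun z xz => etrans (etrans (esym (vactM _ _ _)) (etrans (congr1 (fun g => vact g z) cV) (vactM _ _ _))) (congr1 _ xz)) yv.
by exists w.
Qed.

(** Otherwise [e] would lie on the geodesic between two vertices fixed by [x].
    *)
Lemma fix_side x e u : vact x (orig e) = orig e -> ~ estab e x -> vact x u = u ->
  btwT u (orig e) (ter e).
Proof.
move=> xo xe xu; apply: btwC; case: (adj_side tT e u) => // b.
  by case: xe; apply: fix_edge => //; apply: conv_fix xo xu b.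
Qed.

(** The fixed sets of [x] and [y] lie on different sides of [e]. *)
Lemma sep_fix x y e u v : vact x (orig e) = orig e -> vact y (ter e) = ter e ->
  ~ estab e x -> ~ estab e y -> vact x u = u -> vact y v = v -> on_walk e (gd u v).
Proof.
move=> xo yt xe ye xu yv.
have b1 := fix_side xo xe xu.
have b2 : btwT v (ter e) (orig e).
  rewrite -[ter e]/(orig (erev e)) -(ter_rev e).
  apply: (fix_side (x := y)) => //.
  by move=> h; apply: ye; rewrite /estab -[e]erevK -[in RHS](h : eact y _ = _) erev_eact.
have g1 : gd u (ter e) = gd u (orig e) ++ [:: e] by rewrite b1 geod_edge.
case E: (gd (ter e) v) => [|f t].
  by rewrite -(geod_nil E) g1 on_walk_cat /=; tauto.
suff -> : gd u v = gd u (ter e) ++ gd (ter e) v by rewrite g1 !on_walk_cat /=; tauto.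
apply: (geod_join g1 E) => fe; have [_ _ b3] := geod_cons E.
rewrite fe ter_rev in b3.
exact: not_btw_both (btwC b2) b3.
Qed.

End GTrees.

(** * Collapsing edges and twisting actions *)

Section Morphisms.
Variables (R X : graph) (fE : edge R -> option (edge X)).

Lemma pmap_cons_split (s : seq (edge R)) f t : pmap fE s = f :: t ->
  exists q e s2, [/\ s = q ++ e :: s2, (forall x, on_walk x q -> fE x = None) & fE e = Some f].
Proof.
elim: s => [//|e s IHs] /=; case E: (fE e) => [f'|] /=.
  by move=> [<- _]; exists [::], e, s.
move=> /IHs[q [e2 [s2 [-> qN e2E]]]]; exists (e :: q), e2, s2; split=> //.
by move=> x /= [<-|/qN].
Qed.

(** Two successive edges of the image come from two edges of the walk separated
    by collapsed ones, to which the hypothesis applies. *)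
Lemma image_reduced u s v :
  (forall u' e q e2 v' f f2, walk u' (e :: q ++ [:: e2]) v' ->
    reduced (e :: q ++ [:: e2]) ->
    (forall x, on_walk x q -> fE x = None) -> fE e = Some f -> fE e2 = Some f2 ->
    f2 <> erev f) ->
  walk u s v -> reduced s -> reduced (pmap fE s).
Proof.
move=> nb; elim: s u => [//|e s IHs] u wes res.
have ws : walk (ter e) s v by case: wes.
have rs : reduced s by case: res.
rewrite /=; case E: (fE e) => [f|] /=; last exact: IHs ws rs.
case Es: (pmap fE s) => [//|f2 t]; split; last by rewrite -Es; apply: IHs ws rs.
have [q [e2 [s2 [sE qN e2E]]]] := pmap_cons_split Es.
have h : e :: s = (e :: q ++ [:: e2]) ++ s2 by rewrite sE /= -catA.
rewrite h in wes res; case/walk_cat: wes => v' w' _.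
exact: nb w' (reduced_catl res) qN E e2E.
Qed.

End Morphisms.

Lemma reduced_glue (X : graph) (s t : seq (edge X)) : reduced s -> reduced t ->
  (forall e f s1 t1, s = s1 ++ [:: e] -> t = f :: t1 -> f <> erev e) ->
  reduced (s ++ t).
Proof.
case: (lastP s) => [//|s1 e] rs; case: t => [|f t1] rt h; first by rewrite cats0.
rewrite -cats1 in rs h *; apply/reduced_junction; split=> //.
exact: h (erefl _) (erefl _).
Qed.

Section Collapse.
Variables (G : groupType) (T : gtree G) (K : edge T -> Prop).
Hypothesis Kr : forall e, K e -> K (erev e).
Hypothesis Ka : forall g e, K e -> K (eact g e).

Let Kr' e : K (erev e) -> K e. Proof. by move/Kr; rewrite erevK. Qed.
Let Ka' g e : K (eact g e) -> K e. Proof. by move/(Ka g^-1); rewrite eactK. Qed.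

(** Vertices joined by collapsed edges; they become one vertex of the quotient.
    *)
Definition ccls (v u : vert T) := exists s, path_in (fun e => ~ K e) v s u.

Lemma ccls_refl v : ccls v v. Proof. by exists [::]. Qed.
Lemma ccls_sym u v : ccls u v -> ccls v u.
Proof.
move=> [s /path_inP[us sN]]; exists (wrev s); apply/path_inP; split.
  exact: walk_wrev.
by move=> e /on_walk_wrev/sN; apply: contra_not => /Kr.
Qed.
Lemma ccls_trans u v w : ccls u v -> ccls v w -> ccls u w.
Proof.
move=> [s /path_inP[us sN]] [t /path_inP[vt tN]]; exists (s ++ t).
apply/path_inP; split; first exact: walk_catI us vt.
by move=> e /on_walk_cat[/sN|/tN].
Qed.
Lemma ccls_act g u v : ccls u v -> ccls (vact g u) (vact g v).
Proof.
move=> [s /path_inP[us sN]]; exists (map (eact g) s).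
apply/path_inP; split; first exact: walk_eact.
by move=> e; rewrite -[e](eactVK g) => /on_walk_map/sN; apply: contra_not => /Ka'.
Qed.

(** Vertices of the quotient are classes, given as predicates, so that equality
    of vertices is the relation [ccls]. *)
Definition cvertex := {Q : vert T -> Prop | exists v, Q = ccls v}.
Definition cv (v : vert T) : cvertex := exist _ (ccls v) (ex_intro _ v erefl).

Lemma cv_eq u v : cv u = cv v <-> ccls u v.
Proof.
split=> [[h]|uv]; first by rewrite h; apply: ccls_refl.
apply: eq_exist; apply/funext => w; apply/propext.
by split; apply: ccls_trans => //; apply: ccls_sym.
Qed.
Lemma cv_surj (x : cvertex) : exists v, x = cv v.
Proof. by case: x => Q [v QE]; exists v; apply: eq_exist. Qed.

Definition cedge := {e : edge T | K e}.
Definition corig (e : cedge) : cvertex := cv (orig (proj1_sig e)).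
Definition crev (e : cedge) : cedge := exist _ _ (Kr (proj2_sig e)).

Lemma crevK : involutive crev.
Proof. by move=> [e Ke]; apply: eq_exist; rewrite /= erevK. Qed.
Lemma crev_neq e : crev e <> e.
Proof. by case: e => e Ke [/(@erev_neq T e)]. Qed.

Definition cgraph := Graph corig crevK crev_neq.

Lemma cactV_subproof g (x : cvertex) :
  exists v, (fun u => proj1_sig x (vact g^-1 u)) = ccls v.
Proof.
have [v ->] := cv_surj x; exists (vact g v); apply/funext => u /=.
apply/propext; split=> [/(ccls_act g)|/(ccls_act g^-1)].
  by rewrite vactVK.
by rewrite vactK.
Qed.
Definition cactV g (x : cvertex) : cvertex := exist _ _ (cactV_subproof g x).
Definition cactE g (e : cedge) : cedge := exist _ _ (Ka g (proj2_sig e)).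

Lemma cactV_cv g v : cactV g (cv v) = cv (vact g v).
Proof.
apply: eq_exist; apply/funext => u /=; apply/propext.
split=> [/(ccls_act g)|/(ccls_act g^-1)]; first by rewrite vactVK.
by rewrite vactK.
Qed.

Lemma cactV1 x : cactV 1 x = x.
Proof. by have [v ->] := cv_surj x; rewrite cactV_cv vact1. Qed.
Lemma cactVM g h x : cactV (g * h) x = cactV g (cactV h x).
Proof. by have [v ->] := cv_surj x; rewrite !cactV_cv vactM. Qed.
Lemma cactE1 e : cactE 1 e = e.
Proof. by case: e => e Ke; apply: eq_exist; rewrite /= eact1. Qed.
Lemma cactEM g h e : cactE (g * h) e = cactE g (cactE h e).
Proof. by case: e => e Ke; apply: eq_exist; rewrite /= eactM. Qed.
Lemma cact_orig g (e : edge cgraph) : @orig cgraph (cactE g e) = cactV g (@orig cgraph e).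
Proof. by case: e => e Ke; rewrite /= /corig cactV_cv /= orig_eact. Qed.
Lemma cact_rev g (e : edge cgraph) : @erev cgraph (cactE g e) = cactE g (@erev cgraph e).
Proof. by case: e => e Ke; apply: eq_exist; rewrite /= erev_eact. Qed.

Definition caction : gaction G cgraph :=
  @GAction G cgraph cactV cactE cactV1 cactVM cactE1 cactEM cact_orig cact_rev.

Definition kept (e : edge T) : option cedge :=
  if pselect (K e) is left Ke then Some (exist _ e Ke) else None.

Lemma keptP e k : kept e = Some k -> proj1_sig k = e.
Proof. by rewrite /kept; case: pselect => // Ke [<-]. Qed.
Lemma keptK (k : cedge) : kept (proj1_sig k) = Some k.
Proof.
case: k => e Ke /=; rewrite /kept; case: pselect => // Ke'.
by congr Some; apply: eq_exist.
Qed.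
Lemma kept_None e : kept e = None <-> ~ K e.
Proof. by rewrite /kept; case: pselect. Qed.

Lemma pmap_kept_None s : (forall e, on_walk e s -> ~ K e) -> pmap kept s = [::].
Proof.
elim: s => [//|e s IHs] h /=; rewrite (_ : kept e = None) /=; last first.
  by apply/kept_None; apply: h; left.
by apply: IHs => x xs; apply: h; right.
Qed.

(** A reduced walk of the quotient lifts to a reduced walk with prescribed ends:
    the pieces inserted between kept edges consist of collapsed edges. *)
Lemma clift u v (s : seq (edge cgraph)) : walk (cv u : vert cgraph) s (cv v) ->
  reduced s -> exists t, [/\ walk u t v, reduced t & pmap kept t = s].
Proof.
elim: s u => [|k s IHs] u.
  move=> /cv_eq[t /reduce_walk[t' /path_inP[t'v t'N] rt']] _; exists t'.
  by split=> //; apply: pmap_kept_None.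
move=> /= [/esym/cv_eq[q0 /reduce_walk[q /path_inP[qu qN] rq]] _ sv] [ks rs].
have [t [tv rt tE]] := IHs _ sv rs.
exists (q ++ proj1_sig k :: t); split.
- by apply: walk_catI qu _ => /=; split.
- apply: reduced_glue => // [|e f s1 t1 qE [fE _] ef].
    split=> //; case: t tE {tv rt} => // f t /= tE fk; case: s tE ks {IHs sv rs} => [|k' s].
      by rewrite fk -[erev _]/(proj1_sig (crev k)) keptK.
    by rewrite fk -[erev _]/(proj1_sig (crev k)) keptK /= => -[<- _]; apply.
  apply: (qN e); first by rewrite qE on_walk_cat /=; tauto.
  by apply: Kr'; rewrite -ef -fE; apply: (proj2_sig k).
- by rewrite pmap_cat /= keptK /= tE pmap_kept_None.
Qed.

Lemma cwalk u s v : walk u s v -> walk (cv u : vert cgraph) (pmap kept s) (cv v).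
Proof.
elim: s u => [|e s IHs] u /=; first by move->.
move=> [<- _ /IHs sv]; case E: (kept e) => [k|] /=.
  by split=> //; rewrite ?/ter /= /corig /= (keptP E).
suff -> : cv (orig e) = cv (ter e) by [].
by apply/cv_eq; exists [:: e] => /=; split=> //; apply/kept_None.
Qed.

Lemma ctree : is_tree cgraph.
Proof.
have tT := gtree_tree T; split.
- by case: tT => -[v] _ _; constructor; apply: (cv v).
- move=> x y; have [u ->] := cv_surj x; have [v ->] := cv_surj y.
  by exists (pmap kept (geod tT u v)); apply/cwalk/geodP.
- move=> x s; have [u ->] := cv_surj x => sx rs.
  by have [t [tu rt <-]] := clift sx rs; rewrite (closed_nil tT tu rt).
Qed.

Lemma cnoinv : no_inversion caction.
Proof. by move=> g [e Ke] [h]; apply: (@gtree_noinv _ T g e). Qed.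

(** The preimage of an invariant subtree, with all the collapsed edges, is an
    invariant subtree of [T]. *)
Lemma cmin : minimal_action caction.
Proof.
move=> PV PE [[[x0 PVx0] PEr] conn PVa PEa].
pose QV v := PV (cv v).
pose QE e := (~ K e /\ QV (orig e)) \/ exists Ke : K e, PE (exist _ e Ke).
have QVc u v : ccls u v -> QV u -> QV v by move=> /cv_eq; rewrite /QV => ->.
have QEin u s v : path_in (fun e => ~ K e) u s v -> QV u -> path_in QE u s v.
  elim: s u => [//|e s IHs] u /= [<- Ke sv] Qu; split=> //; first by left.
  by apply: IHs sv _; apply: QVc Qu; exists [:: e].
have inv : invariant_subtree (gtree_act T) QV QE.
  split.
  - split; first by have [v x0E] := cv_surj x0; exists v; rewrite /QV -x0E.
    move=> e [[Ke Qe]|[Ke PEe]].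
      split=> //; left; split; first by move/Kr'.
      by apply: QVc Qe; exists [:: e].
    have [h1 h2] := PEr _ PEe; split=> //; right; exists (Kr Ke).
    by rewrite (_ : exist _ _ _ = crev (exist _ e Ke)) //; apply: eq_exist.
  - move=> u v Qu Qv; have [s sP] := conn _ _ Qu Qv.
    elim: s u Qu sP => [|k s IHs] u Qu /=.
      by move=> /cv_eq[s sP]; exists s; apply: QEin.
    move=> [/esym/cv_eq[q qP] PEk sv].
    have Qt : QV (ter (proj1_sig k)) by have [/PEr[_ ]] := PEr _ PEk.
    have [t tP] := IHs _ Qt sv.
    exists (q ++ proj1_sig k :: t).
    have /path_inP[q1 q2] := QEin _ _ _ qP Qu.
    have /path_inP[t1 t2] := tP.
    apply/path_inP; split; first by apply: walk_catI q1 _ => /=; split.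
    move=> e /on_walk_cat[/q2//|/= [<-|/t2//]]; right.
    by exists (proj2_sig k); case: (k) PEk.
  - by move=> g v Qv; rewrite /QV -[actV _ g v]/(vact g v) -cactV_cv; apply: PVa.
  - move=> g e [[Ke Qe]|[Ke PEe]]; last first.
      right; exists (Ka g Ke).
      by rewrite (_ : exist _ _ _ = cactE g (exist _ e Ke)); [apply: PEa|apply: eq_exist].
    left; split; first by move/Ka'.
    by rewrite /QV [orig _]orig_eact -cactV_cv; apply: PVa.
have [allV allE] := @gtree_min _ T _ _ inv; split.
  by move=> x; have [v ->] := cv_surj x; apply: allV.
move=> [e Ke]; have [[]//|[Ke' h]] := allE e.
by rewrite (_ : exist _ _ _ = exist _ e Ke') //; apply: eq_exist.
Qed.

Definition collapse : gtree G := GTree ctree cnoinv cmin.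

End Collapse.

Section Twist.
Variables (G : groupType) (T : gtree G) (sigma : G -> G).
Hypothesis sigmaM : forall g h, sigma (g * h) = sigma g * sigma h.
Hypothesis sigma_surj : forall g, exists h, sigma h = g.

Let sigma1 : sigma 1 = 1.
Proof. by apply: (mulgI (sigma 1)); rewrite -sigmaM !mulg1. Qed.

Definition taction : gaction G T.
Proof.
refine (@GAction G T (fun g => vact (sigma g)) (fun g => eact (sigma g)) _ _ _ _ _ _).
- by move=> v; rewrite sigma1 vact1.
- by move=> g h v; rewrite sigmaM vactM.
- by move=> v; rewrite sigma1 eact1.
- by move=> g h v; rewrite sigmaM eactM.
- by move=> g e; rewrite orig_eact.
- by move=> g e; rewrite erev_eact.
Defined.

Lemma tnoinv : no_inversion taction.
Proof. by move=> g e; apply: (@gtree_noinv _ T). Qed.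
Lemma tmin : minimal_action taction.
Proof.
move=> PV PE [h1 h2 h3 h4]; apply: (@gtree_min _ T); split=> // g.
  by have [h <-] := sigma_surj g; apply: h3.
by have [h <-] := sigma_surj g; apply: h4.
Qed.

Definition twist : gtree G := GTree (gtree_tree T) tnoinv tmin.

End Twist.

(** * Compatible trees and covers by subtrees *)

Section CompatibleCover.
Variables (G : groupType) (T S : gtree G).

(** A common refinement turns each vertex of [S] into a subtree of [T], namely
    the image of its fibre; as an edge of [T] has only one preimage, these
    subtrees do not overlap along edges. *)
Lemma compatible_cover : compatible T S -> exists Z : vert S -> vert T -> Prop,
  [/\ forall k, exists v, Z k v,
      forall k, conv (gtree_tree T) (Z k),
      forall g k v, Z k v -> Z (vact g k) (vact g v) &
      forall k k' e, edge_in (Z k) e -> edge_in (Z k') e -> k = k'].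
Proof.
move=> [R [[fT [eT cT]] [fS [eS cS]]]].
pose Z k v := exists2 r : vert R, fS r = k & fT r = v.
have fib k r r' : fS r = k -> fS r' = k ->
    exists2 s, path_in (fun e => eS e = None /\ fS (orig e) = k) r s r' &
    path_in (edge_in (Z k)) (fT r) (pmap eT s) (fT r').
  move=> rk r'k; have [s sP] : exists s, path_in (fun e => eS e = None) r s r'.
    by apply/(collapse_fiberV cS); rewrite rk.
  exists s.
    elim: s r rk sP => [//|e s IHs] r rk /= [eo eN sP]; split=> //.
      by split=> //; rewrite eo.
    apply: IHs sP; rewrite -rk -eo; apply/(collapse_fiberV cS).
    by exists [:: erev e] => /=; rewrite ter_rev (collapse_rev cS) eN.
  elim: s r rk sP => [|e s IHs] r rk /=; first by move->.
  move=> [eo eN sP].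
  have tk : fS (ter e) = k.
    rewrite -rk -eo; apply/(collapse_fiberV cS).
    by exists [:: erev e] => /=; rewrite ter_rev (collapse_rev cS) eN.
  have := IHs _ tk sP; case E: (eT e) => [f|] /= h.
    have of_ := collapse_orig cT E.
    have tf : ter f = fT (ter e).
      have Er : eT (erev e) = Some (erev f) by rewrite (collapse_rev cT) E.
      exact: (collapse_orig cT Er).
    rewrite tf; split=> //; first by rewrite of_ eo.
    by split; [exists r; rewrite // of_ eo|exists (ter e)].
  suff <- : fT (ter e) = fT r by [].
  rewrite -eo; apply/(collapse_fiberV cT).
  by exists [:: erev e] => /=; rewrite ter_rev (collapse_rev cT) E.
exists Z; split.
- by move=> k; have [r rk] := collapse_surjV cS k; exists (fT r), r.
- move=> k; apply: conv_walk => _ _ [r rk <-] [r' r'k <-].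
  by have [s _ sP] := fib k r r' rk r'k; exists (pmap eT s).
- move=> g k _ [r <- <-]; exists (vact g r).
    by rewrite (collapse_actV cS).
  by rewrite (collapse_actV cT).
- suff key k e : edge_in (Z k) e -> forall e0, eT e0 = Some e -> fS (orig e0) = k.
    move=> k k' e h h'; have [e0 e0E] := collapse_surjE cT e.
    by rewrite -(key k e h e0 e0E) (key k' e h' e0 e0E).
  move=> [[r rk ro] [r' r'k rt]] e0 e0E.
  have [s sP] := fib k r r' rk r'k; rewrite ro rt => /path_inP[w _].
  have es : on_walk e (pmap eT s).
    have P : path_in (fun x => on_walk x (pmap eT s)) (orig e) (pmap eT s) (ter e).
      by apply/path_inP.
    by have := geod_in (gtree_tree T) P; rewrite geod_edge => -[].
  elim: s r {rk ro w} sP es => [//|x s IHs] r /= [_ [_ ox] sP].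
  case E: (eT x) => [f|] /=; last exact: IHs sP.
  case=> [fe|]; last exact: IHs sP.
  by rewrite fe in E; rewrite (collapse_injE cT e0E E).
Qed.

End CompatibleCover.

Section CommonRefinement.
Variables (G : groupType) (T S : gtree G).
Variables (Z : vert T -> vert S -> Prop) (p : edge T -> vert S).

Local Notation tT := (gtree_tree T).
Local Notation tS := (gtree_tree S).

Hypothesis Zne : forall x, exists s, Z x s.
Hypothesis Zconv : forall x, conv tS (Z x).
Hypothesis Zact : forall g x s, Z x s -> Z (vact g x) (vact g s).
Hypothesis pZ : forall e, Z (orig e) (p e).
Hypothesis pr : forall e, p (erev e) = p e.
Hypothesis pact : forall g e, p (eact g e) = vact g (p e).
Hypothesis nofold : forall x x' e, x <> x' -> edge_in (Z x) e -> edge_in (Z x') e ->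
  exists2 t, on_walk t (geod tT x x') & p t <> orig e.

(** The refinement is the subgraph of the product of T and S formed by the slices
   {x} x Z_x and by one copy of each edge t of T over the vertex p_t of S. *)
Definition rvert := {xs : vert T * vert S | Z xs.1 xs.2}.
Definition sedge := {xe : vert T * edge S | edge_in (Z xe.1) xe.2}.
Definition redge := (edge T + sedge)%type.

Definition mkv x s (h : Z x s) : rvert := exist _ (x, s) h.
Definition mke x e (h : edge_in (Z x) e) : sedge := exist _ (x, e) h.

Lemma mkv_eq (r r' : rvert) : (sval r).1 = (sval r').1 ->
  (sval r).2 = (sval r').2 -> r = r'.
Proof.
by case: r r' => [[x s] h] [[x' s'] h'] /= ex es; apply: eq_exist; rewrite ex es.
Qed.
Lemma mke_eq (r r' : sedge) : (sval r).1 = (sval r').1 ->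
  (sval r).2 = (sval r').2 -> r = r'.
Proof.
by case: r r' => [[x s] h] [[x' s'] h'] /= ex es; apply: eq_exist; rewrite ex es.
Qed.

Lemma edge_in_rev (Y : vert S -> Prop) e : edge_in Y e -> edge_in Y (erev e).
Proof. by case=> h1 h2; split; rewrite ?ter_rev. Qed.

Definition rorig (e : redge) : rvert :=
  match e with
  | inl t => mkv (pZ t)
  | inr a => mkv (proj1 (proj2_sig a))
  end.
Definition rrev (e : redge) : redge :=
  match e with
  | inl t => inl (erev t)
  | inr a => inr (mke (edge_in_rev (proj2_sig a)))
  end.
Lemma rrevK : involutive rrev.
Proof.
by case=> [t|a] /=; [rewrite erevK|congr inr; apply: mke_eq => //=; rewrite erevK].
Qed.
Lemma rrev_neq e : rrev e <> e.
Proof.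
case: e => [t|a] /= [h]; first exact: (@erev_neq T t).
by have := congr1 (fun b => (sval b).2) h; apply: erev_neq.
Qed.
Definition rgraph := Graph rorig rrevK rrev_neq.

Implicit Types (q : seq (edge rgraph)) (r : vert rgraph).

Definition rT (e : redge) : option (edge T) := if e is inl t then Some t else None.
Definition rS (e : redge) : option (edge S) :=
  if e is inr a then Some (sval a).2 else None.

Lemma rter_inl t : sval (@ter rgraph (inl t)) = (ter t, p t).
Proof. by rewrite /= /ter /= pr. Qed.

Lemma rwalkT r q r' : walk r q r' -> walk (sval r).1 (pmap rT q) (sval r').1.
Proof.
elim: q r => [|[t|a] q IHq] r /=; first by move->.
  by move=> [<- _ /IHq]; rewrite rter_inl.
by move=> [<- _ /IHq].
Qed.
Lemma rwalkS r q r' : walk r q r' -> walk (sval r).2 (pmap rS q) (sval r').2.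
Proof.
elim: q r => [|[t|a] q IHq] r /=; first by move->.
  by move=> [<- _ /IHq]; rewrite rter_inl.
by move=> [<- _ /IHq].
Qed.

Lemma slice_reduced r q r' : walk r q r' -> (forall e, on_walk e q -> rT e = None) ->
  reduced q -> reduced (pmap rS q) /\ size (pmap rS q) = size q.
Proof.
elim: q r => [//|[t|a] q IHq] r /=; first by move=> _ /(_ _ (or_introl erefl)).
move=> [_ _ wq] h [hq rq].
have [r1 r2] := IHq _ wq (fun e he => h e (or_intror he)) rq.
split; last by rewrite /= r2.
split=> //; case: q {IHq rq r1 r2} wq hq h => [//|[t|b] q] /= [oe _ _] hq h.
  by have := h _ (or_intror (or_introl erefl)).
move=> be; apply: hq; congr inr; apply: mke_eq => //=.
by have := congr1 (fun v => (sval v).1) oe.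
Qed.

Lemma slice_nil r q r' : walk r q r' -> (forall e, on_walk e q -> rT e = None) ->
  reduced q -> (sval r).2 = (sval r').2 -> q = [::].
Proof.
move=> w h rq e; have [rr sz] := slice_reduced w h rq.
have := rwalkS w; rewrite e => /(closed_nil tS)/(_ rr) n.
by apply: size0nil; rewrite -sz n.
Qed.

Lemma slice_lift x s s' (h : Z x s) (h' : Z x s') :
  exists q, walk (mkv h : vert rgraph) q (mkv h' : vert rgraph) /\
    (forall e, on_walk e q -> rT e = None).
Proof.
have : forall e, on_walk e (geod tS s s') -> edge_in (Z x) e.
  by move=> e; apply: geod_conv.
have := geodP tS s s'; move: (geod _ _ _) => t.
elim: t s h => [|e t IHt] s h /=.
  by move=> ss _; exists [::]; split=> //; apply: mkv_eq.
move=> [eo _ wt] hE.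
have he : edge_in (Z x) e by apply: hE; left.
have [q [wq qN]] := IHt _ (proj2 he) wt (fun f hf => hE f (or_intror hf)).
exists (inr (mke he) :: q); split; last by move=> f /= [<-|/qN].
split=> //; first exact: mkv_eq.
have -> // : @ter rgraph (inr (mke he)) = mkv (proj2 he) by apply: mkv_eq.
Qed.

(** A reduced closed walk has a trivial image in [T]: between two edges of the
    walk whose images backtrack there would be a reduced closed walk in a slice.
    So it stays in one slice, which is convex in [S] and therefore a tree. *)
Lemma rtree : is_tree rgraph.
Proof.
split.
- case: tT => -[x] _ _; have [s h] := Zne x; constructor; exact: (mkv h).
- move=> [[x s] h] [[x' s'] h'] /=.
  have := geodP tT x x'; move: (geod _ _ _) => t.
  elim: t x s h => [|e t IHt] x s h /=.
    move=> xx; move: h; rewrite xx => h.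
    have [q [wq _]] := slice_lift h h'; exists q.
    by move: wq; congr walk; apply: mkv_eq.
  move=> [eo _ wt].
  have hp : Z x (p e) by rewrite -eo.
  have hp' : Z (ter e) (p e) by rewrite -pr; apply: pZ.
  have [q1 [w1 _]] := slice_lift h hp.
  have [q2 w2] := IHt (ter e) (p e) hp' wt.
  exists (q1 ++ (inl e : edge rgraph) :: q2).
  have w1' : walk (exist _ (x, s) h : vert rgraph) q1 (rorig (inl e)).
    by move: w1; congr walk; apply: mkv_eq.
  apply: walk_catI w1' _ => /=; split=> //.
  have -> // : @ter rgraph (inl e) = exist _ (ter e, p e) hp'.
  by apply: mkv_eq; rewrite rter_inl.
- move=> r q w rq.
  have N : pmap rT q = [::].
    apply: (closed_nil tT (rwalkT w)); apply: (@image_reduced rgraph T rT _ _ _ _ w rq).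
    move=> u e q' e2 v f f2 + + q'N eE e2E fE.
    case: e eE => [t|a] //= [->]; case: e2 e2E => [t2|a2] //= [->].
    move=> [_ _ /walk_cat[m w1 /= [mE _ _]]] [h r'].
    have q'nil : q' = [::].
      apply: (slice_nil w1 q'N (reduced_catl r')).
      by rewrite rter_inl -mE /= fE pr.
    by rewrite q'nil /= fE in h; case: h.
  apply: (slice_nil w) => //.
  elim: q {w rq} N => [//|[t|a] q IHq] //= N e [<-|] //; exact: IHq.
Qed.

(** A walk over one vertex of [S] consists of copies of edges of [T], and is
    reduced in [T] when it is reduced. *)
Lemma fibre_walk r q r' : walk r q r' -> (forall e, on_walk e q -> rS e = None) ->
  reduced q -> [/\ geod tT (sval r).1 (sval r').1 = pmap rT q,
    (sval r).2 = (sval r').2 &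
    forall t, on_walk t (geod tT (sval r).1 (sval r').1) -> p t = (sval r).2].
Proof.
move=> w qN rq.
have [l qE] : exists l, q = map inl l.
  elim: q {w rq} qN => [|[t|a] q IHq] qN; first by exists [::].
    by have [l ->] := IHq (fun e he => qN e (or_intror he)); exists (t :: l).
  by have := qN _ (or_introl erefl).
have lE : pmap rT q = l by rewrite qE; elim: (l) => //= a l' ->.
have rl : reduced l.
  rewrite qE in rq; elim: (l) rq => [//|a [|b l'] IHl] //= [h rl'].
  by split; [move=> hb; apply: h; rewrite hb|apply: IHl].
have gE : geod tT (sval r).1 (sval r').1 = l.
  by apply: geod_eq => //; rewrite -lE; apply: rwalkT.
rewrite lE gE; rewrite {q lE rl gE qN rq}qE in w.
suff [h1 h2] : (sval r).2 = (sval r').2 /\ forall t, on_walk t l -> p t = (sval r).2 by [].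
elim: l r w => [|t l IHl] r /=; first by move->.
move=> [<- _ /IHl]; rewrite rter_inl /= => -[h1 h2]; split=> //.
by move=> t' [<-|/h2].
Qed.

(** Between two successive copies of an edge of [S] with opposite images, the
    walk stays over one vertex of [S]; then [nofold] forbids the slices of its
    two ends to differ. *)
Lemma image_reducedS r q r' : walk r q r' -> reduced q -> reduced (pmap rS q).
Proof.
apply: (@image_reduced rgraph S rS) => u e q' e2 v f f2 + + q'N eE e2E fE.
case: e eE => [t|[[x a] ha]] //= [fa]; case: e2 e2E => [t2|[[x' b] hb]] //= [fb].
move=> [_ _ /walk_cat[m w1 /= [mE _ _]]] [h rq'].
rewrite -fa -fb in fE => {fa fb}.
have [g1 g2 g3] := fibre_walk w1 q'N (reduced_catl rq').
rewrite -mE /= in g1 g3.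
case: (EM (x = x')) => [xx|xx'].
  rewrite -xx geod_id in g1.
  have q'nil : q' = [::].
    by case: q' q'N g1 {h rq' w1 g3} => [//|[t|c] q'] // /(_ _ (or_introl erefl)).
  by rewrite q'nil /= in h; apply: h; congr inr; apply: mke_eq.
have ha' : edge_in (Z x) (erev a) := edge_in_rev ha.
have hb' : edge_in (Z x') (erev a) by rewrite -fE.
have [t tg] := nofold xx' ha' hb'.
by case; rewrite (g3 _ tg).
Qed.

Lemma fibreS r r' : (sval r).2 = (sval r').2 -> exists2 q,
  path_in (fun e : edge rgraph => rS e = None) r q r' & reduced q.
Proof.
move=> e; exists (geod rtree r r'); last exact: geod_red.
have w := geodP rtree r r'; apply/path_inP; split=> //.
have := rwalkS w; rewrite e => /(closed_nil tS)/(_ (image_reducedS w (geod_red _ _ _))).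
move: (geod _ _ _) => q; elim: q {w} => [//|[t|a] q IHq] //= N f [<-|] //; exact: IHq.
Qed.

Lemma slice_uniq (a b : sedge) : (sval a).2 = (sval b).2 -> a = b.
Proof.
case: a b => [[x a] ha] [[x' b] hb] /= ab; subst b; apply: mke_eq => //=.
case: (EM (x = x')) => // xx'.
have [q /path_inP[wq qN] rq] :=
  @fibreS (mkv (proj2 ha)) (mkv (proj2 hb)) erefl.
have [_ _ h] := fibre_walk wq qN rq.
have [t tg] := nofold xx' (edge_in_rev ha) (edge_in_rev hb).
by case; rewrite (h _ tg).
Qed.

Definition ractV g r : vert rgraph := mkv (Zact g (proj2_sig r)).
Lemma edge_in_act g x e : edge_in (Z x) e -> edge_in (Z (vact g x)) (eact g e).
Proof. by case=> h1 h2; split; rewrite ?orig_eact ?ter_eact; apply: Zact. Qed.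
Definition ractE g (e : edge rgraph) : edge rgraph :=
  match e with
  | inl t => inl (eact g t)
  | inr a => inr (mke (edge_in_act g (proj2_sig a)))
  end.

Definition raction : gaction G rgraph.
Proof.
refine (@GAction G rgraph ractV ractE _ _ _ _ _ _).
- by move=> r; apply: mkv_eq; rewrite /= vact1.
- by move=> g h r; apply: mkv_eq; rewrite /= vactM.
- by case=> [t|a] /=; [rewrite eact1|congr inr; apply: mke_eq; rewrite /= ?vact1 ?eact1].
- by move=> g h [t|a] /=; [rewrite eactM|congr inr; apply: mke_eq; rewrite /= ?vactM ?eactM].
- by move=> g [t|a]; apply: mkv_eq; rewrite /= ?orig_eact ?pact.
- move=> g [t|a] /=; first by rewrite erev_eact.
  by congr inr; apply: mke_eq; rewrite //= erev_eact.
Defined.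

Lemma rnoinv : no_inversion raction.
Proof.
move=> g [t|a] /= [h]; first exact: (@gtree_noinv _ T g t) h.
by apply: (@gtree_noinv _ S g (sval a).2).
Qed.

Lemma rmin : minimal_action raction.
Proof.
move=> PV PE [[[r0 PVr0] PEr] conn PVa PEa].
have allT t : PE (inl t).
  suff inv : invariant_subtree (gtree_act T)
      (fun x => exists2 r, PV r & (sval r).1 = x) (fun t => PE (inl t)).
    by have [_] := @gtree_min _ T _ _ inv; apply.
  split.
  - split; first by exists (sval r0).1, r0.
    by move=> e /PEr[h1 h2]; split=> //; exists (rorig (inl e)).
  - move=> _ _ [r Pr <-] [r' Pr' <-]; have [q qP] := conn _ _ Pr Pr'.
    exists (pmap rT q); elim: q r {Pr} qP => [|[e|a] q IHq] r /=; first by move->.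
      by move=> [<- Pe /IHq]; rewrite rter_inl.
    by move=> [<- _ /IHq].
  - by move=> g _ [r Pr <-]; exists (ractV g r) => //; apply: PVa.
  - by move=> g e; apply: (PEa g (inl e)).
have allS a : PE (inr a).
  suff inv : invariant_subtree (gtree_act S)
      (fun x => exists2 r, PV r & (sval r).2 = x)
      (fun e => exists2 a, PE (inr a) & (sval a).2 = e).
    have [_ /(_ (sval a).2)[b Pb ba]] := @gtree_min _ S _ _ inv.
    by rewrite -(slice_uniq ba).
  split.
  - split; first by exists (sval r0).2, r0.
    move=> _ [b Pb <-]; have [h1 h2] := PEr _ Pb.
    split; first by exists (mke (edge_in_rev (proj2_sig b))).
    by exists (rorig (inr b)).
  - move=> _ _ [r Pr <-] [r' Pr' <-]; have [q qP] := conn _ _ Pr Pr'.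
    exists (pmap rS q); elim: q r {Pr} qP => [|[e|b] q IHq] r /=; first by move->.
      by move=> [<- Pe /IHq]; rewrite rter_inl.
    by move=> [<- Pb /IHq h]; split=> //; exists b.
  - by move=> g _ [r Pr <-]; exists (ractV g r) => //; apply: PVa.
  - move=> g _ [b Pb <-]; exists (mke (edge_in_act g (proj2_sig b))) => //.
    exact: (PEa g (inr b)).
have allE e : PE e by case: e.
split=> // r; have := geodP rtree r r0.
case: (geod _ _ _) => [-> //|e q /= [<- _ _]].
by have [] := PEr _ (allE e).
Qed.

Definition rgtree : gtree G := GTree rtree rnoinv rmin.

(** The fibres of the projection to [T] are the slices; those of the projection
    to [S] are connected by [fibreS], and an edge of [S] is in one slice only,
    by [slice_uniq]. *)
Lemma compatible_of_cover : (forall e, exists x, edge_in (Z x) e) -> compatible T S.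
Proof.
move=> cov; exists rgtree; split.
  exists (fun r => (sval r).1), rT; split.
  - by [].
  - by move=> g [].
  - by case.
  - by move=> [t|a] // e' [->].
  - by move=> x; have [s h] := Zne x; exists (mkv h).
  - by move=> t; exists (inl t).
  - by move=> [t1|a1] [t2|a2] // e' [->] [->].
  - move=> [[x s] h] [[x' s'] h'] /=; split=> [xx'|[q qP]].
      move: h'; rewrite -xx' => h'; have [q [w qN]] := slice_lift h h'.
      by exists q; apply/path_inP; split=> //; move: w; congr walk; apply: mkv_eq.
    have /path_inP[/rwalkT w qN] := qP; move: w.
    have -> // : pmap rT q = [::].
    by elim: q {qP} qN => [//|e q IHq] hq /=; rewrite (hq e (or_introl erefl)) /= IHq // => f hf; apply: hq; right.
exists (fun r => (sval r).2), rS; split.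
- by [].
- by move=> g [].
- by case.
- by move=> [t|a] // e' [<-].
- move=> s; case: (EM (exists e : edge S, orig e = s)) => [[e <-]|hs].
    by have [x h] := cov e; exists (mkv (proj1 h)).
  case: tT => -[x] _ _; have [s' h'] := Zne x; exists (mkv h') => /=.
  have := geodP tS s s'; case: (geod _ _ _) => [-> //|e q /= [eo _ _]].
  by case: hs; exists e.
- by move=> e; have [x h] := cov e; exists (inr (mke h)).
- by move=> [t1|a1] [t2|a2] // e' [<-] [/esym/slice_uniq->].
- move=> r r'; split=> [/fibreS[q qP _]|[q qP]]; first by exists q.
  have /path_inP[/rwalkS w qN] := qP; move: w.
  have -> // : pmap rS q = [::].
  by elim: q {qP} qN => [//|e q IHq] hq /=; rewrite (hq e (or_introl erefl)) /= IHq // => f hf; apply: hq; right.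
Qed.

End CommonRefinement.

Import GRing.Theory Num.Theory Order.TTheory.
Local Close Scope group_scope.

(** * Normal forms in the path group *)

Section NormalForms.
Variable X : vgbs.

(** All vertex groups are embedded in one free abelian group, so that words need
   not be composable to act on states. *)
Definition maxrank : nat := \max_v vrank (v : 'I_(nV X).+1).
Definition amb := 'rV[int]_maxrank.
Definition emb (v : 'I_(nV X).+1) (x : 'rV[int]_(vrank v)) : amb :=
  (x *m pid_mx (vrank v))%R.

Lemma embD v (x y : 'rV[int]_(vrank v)) : emb (x + y)%R = (emb x + emb y)%R.
Proof. by rewrite /emb mulmxDl. Qed.
Lemma emb0 v : emb (0 : 'rV[int]_(vrank v))%R = 0%R.
Proof. by rewrite /emb mul0mx. Qed.
Lemma embN v (x : 'rV[int]_(vrank v)) : emb (- x)%R = (- emb x)%R.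
Proof. by rewrite /emb mulNmx. Qed.

Lemma emb_inj v : injective (@emb v).
Proof.
move=> x y; rewrite /emb => /(congr1 (fun z => z *m (pid_mx (vrank v) : 'M_(_, vrank v)))%R).
rewrite -!mulmxA mul_pid_mx minnn (minn_idPr _) ?leq_bigmax //.
by rewrite pid_mx_1 !mulmx1.
Qed.

Definition oedge : Type := ('I_(nE X) * bool)%type.
Definition oinv (o : oedge) : oedge := (o.1, ~~ o.2).
Lemma oinvK : involutive oinv.
Proof. by case=> e b; rewrite /oinv /= negbK. Qed.

Definition osrc (o : oedge) := if o.2 then eorg o.1 else eter o.1.
Definition oinc (o : oedge) : 'rV[int]_(erank o.1) -> 'rV[int]_(vrank (osrc o)) :=
  match o return 'rV[int]_(erank o.1) -> 'rV[int]_(vrank (osrc o)) with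
  | (e, true) => fun c => (c *m inc_org e)%R
  | (e, false) => fun c => (c *m inc_ter e)%R
  end.

Lemma oincD o c d : oinc (o := o) (c + d)%R = (oinc c + oinc d)%R.
Proof. by case: o c d => e [] c d; rewrite /= mulmxDl. Qed.
Lemma oincN o c : oinc (o := o) (- c)%R = (- oinc c)%R.
Proof. by case: o c => e [] c; rewrite /= mulNmx. Qed.
Lemma oinc0 o : oinc (o := o) 0%R = 0%R.
Proof. by case: o => e []; rewrite /= mul0mx. Qed.
Lemma oinc_inj o : injective (@oinc o).
Proof. by case: o => e []; [apply: inc_org_inj|apply: inc_ter_inj]. Qed.

Definition oim (o : oedge) (c : 'rV[int]_(erank o.1)) : amb := emb (oinc c).
Definition oH (o : oedge) (y : amb) := exists c, y = @oim o c.

Lemma oimD o c d : oim (o := o) (c + d)%R = (oim c + oim d)%R.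
Proof. by rewrite /oim oincD embD. Qed.
Lemma oim_inj o : injective (@oim o).
Proof. by move=> c d /emb_inj/oinc_inj. Qed.

Lemma oH0 o : oH o 0%R.
Proof. by exists 0%R; rewrite /oim oinc0 emb0. Qed.
Lemma oHB o x y : oH o x -> oH o y -> oH o (x - y)%R.
Proof.
by move=> [c ->] [d ->]; exists (c - d)%R; rewrite oimD /oim oincN embN.
Qed.
Lemma oHD o x y : oH o x -> oH o y -> oH o (x + y)%R.
Proof. by move=> [c ->] [d ->]; exists (c + d)%R; rewrite oimD. Qed.
Lemma oHN o x : oH o (- x)%R <-> oH o x.
Proof.
by split=> h; have := oHB (oH0 o) h; rewrite sub0r ?opprK.
Qed.

(** The identification of the two copies of the edge group. *)
Definition ophi (o : oedge) (y : amb) : amb :=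
  if pselect (oH o y) is left h then @oim (oinv o) (proj1_sig (cid h)) else 0%R.
Lemma ophiE o c : ophi o (@oim o c) = @oim (oinv o) c.
Proof.
rewrite /ophi; case: pselect => [h|[]]; last by exists c.
by case: (cid h) => d /= /oim_inj->.
Qed.

Definition pickP (P : amb -> Prop) : amb :=
  if pselect (exists z, P z) is left h then proj1_sig (cid h) else 0%R.
Lemma pickPP P z : P z -> P (pickP P).
Proof.
by move=> Pz; rewrite /pickP; case: pselect => [h|[]]; [case: (cid h)|exists z].
Qed.

(** A representative of [y] modulo the edge group; the class of 0 is represented
    by 0, so that a trivial coset is recognised by its representative. *)
Definition orep (o : oedge) (y : amb) : amb :=
  if pselect (oH o y) then 0%R else pickP (fun z => oH o (y - z)%R).

Lemma orepH o y : oH o (y - orep o y)%R.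
Proof.
rewrite /orep; case: pselect => h; first by rewrite subr0.
by apply: (@pickPP (fun z => oH o (y - z)%R) y); rewrite subrr; apply: oH0.
Qed.
Lemma orep_eq o y z : oH o (y - z)%R -> orep o y = orep o z.
Proof.
move=> yz; rewrite /orep.
have e : oH o y <-> oH o z.
  by split=> h; [have := oHB h yz; rewrite opprB addrC subrK|
    have := oHD yz h; rewrite subrK].
case: pselect => h; case: pselect => h' //; try by case: h'; apply/e.
  by case: h; apply/e.
congr pickP; apply/funext => w; apply/propext; split=> hw.
  by have := oHB hw yz; rewrite opprB addrC addrA subrK.
by have := oHD yz hw; rewrite addrA subrK.
Qed.
Lemma orep0 o y : orep o y = 0%R <-> oH o y.
Proof.
split=> [h|h]; first by have := orepH o y; rewrite h subr0.
by rewrite /orep; case: pselect.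
Qed.
Lemma orep_id o y : orep o (orep o y) = orep o y.
Proof. by apply: orep_eq; rewrite -opprB oHN; apply: orepH. Qed.
Lemma orepDH o y h : oH o h -> orep o (y + h)%R = orep o y.
Proof. by move=> hh; apply: orep_eq; rewrite addrC addKr. Qed.

(** A state (g, s) stands for a normal form: [s] lists, from right to left, the
    edges together with the coset representatives that precede them, and [g] is
    the last vertex element. *)
Definition state : Type := (amb * seq (oedge * amb))%type.

Definition pops (o : oedge) (st : state) : Prop :=
  orep o st.1 = 0%R /\ exists r s, st.2 = (oinv o, r) :: s.

(** Right multiplication of a normal form by an edge: the edge is cancelled
    against the last one if the vertex element between them is in the edge
    group, and appended otherwise. *)
Definition app (o : oedge) (st : state) : state :=
  let r := orep o st.1 in
  let y := ophi o (st.1 - r)%R in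
  if pselect (pops o st) is left _ then
    if st.2 is (_, r') :: s then ((r' + y)%R, s) else st
  else (y, (o, r) :: st.2).

Fixpoint valid (s : seq (oedge * amb)) : Prop :=
  if s is (o, r) :: s' then
    [/\ orep o r = r,
        r = 0%R -> (if s' is (o', _) :: _ then o' <> oinv o else True)
      & valid s']
  else True.

Lemma app_pop o r s c :
  app o (@oim o c, (oinv o, r) :: s) = ((r + @oim (oinv o) c)%R, s).
Proof.
have h : orep o (oim c) = 0%R by apply/orep0; exists c.
rewrite /app /= h subr0 ophiE; case: pselect => // -[]; split=> //.
by exists r, s.
Qed.

Lemma oim_inv o c : @oim (oinv (oinv o)) c = @oim o c.
Proof. by case: o c => e []. Qed.
Lemma app_popV o r s c :
  app (oinv o) (@oim (oinv o) c, (o, r) :: s) = ((r + @oim o c)%R, s).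
Proof. by case: o c => e [] c; [apply: (@app_pop (e, false) r s c)|apply: (@app_pop (e, true) r s c)]. Qed.

Lemma app_push o r c s : orep o r = r ->
  (r = 0%R -> (if s is (o', _) :: _ then o' <> oinv o else True)) ->
  app o ((r + @oim o c)%R, s) = (@oim (oinv o) c, (o, r) :: s).
Proof.
move=> hr hs; have h : orep o (r + oim c)%R = r.
  by rewrite orepDH //; exists c.
rewrite /app /= h addrC addrK ophiE; case: pselect => // -[/=].
by rewrite addrC h => /hs + [r' [s' sE]]; rewrite sE.
Qed.

Lemma app_case o g s : exists r c, [/\ g = (r + @oim o c)%R, orep o r = r &
  (exists r' s', [/\ r = 0%R, s = (oinv o, r') :: s' &
     app o (g, s) = ((r' + @oim (oinv o) c)%R, s')]) \/
  (r = 0%R -> (if s is (o', _) :: _ then o' <> oinv o else True)) /\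
  app o (g, s) = (@oim (oinv o) c, (o, r) :: s)].
Proof.
have [c hc] := orepH o g; set r := orep o g in hc.
have gE : g = (r + oim c)%R by rewrite -hc addrC subrK.
exists r, c; split=> //; first exact: orep_id.
case: (EM (r = 0%R /\ exists r' s', s = (oinv o, r') :: s')).
  move=> [r0 [r' [s' sE]]]; left; exists r', s'; split=> //.
  by rewrite gE sE r0 add0r app_pop.
move=> h; have h2 : r = 0%R -> (if s is (o', _) :: _ then o' <> oinv o else True).
  by move=> r0; case: s h => [//|[o' r'] s'] h oE; apply: h; rewrite oE; split=> //; exists r', s'.
by right; split=> //; rewrite gE app_push //; apply: orep_id.
Qed.

Lemma app_valid o st : valid st.2 -> valid (app o st).2.
Proof.
case: st => g s /= vs; have [r [c [_ hr [[r' [s' [_ sE ->]]]|[h ->]]]]] := app_case o g s.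
  by move: vs; rewrite sE => -[].
by split.
Qed.

(** An edge followed by its inverse cancels: what has been appended is popped,
    and what has been popped is appended again with the same representative, by
    validity. *)
Lemma appK o st : valid st.2 -> app (oinv o) (app o st) = st.
Proof.
case: st => g s /= vs; have [r [c [gE hr [[r' [s' [r0 sE ->]]]|[h ->]]]]] := app_case o g s.
  move: vs; rewrite sE => -[hr' hs' _].
  by rewrite app_push // oim_inv gE r0 add0r.
by rewrite app_popV gE.
Qed.

Definition lact (st : state) (l : letter X) : state :=
  match l with
  | inl x => ((st.1 + emb (tagged x))%R, st.2)
  | inr o => app o st
  end.
Definition wact (w : seq (letter X)) (st : state) : state := foldl lact st w.

Lemma wact_cat w1 w2 st : wact (w1 ++ w2) st = wact w2 (wact w1 st).
Proof. exact: foldl_cat. Qed.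
Lemma wact_valid w st : valid st.2 -> valid (wact w st).2.
Proof.
elim: w st => [//|[x|o] w IHw] st vs /=; first exact: IHw.
by apply: IHw; apply: app_valid.
Qed.

Lemma app_add o c st : app o ((st.1 + @oim o c)%R, st.2) =
  (((app o st).1 + @oim (oinv o) c)%R, (app o st).2).
Proof.
case: st => g s /=.
have [r [d [gE hr [[r' [s' [r0 sE ->]]]|[h ->]]]]] := app_case o g s.
  by rewrite gE r0 add0r -oimD sE app_pop oimD addrA.
by rewrite gE -addrA -oimD app_push // oimD.
Qed.

(** Each defining relation of the path group acts trivially on valid normal
    forms; thus normal forms separate elements of the path group. *)
Lemma weq_wact w1 w2 : weq w1 w2 -> forall st, valid st.2 -> wact w1 st = wact w2 st.
Proof.
elim=> {w1 w2}.
- by [].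
- by move=> w1 w2 _ IH st vs; rewrite IH.
- by move=> w1 w2 w3 _ IH1 _ IH2 st vs; rewrite IH1 ?IH2.
- move=> w1 w1' w2 w2' _ IH1 _ IH2 st vs; rewrite !wact_cat IH1 // IH2 //.
  exact: wact_valid.
- by move=> v [g s] _; rewrite /= emb0 addr0.
- by move=> v x y [g s] _; rewrite /= embD addrA.
- by move=> e b st vs; rewrite /= -[(e, ~~ b)]/(oinv (e, b)) appK.
- move=> e c st vs; rewrite /wact /= -[emb _]/(@oim (oinv (e, true)) c).
  rewrite -(@app_add (e, true) c st) -[(e, false)]/(oinv (e, true)) appK //.
Qed.

End NormalForms.

Local Open Scope group_scope.

(** * The Bass-Serre tree of a graph of free abelian groups *)

(** A connected graph is a tree as soon as its vertices have heights such that
    adjacent heights differ by one and no vertex has two lower neighbours: a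
    reduced walk that has started to climb must go on climbing. *)
Section Heights.
Variables (Y : graph) (h : vert Y -> nat).
Hypothesis ne : inhabited (vert Y).
Hypothesis conn : forall u v : vert Y, exists s, walk u s v.
Hypothesis step : forall e : edge Y, h (ter e) = (h (orig e)).+1 \/
  h (orig e) = (h (ter e)).+1.
Hypothesis desc : forall e f : edge Y, orig e = orig f ->
  h (orig e) = (h (ter e)).+1 -> h (orig f) = (h (ter f)).+1 -> e = f.

Let climb e s u v : walk u (e :: s) v -> reduced (e :: s) ->
  h (ter e) = (h (orig e)).+1 -> h u < h v.
Proof.
elim: s e u => [|f s IHs] e u /=; first by move=> [<- _ <-] _ ->.
move=> [<- _ [fe _ sv]] [ef rs] he.
have hf : h (ter f) = (h (orig f)).+1.
  case: (step f) => // hf; case: ef; apply: desc => //.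
  by rewrite ter_rev.
apply: ltn_trans (IHs f (orig f) _ rs hf); last by split.
by rewrite fe he.
Qed.

Lemma height_tree : is_tree Y.
Proof.
split=> // u s; have [n] := ubnP (size s); elim: n u s => // n IHn u [//|e s] sz w rs.
exfalso; have ou : orig e = u by case: w.
have de : h (orig e) = (h (ter e)).+1.
  by case: (step e) => // /(climb w rs); rewrite ltnn.
have w' := walk_wrev w; have rs' := reduced_wrev rs.
case: (lastP s) w rs sz w' rs' => [|m l] w rs sz w' rs'.
  by case: w => _ _ /= tu; move: de; rewrite tu ou => /n_Sn.
move: w' rs'; rewrite -cats1 -cat_cons wrev_cat => w' rs'.
have dl : h (orig (erev l)) = (h (ter (erev l))).+1.
  by case: (step (erev l)) => // /(climb w' rs'); rewrite ltnn.
have ol : orig (erev l) = u by case: w'.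
have el : e = erev l by apply: desc => //; rewrite ou ol.
have [_ _ /walk_cat[v wm /= [lv _ _]]] : walk u (e :: m ++ [:: l]) u.
  by rewrite cats1.
have vt : v = ter e by rewrite -lv el ter_rev.
rewrite vt in wm.
have rem : reduced (e :: m ++ [:: l]) by rewrite cats1.
have rm : reduced m by case: rem => _ /reduced_catl.
have mN : m = [::].
  apply: IHn wm rm; move: sz; rewrite /= size_rcons ltnS => sz.
  exact: leq_trans sz.
by move: rem; rewrite mN /= => -[+ _]; rewrite el erevK.
Qed.

End Heights.

Section BassSerre.
Variable X : vgbs.
Local Notation G := (pi1 X).
Local Notation vtyp := 'I_(nV X).+1.
Local Notation etyp := 'I_(nE X).
Implicit Types (g h k : G) (v : vtyp) (e : etyp).

(** Paths from the base point to all vertices. *)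
Variable gam : vtyp -> seq (letter X).
Hypothesis gamP : forall v, is_wpath ord0 (gam v) v.
Hypothesis gam0 : gam ord0 = [::].

Lemma weq_catr (a b c : seq (letter X)) : weq b c -> weq (a ++ b) (a ++ c).
Proof. by move=> h; apply: weq_cat h; apply: weq_refl. Qed.
Lemma weq_catl (a b c : seq (letter X)) : weq b c -> weq (b ++ a) (c ++ a).
Proof. by move=> h; apply: weq_cat h _; apply: weq_refl. Qed.
Lemma weq_mid (a b c : seq (letter X)) : weq (a ++ winv c ++ c ++ b) (a ++ b).
Proof.
rewrite (catA (winv c)); apply: weq_catr; rewrite -[X in weq _ X]cat0s.
by apply: weq_catl; apply: weq_inv.
Qed.

Definition based (u v : vtyp) (w : seq (letter X)) := gam u ++ w ++ winv (gam v).

Lemma basedP u v w : is_wpath u w v -> is_wpath ord0 (based u v w) ord0.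
Proof.
move=> uv; apply: is_wpath_cat (gamP u) _; apply: is_wpath_cat uv _.
exact: is_wpath_inv (gamP v).
Qed.

(** Words that are not loops are sent to the trivial loop, so that loops can be
    written as plain words. *)
Definition lof (w : seq (letter X)) : loop X :=
  if pselect (is_wpath ord0 w ord0) is left h then exist _ w h else loop1 X.
Lemma lofE w : is_wpath ord0 w ord0 -> val (lof w) = w.
Proof. by rewrite /lof; case: pselect. Qed.

(** The paths [gam] to the base point close up any path into a loop. *)
Definition pel (u v : vtyp) (w : seq (letter X)) : G := to_pi1 (lof (based u v w)).

Lemma pel_weq u v w w' : is_wpath u w v -> is_wpath u w' v -> weq w w' ->
  pel u v w = pel u v w'.
Proof.
move=> h h' ww; apply/to_pi1P; rewrite !lofE; try exact: basedP.
by apply: weq_catr; apply: weq_catl.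
Qed.

Lemma pelM u v z w w' : is_wpath u w v -> is_wpath v w' z ->
  pel u z (w ++ w') = pel u v w * pel v z w'.
Proof.
move=> h h'; rewrite -[RHS]to_pi1M; apply/to_pi1P; rewrite /= !lofE; try exact: basedP.
  apply: weq_sym; rewrite /based -!catA.
  by rewrite (catA (gam u)) [X in weq _ X]catA; apply: weq_mid.
by apply: basedP; apply: is_wpath_cat h h'.
Qed.

Lemma pel_nil v : pel v v [::] = 1.
Proof.
apply/to_pi1P; rewrite lofE; last by apply: basedP => /=.
by rewrite /based cat0s; have := weq_inv (winv (gam v)); rewrite winvK.
Qed.

Lemma pel_loop (p : loop X) : pel ord0 ord0 (val p) = to_pi1 p.
Proof.
apply/to_pi1P; rewrite lofE; last by apply: basedP; apply: (valP p).
by rewrite /based gam0 /= cats0; apply: weq_refl.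
Qed.

Lemma pel_inv u v w : is_wpath u w v -> pel v u (winv w) = (pel u v w)^-1.
Proof.
move=> h; apply: (mulIg (pel u v w)); rewrite mulVg -pelM //; last exact: is_wpath_inv.
rewrite -(pel_nil v); apply: (pel_weq _ _ (weq_inv w)); last exact: eqxx.
exact: is_wpath_cat (is_wpath_inv h) h.
Qed.

Definition vel v (x : 'rV[int]_(vrank v)) : G := pel v v [:: vlet x].
Definition sel e : G := pel (eorg e) (eter e) [:: elet e true].

Lemma vlet_path v (x : 'rV[int]_(vrank v)) : is_wpath v [:: vlet x] v.
Proof. by rewrite /= /ltgt /= !eqxx. Qed.
Lemma elet_path e : is_wpath (eorg e) [:: elet e true] (eter e).
Proof. by rewrite /= /ltgt /= !eqxx. Qed.

Lemma velD v (x y : 'rV[int]_(vrank v)) : vel (x + y)%R = vel x * vel y.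
Proof.
rewrite -pelM; try exact: vlet_path.
apply: (pel_weq _ _ (weq_sym (weq_add x y))); first exact: vlet_path.
by rewrite /= /ltgt /= !eqxx.
Qed.
Lemma vel0 v : vel (0 : 'rV[int]_(vrank v))%R = 1.
Proof. by apply: (mulgI (vel (0 : 'rV[int]_(vrank v))%R)); rewrite -velD addr0 mulg1. Qed.
Lemma velN v (x : 'rV[int]_(vrank v)) : vel (- x)%R = (vel x)^-1.
Proof. by apply: (mulIg (vel x)); rewrite -velD addNr vel0 mulVg. Qed.
Lemma velX v (x : 'rV[int]_(vrank v)) n : vel x ^+ n = vel (x *+ n)%R.
Proof.
by elim: n => [|n IHn]; rewrite ?expg0 ?mulr0n ?vel0 // expgS mulrS velD IHn.
Qed.
Lemma velC v (x y : 'rV[int]_(vrank v)) : commute (vel x) (vel y).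
Proof. by rewrite /commute -!velD addrC. Qed.

Lemma sel_conj e (c : 'rV[int]_(erank e)) :
  sel e * vel (c *m inc_ter e)%R = vel (c *m inc_org e)%R * sel e.
Proof.
rewrite -!pelM; try exact: vlet_path; try exact: elet_path.
apply: pel_weq; try by rewrite /= /ltgt /= !eqxx.
apply: weq_trans (_ : weq ([:: elet e true; vlet (c *m inc_ter e)%R; elet e false] ++ [:: elet e true]) _); last first.
  by apply: weq_catl; apply: weq_conj.
apply: weq_sym; rewrite -[X in weq _ X]cats0.
rewrite -[X in weq X _]/([:: elet e true; vlet (c *m inc_ter e)%R] ++ [:: elet e false; elet e (~~ false)]).
by apply: weq_catr; apply: weq_edge.
Qed.

Definition Gr v g := exists x, g = @vel v x.
Definition Ce e g := exists c, g = vel (c *m inc_org e)%R.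

Lemma Gr1 v : Gr v 1. Proof. by exists 0%R; rewrite vel0. Qed.
Lemma GrM v g h : Gr v g -> Gr v h -> Gr v (g * h).
Proof. by move=> [x ->] [y ->]; exists (x + y)%R; rewrite velD. Qed.
Lemma GrV v g : Gr v g -> Gr v g^-1.
Proof. by move=> [x ->]; exists (- x)%R; rewrite velN. Qed.
Lemma Ce1 e : Ce e 1. Proof. by exists 0%R; rewrite mul0mx vel0. Qed.
Lemma CeM e g h : Ce e g -> Ce e h -> Ce e (g * h).
Proof. by move=> [x ->] [y ->]; exists (x + y)%R; rewrite mulmxDl velD. Qed.
Lemma CeV e g : Ce e g -> Ce e g^-1.
Proof. by move=> [x ->]; exists (- x)%R; rewrite mulNmx velN. Qed.
Lemma Ce_org e g : Ce e g -> Gr (eorg e) g.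
Proof. by move=> [c ->]; eexists. Qed.
Lemma Ce_ter e g : Ce e g -> Gr (eter e) ((sel e)^-1 * g * sel e).
Proof.
move=> [c ->]; exists (c *m inc_ter e)%R.
by rewrite -mulgA -sel_conj mulKg.
Qed.

(** Vertices and edges are left cosets of the vertex and edge groups. *)
Definition bvert := {p : vtyp * (G -> Prop) | exists g, p.2 = fun h => Gr p.1 (g^-1 * h)}.
Definition bedge := {q : etyp * bool * (G -> Prop) |
  exists g, q.2 = fun h => Ce q.1.1 (g^-1 * h)}.

Definition vtx v g : bvert := exist _ (v, fun h => Gr v (g^-1 * h)) (ex_intro _ g erefl).
Definition edg e b g : bedge :=
  exist _ (e, b, fun h => Ce e (g^-1 * h)) (ex_intro _ g erefl).

Lemma vtx_tag v v' g g' : vtx v g = vtx v' g' -> v = v'.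
Proof. by move=> /(congr1 (fun p => (sval p).1)). Qed.
Lemma vtx_eq v g g' : vtx v g = vtx v g' <-> Gr v (g^-1 * g').
Proof.
split=> [h|h].
  have := congr1 (fun p => (sval p).2 g') h => /= ->.
  by rewrite mulVg; apply: Gr1.
apply: eq_exist; congr pair; apply/funext => k; apply/propext; split=> hk.
  by have := GrM (GrV h) hk; rewrite invgM invgK mulgA mulgK.
by have := GrM h hk; rewrite mulgA mulgK.
Qed.
Lemma edg_tag e e' b b' g g' : edg e b g = edg e' b' g' -> e = e' /\ b = b'.
Proof. by move=> /(congr1 (fun p => (sval p).1)) /= [-> ->]. Qed.
Lemma edg_eq e b g g' : edg e b g = edg e b g' <-> Ce e (g^-1 * g').
Proof.
split=> [h|h].
  have := congr1 (fun p => (sval p).2 g') h => /= ->.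
  by rewrite mulVg; apply: Ce1.
apply: eq_exist; congr pair; apply/funext => k; apply/propext; split=> hk.
  by have := CeM (CeV h) hk; rewrite invgM invgK mulgA mulgK.
by have := CeM h hk; rewrite mulgA mulgK.
Qed.

Lemma vtxP (p : bvert) : exists v g, p = vtx v g.
Proof. by case: p => [[v Q] [g /= QE]]; exists v, g; apply: eq_exist; rewrite QE. Qed.
Lemma edgP (q : bedge) : exists e b g, q = edg e b g.
Proof.
by case: q => [[[e b] Q] [g /= QE]]; exists e, b, g; apply: eq_exist; rewrite QE.
Qed.

Definition borig (q : bedge) : bvert :=
  let g := sval (cid (proj2_sig q)) in let: (e, b) := (sval q).1 in
  if b then vtx (eorg e) g else vtx (eter e) (g * sel e).
Definition brev (q : bedge) : bedge :=
  exist (fun q : etyp * bool * (G -> Prop) => exists g, q.2 = fun h => Ce q.1.1 (g^-1 * h))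
  ((sval q).1.1, ~~ (sval q).1.2, (sval q).2) (proj2_sig q).

Lemma borigE e b g : borig (edg e b g) =
  if b then vtx (eorg e) g else vtx (eter e) (g * sel e).
Proof.
rewrite /borig /=; case: cid => g' /= hg'.
have : Ce e (g'^-1 * g) by have := congr1 (fun f => f g) hg' => /= <-; rewrite mulVg; apply: Ce1.
case: b => h; apply/vtx_eq; first exact: Ce_org.
by have := Ce_ter h; rewrite invgM !mulgA.
Qed.
Lemma brevE e b g : brev (edg e b g) = edg e (~~ b) g.
Proof. exact: eq_exist. Qed.
Lemma brevK : involutive brev.
Proof. by move=> q; have [e [b [g ->]]] := edgP q; rewrite !brevE negbK. Qed.
Lemma brev_neq q : brev q <> q.
Proof.
have [e [b [g ->]]] := edgP q; rewrite brevE => /edg_tag[_].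
by case: (b).
Qed.
Definition bgraph := Graph borig brevK brev_neq.

Definition bactV g (p : bvert) : bvert :=
  let: exist q _ := p in vtx q.1 (g * sval (cid (proj2_sig p))).
Definition bactE g (q : bedge) : bedge :=
  edg (sval q).1.1 (sval q).1.2 (g * sval (cid (proj2_sig q))).

Lemma bactVE g v h : bactV g (vtx v h) = vtx v (g * h).
Proof.
rewrite /bactV /=; case: cid => h' /= hh; apply/vtx_eq.
rewrite invgM -mulgA mulKg.
by have := congr1 (fun f => f h) hh => /= <-; rewrite mulVg; apply: Gr1.
Qed.
Lemma bactEE g e b h : bactE g (edg e b h) = edg e b (g * h).
Proof.
rewrite /bactE /=; case: cid => h' /= hh; apply/edg_eq.
rewrite invgM -mulgA mulKg.
by have := congr1 (fun f => f h) hh => /= <-; rewrite mulVg; apply: Ce1.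
Qed.

Definition baction : gaction G bgraph.
Proof.
refine (@GAction G bgraph bactV bactE _ _ _ _ _ _).
- by move=> p; have [v [g ->]] := vtxP p; rewrite bactVE mul1g.
- by move=> g h p; have [v [k ->]] := vtxP p; rewrite !bactVE mulgA.
- by move=> q; have [e [b [g ->]]] := edgP q; rewrite bactEE mul1g.
- by move=> g h q; have [e [b [k ->]]] := edgP q; rewrite !bactEE mulgA.
- move=> g q; have [e [b [k ->]]] := edgP q.
  by rewrite bactEE /= !borigE; case: (b); rewrite bactVE ?mulgA.
- move=> g q; have [e [b [k ->]]] := edgP q.
  by rewrite bactEE /= !brevE bactEE.
Defined.

Lemma bnoinv : no_inversion baction.
Proof.
move=> g q; have [e [b [k ->]]] := edgP q; rewrite /= bactEE brevE => /edg_tag[_].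
by case: (b).
Qed.

(** The edges issued from a vertex, indexed by oriented edges of the graph. *)
Definition ssel (o : oedge X) : G := if o.2 then sel o.1 else (sel o.1)^-1.
Definition oed (o : oedge X) g : edge bgraph :=
  if o.2 then edg o.1 true g else edg o.1 false (g * (sel o.1)^-1).

Lemma orig_oed o g : orig (oed o g) = vtx (osrc o) g.
Proof.
by case: o => e []; rewrite /oed /= borigE // mulgVK.
Qed.
Lemma bactE_oed h o g : bactE h (oed o g) = oed o (h * g).
Proof. by case: o => e []; rewrite /oed /= bactEE ?mulgA. Qed.
Lemma erev_oed o g : erev (oed o g) = oed (oinv o) (g * ssel o).
Proof.
by case: o => e []; rewrite /oed /ssel /= brevE //= mulgK.
Qed.
Lemma ter_oed o g : ter (oed o g) = vtx (osrc (oinv o)) (g * ssel o).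
Proof. by rewrite /ter erev_oed orig_oed. Qed.

Lemma oed_surj v g (E : edge bgraph) : orig E = vtx v g ->
  exists o x, osrc o = v /\ E = oed o (g * @vel v x).
Proof.
have [e [b [k ->]]] := edgP E; rewrite /= borigE; case: b => h.
  have hv := vtx_tag h; subst v; exists (e, true); rewrite /oed /=.
  by move: (esym h) => /vtx_eq[x hx]; exists x; rewrite -hx mulVKg.
have hv := vtx_tag h; subst v; exists (e, false); rewrite /oed /=.
by move: (esym h) => /vtx_eq[x hx]; exists x; rewrite -hx mulVKg mulgK.
Qed.

Lemma oed_eq o g h : oed o g = oed o h <-> exists c, g^-1 * h = @vel (osrc o) (oinc c).
Proof.
case: o => e [] /=; rewrite /oed /=; first by rewrite edg_eq.
rewrite edg_eq invgM invgK.
split=> [[c hc]|[c hc]]; exists c.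
  by apply: (mulgI (sel e)); rewrite sel_conj -hc !mulgA mulgVK.
by apply: (mulIg (sel e)); rewrite -sel_conj -hc !mulgA mulgVK.
Qed.

Definition base : state X := (0%R, [::]).
(** The normal form of an element depends on the vertex at which its last letter
    ends; multiplying by the vertex group does not change the list of edges,
    whose length is the height of the coset. *)
Definition nf v g : state X := wact (val (repr g) ++ gam v) base.

Lemma nf_pel u v w g : is_wpath u w v -> nf v (g * pel u v w) = wact w (nf u g).
Proof.
move=> uv; rewrite /nf -[in RHS]wact_cat; apply: weq_wact => //.
have : weq (val (repr (g * pel u v w))) (val (repr g) ++ based u v w).
  apply: weq_trans (repr_pi1 _) _; apply: weq_catr.
  by apply: weq_trans (repr_pi1 _) _; rewrite lofE ?basedP //; apply: weq_refl.
move=> h; apply: weq_trans (weq_catl _ h) _; rewrite /based -!catA.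
have := weq_mid (val (repr g) ++ gam u ++ w) [::] (gam v).
by rewrite !cats0 -!catA.
Qed.

Lemma nf_vel v g x : nf v (g * @vel v x) = (((nf v g).1 + emb x)%R, (nf v g).2).
Proof. by rewrite nf_pel ?vlet_path. Qed.
Lemma nf_ssel o g : nf (osrc (oinv o)) (g * ssel o) = app o (nf (osrc o) g).
Proof.
case: o => e [] /=; first by rewrite nf_pel ?elet_path.
rewrite /ssel /osrc /= -pel_inv ?elet_path //.
by rewrite nf_pel ?is_wpath_inv ?elet_path.
Qed.

Definition bhgt (p : bvert) : nat :=
  size (nf (sval p).1 (sval (cid (proj2_sig p)))).2.

Lemma bhgtE v g : bhgt (vtx v g) = size (nf v g).2.
Proof.
rewrite /bhgt /=; case: cid => g' /= hg'.
have : Gr v (g'^-1 * g) by have := congr1 (fun f => f g) hg' => /= <-; rewrite mulVg; apply: Gr1.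
by move=> [x hx]; rewrite -[g](mulVKg g') hx nf_vel.
Qed.

Lemma bstep (E : edge bgraph) : bhgt (ter E) = (bhgt (orig E)).+1 \/
  bhgt (orig E) = (bhgt (ter E)).+1.
Proof.
have [v [g Eo]] := vtxP (orig E); have [o [x [_ ->]]] := oed_surj Eo.
rewrite orig_oed ter_oed !bhgtE nf_ssel.
case: (nf _ _) => y s; have [r [c [_ _ [[r' [s' [_ -> ->]]]|[_ ->]]]]] := app_case o y s.
  by right.
by left.
Qed.

Lemma bdesc_pops o h : bhgt (orig (oed o h)) = (bhgt (ter (oed o h))).+1 ->
  pops o (nf (osrc o) h).
Proof.
rewrite ter_oed orig_oed !bhgtE nf_ssel; case: (nf _ _) => y s.
have [r [c [-> hr [[r' [s' [r0 -> _]]]|[_ ->]]]]] := app_case o y s.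
  by move=> _; split; [rewrite orepDH; [rewrite hr|exists c]|exists r', s'].
by move=> /= /esym hs; have := leqnSn (size s).+1; rewrite hs ltnn.
Qed.

(** Downwards, the edge must cancel the last edge of the normal form, which
    determines it as well as its coset. *)
Lemma bdesc (E F : edge bgraph) : orig E = orig F ->
  bhgt (orig E) = (bhgt (ter E)).+1 -> bhgt (orig F) = (bhgt (ter F)).+1 -> E = F.
Proof.
have [v [g Eo]] := vtxP (orig E); rewrite {1}Eo => /esym Fo.
have [o [x [ov ->]]] := oed_surj Eo; have [o' [x' [ov' ->]]] := oed_surj Fo.
move=> /bdesc_pops; rewrite ov nf_vel => -[/= x0 [r [s sE]]].
move=> /bdesc_pops; rewrite ov' nf_vel => -[/= x'0 [r' [s' s'E]]].
have oo : o' = o.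
  by move: s'E; rewrite sE => -[h1 h2 _ _]; rewrite -[o]oinvK -[o']oinvK /oinv h1 h2.
subst o'; apply/oed_eq; subst v.
have [c hc] := oHB (proj1 (orep0 _ _) x'0) (proj1 (orep0 _ _) x0).
exists c; rewrite invgM mulgA mulgVK -velN -velD; congr vel.
apply: emb_inj; rewrite -[RHS]/(oim c) -hc embD embN opprD addrACA subrr add0r.
exact: addrC.
Qed.

Lemma bconn (p q : vert bgraph) : exists s, walk p s q.
Proof.
have symw p1 q1 : (exists s, walk p1 s q1) -> exists s : seq (edge bgraph), walk q1 s p1.
  by move=> [s h]; exists (wrev s); apply: walk_wrev.
have trw p1 q1 r1 : (exists s, walk p1 s q1) -> (exists s, walk q1 s r1) ->
    exists s : seq (edge bgraph), walk p1 s r1.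
  by move=> [s h] [t h']; exists (s ++ t); apply: walk_catI h h'.
have edw o g : exists s : seq (edge bgraph),
    walk (vtx (osrc o) g : vert bgraph) s (vtx (osrc (oinv o)) (g * ssel o)).
  by exists [:: oed o g] => /=; split; [apply: orig_oed| |apply: ter_oed].
have along u w v g : is_wpath u w v -> exists s : seq (edge bgraph),
    walk (vtx u g : vert bgraph) s (vtx v (g * pel u v w)).
  elim: w u g => [|l w IHw] u g.
    by move=> /= /eqP<-; exists [::]; rewrite pel_nil mulg1.
  move=> /= /andP[/eqP lu wp]; have lp : is_wpath u [:: l] (ltgt l) by rewrite /= lu !eqxx.
  rewrite -cat1s (pelM lp wp) mulgA; apply: trw (IHw _ _ wp).
  case: l lu lp {wp} => [[z x]|[e b]] lu lp; rewrite /= in lu; subst u.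
    exists [::] => /=; apply/vtx_eq; rewrite mulKg; exists x.
    by apply: pel_weq => //; apply: weq_refl.
  case: b lp => lp; first exact: (edw (e, true)).
  have := edw (e, false) g; rewrite /ssel /osrc /=.
  by rewrite -pel_inv ?elet_path.
have root v g : exists s : seq (edge bgraph), walk (vtx ord0 1 : vert bgraph) s (vtx v g).
  have h : is_wpath ord0 (val (repr g) ++ gam v) v.
    by apply: is_wpath_cat (gamP v); apply: (valP (repr g)).
  have := along _ _ _ 1 h; rewrite mul1g (pelM (valP (repr g)) (gamP v)) pel_loop.
  rewrite /to_pi1 reprK (_ : pel ord0 v (gam v) = 1) ?mulg1 //.
  rewrite -(pel_nil ord0); apply/to_pi1P; rewrite !lofE; try exact: basedP.
  rewrite /based gam0 /=; have := weq_inv (winv (gam v)); rewrite winvK.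
  by [].
have [v [g ->]] := vtxP p; have [v' [g' ->]] := vtxP q.
exact: trw (symw _ _ (root v g)) (root v' g').
Qed.

Lemma btree : is_tree bgraph.
Proof.
apply: (@height_tree bgraph bhgt); [|exact: bconn|exact: bstep|exact: bdesc].
by constructor; exact: (vtx ord0 1).
Qed.

Hypothesis org_proper : forall e, exists x, forall c : 'rV[int]_(erank e), x <> (c *m inc_org e)%R.
Hypothesis ter_proper : forall e, exists x, forall c : 'rV[int]_(erank e), x <> (c *m inc_ter e)%R.

Lemma oinc_proper o : exists x, forall c, x <> @oinc X o c.
Proof. by case: o => e []; [apply: org_proper|apply: ter_proper]. Qed.

(** The action on the empty normal form recovers the vector. *)
Lemma vel_inj v : injective (@vel v).
Proof.
move=> x y h; have := @nf_vel v 1 x; rewrite h nf_vel => -[] /addrI.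
by move/emb_inj.
Qed.

(** Each edge group is proper at both ends, so each edge is moved by an element
    fixing one of its ends and lies between a vertex and a translate of this
    vertex. *)
Lemma bmin : minimal_action baction.
Proof.
move=> PV PE [[[p0 PVp0] PEr] conn PVa PEa].
have key (E : edge bgraph) : btw btree p0 (orig E) (ter E) -> PE E.
  have [v [g Et]] := vtxP (ter E).
  have [o [x [ov Eo]]] : exists o x, osrc o = v /\ erev E = oed o (g * @vel v x).
    exact: oed_surj.
  subst v => b; have [y hy] := oinc_proper o.
  pose k := g * vel y * g^-1.
  have kt : actV baction k (ter E) = ter E.
    rewrite Et [LHS]bactVE /k mulgVK; apply/vtx_eq.
    by rewrite invgM mulgVK -velN; exists (- y)%R.
  have kE : actE baction k (erev E) <> erev E.
    rewrite Eo => h; have := etrans (esym (bactE_oed k o (g * vel x))) h.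
    move=> /esym/oed_eq[c]; rewrite /k !mulgA mulgVK invgM -!mulgA mulKg.
    rewrite -velN -!velD => /vel_inj; rewrite addrCA addNr addr0.
    exact: hy.
  have gE : geod btree (ter E) (actV baction k p0) =
      map (actE baction k) (geod btree (ter E) p0).
    apply: geod_eq; last exact/reduced_act/geod_red.
    by rewrite -{1}kt; apply: walk_act; apply: geodP.
  have g1 : geod btree p0 (ter E) = geod btree p0 (orig E) ++ [:: E].
    by rewrite b geod_edge.
  have g2 : geod btree (ter E) p0 = erev E :: wrev (geod btree p0 (orig E)).
    by rewrite geodC g1 wrev_cat.
  have b2 : btw btree p0 (ter E) (actV baction k p0).
    exact: (geod_join g1 (etrans gE (congr1 _ g2))) kE.
  have [s sP] := conn _ _ PVp0 (PVa k _ PVp0).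
  have /path_inP[_ h] := geod_in btree sP.
  by apply: h; rewrite b2 g1 !on_walk_cat /=; tauto.
have allE E : PE E.
  case: (adj_side btree E p0) => h; last by apply: key; apply: btwC.
  have := key (erev E); rewrite ter_rev => /(_ (btwC h))/PEr[].
  by rewrite erevK.
split=> // p; have [s] := bconn p p0; case: s => [-> //|E s [<- _ _]].
by have [] := PEr _ (allE E).
Qed.

Definition bass_serre : gtree G := GTree btree bnoinv bmin.

Lemma vact_vtx h v g : vact h (vtx v g : vert bass_serre) = vtx v (h * g).
Proof. exact: bactVE. Qed.
Lemma eact_edg h e b g : eact h (edg e b g : edge bass_serre) = edg e b (h * g).
Proof. exact: bactEE. Qed.

End BassSerre.

(** * A fixed vertex forced by two compatible trees *)

Section Gates.
Variable X : graph.
Hypothesis tX : is_tree X.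

Lemma btw_join (u m n v : vert X) : btw tX u m n -> btw tX m n v -> m <> n ->
  btw tX u m v.
Proof.
move=> b1 b2 mn.
have [E1|[s [e E1]]] : geod tX u m = [::] \/ exists s e, geod tX u m = s ++ [:: e].
- case: (lastP (geod tX u m)) => [|s e]; first by left.
  by right; exists s, e; rewrite cats1.
- by rewrite (geod_nil E1); apply: btwl.
case E2: (geod tX m n) => [|f t]; first by case: mn; apply: geod_nil E2.
have E3 : geod tX m v = f :: t ++ geod tX n v by rewrite b2 E2.
apply: (geod_join E1 E3).
by have := geod_red tX u n; rewrite b1 E1 E2 => /reduced_junction[].
Qed.

(** Project a vertex of the first set to the second set, and the result back to
    the first set. *)
Lemma gates (Y1 Y2 : vert X -> Prop) y1 y2 : conv tX Y1 -> conv tX Y2 ->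
  Y1 y1 -> Y2 y2 -> exists b c, [/\ Y1 b, Y2 c,
    forall z, Y1 z -> btw tX c b z & forall z, Y2 z -> btw tX b c z].
Proof.
move=> c1 c2 h1 h2; have [c Y2c hc] := proj_ex y1 c2 h2.
have [b Y1b hb] := proj_ex c c1 h1.
exists b, c; split=> // z /hc h; apply: btw_mid h _.
exact/btwC/hb.
Qed.

Lemma gate_btw (Y1 Y2 : vert X -> Prop) b c x y : b <> c ->
  (forall z, Y1 z -> btw tX c b z) -> (forall z, Y2 z -> btw tX b c z) ->
  Y1 x -> Y2 y -> btw tX x b y.
Proof. by move=> bc h1 h2 /h1 bx /h2 cy; apply: btw_join (btwC bx) cy bc. Qed.

End Gates.

Section CommonFixedVertex.
Variables (G : groupType) (T : gtree G).
Local Notation tT := (gtree_tree T).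
Local Notation Fix g := (fun v : vert T => vact g v = v).

Lemma conj_fix (b c : G) (v : vert T) : vact c (vact b^-1 v) = vact b^-1 v <->
  vact (b * c * b^-1) v = v.
Proof.
rewrite !vactM; split=> [->|h]; first by rewrite vactVK.
by rewrite -[LHS](vactK b) h.
Qed.

(** A convex set invariant under b c b^-1 which shares no edge with its
    translate by b does not look from Fix b towards Fix c: it would contain the
    first edge of the way from Fix b to Fix c, and its translate by b as well. *)
Lemma looks_away (b c : G) (Z : vert T -> Prop) beta gam0 e t q :
  conv tT Z -> (forall v, Z v -> Z (vact (b * c * b^-1) v)) ->
  (forall v, Z v -> Z (vact (b * c * b^-1)^-1 v)) ->
  (forall f, edge_in Z f -> edge_in Z (eact b f) -> False) ->
  vact b beta = beta -> vact c gam0 = gam0 ->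
  (forall z, vact b z = z -> btw tT gam0 beta z) ->
  (forall z, vact c z = z -> btw tT beta gam0 z) ->
  geod tT beta gam0 = e :: t -> Z q -> ~ btw tT beta (ter e) q.
Proof.
move=> cZ Zi Zi' Zb bb cc hb hc E Zq bq.
have [oe _ be] := geod_cons E.
have [z Zz zz] : exists2 z, Z z & vact (b * c * b^-1) z = z.
  by apply: (fix_in_conv (v := vact b gam0) cZ Zq Zi Zi'); rewrite !vactM vactK cc.
have E2 : geod tT beta z = eact b e :: map (eact b) (t ++ geod tT gam0 (vact b^-1 z)).
  rewrite -{1}bb -{1}[z](vactVK b) geod_eact.
  by rewrite (hc (vact b^-1 z)) ?E //; apply/conj_fix.
have E1 : geod tT q beta = wrev (geod tT (ter e) q) ++ [:: erev e].
  have oe' : geod tT beta (ter e) = [:: e] by rewrite -oe geod_edge.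
  by rewrite geodC bq oe' wrev_cons.
have ne : eact b e <> erev (erev e).
  rewrite erevK => h; apply: (@edge_neq _ tT e).
  rewrite oe; apply: (btw_antisym (hb (ter e) _) (btwC be)).
  by rewrite -ter_eact h.
have B := geod_join E1 E2 ne.
have inZ f : on_walk f (geod tT q z) -> edge_in Z f by apply: geod_conv.
apply: (Zb e).
  have [] : edge_in Z (erev e) by apply: inZ; rewrite B E1 !on_walk_cat /=; tauto.
  by rewrite ter_rev; split.
by apply: inZ; rewrite B E2 !on_walk_cat /=; tauto.
Qed.

Hypothesis abT : abelian_gtree T.
Variables (a a' b c : G).
Hypothesis aa' : ~ commute a a'.
Hypothesis ea : exists v, Fix a v.
Hypothesis ea' : exists v, Fix a' v.
Hypothesis eb : exists v, Fix b v.
Hypothesis ec : exists v, Fix c v.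

(** Both sets contain vertices fixed by [a] and vertices fixed by [a']. If these
    two fixed sets are disjoint then both sets contain the bridge between them;
    otherwise [a] and [a'] fix one vertex only, since they do not commute and
    [T] is abelian. *)
Lemma common_point (Z1 Z2 : vert T -> Prop) q1 q2 :
  conv tT Z1 -> conv tT Z2 -> Z1 q1 -> Z2 q2 ->
  (forall g v, g = a \/ g = a' -> Z1 v -> Z1 (vact g v) /\ Z1 (vact g^-1 v)) ->
  (forall g v, g = a \/ g = a' -> Z2 v -> Z2 (vact g v) /\ Z2 (vact g^-1 v)) ->
  exists q, Z1 q /\ Z2 q.
Proof.
move=> c1 c2 h1 h2 i1 i2; have [v av] := ea; have [v' av'] := ea'.
have fixZ (Z : vert T -> Prop) q : conv tT Z -> Z q ->
    (forall g v, g = a \/ g = a' -> Z v -> Z (vact g v) /\ Z (vact g^-1 v)) ->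
    (exists2 z, Z z & Fix a z) /\ (exists2 z, Z z & Fix a' z).
  move=> cZ Zq iZ; split.
    by apply: fix_in_conv cZ Zq _ _ av => z /iZ h; have [] := h a (or_introl erefl).
  by apply: fix_in_conv cZ Zq _ _ av' => z /iZ h; have [] := h a' (or_intror erefl).
have [[x1 x1Z ax1] [x1' x1Z' ax1']] := fixZ _ _ c1 h1 i1.
have [[x2 x2Z ax2] [x2' x2Z' ax2']] := fixZ _ _ c2 h2 i2.
have [al [al' [fal fal' hal hal']]] := gates (@conv_fix _ T a) (@conv_fix _ T a') av av'.
case: (EM (al = al')) => [alE|alN]; last first.
  exists al; split.
    exact: c1 x1Z x1Z' (gate_btw alN hal hal' ax1 ax1').
  exact: c2 x2Z x2Z' (gate_btw alN hal hal' ax2 ax2').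
rewrite -alE in fal'.
have [m1 [Zm1 m1a m1a']] := helly3 c1 (@conv_fix _ T a) (@conv_fix _ T a') x1Z ax1 x1Z' ax1' fal fal'.
have [m2 [Zm2 m2a m2a']] := helly3 c2 (@conv_fix _ T a) (@conv_fix _ T a') x2Z ax2 x2Z' ax2' fal fal'.
exists m1; split=> //; suff -> : m1 = m2 by [].
case E: (geod tT m1 m2) => [|e t]; first exact: geod_nil E.
have em : on_walk e (geod tT m1 m2) by rewrite E; left.
by case: aa'; apply: (abT (fix_geod m1a m2a em) (fix_geod m1a' m2a' em)).
Qed.

(** Let [Z1] and [Z2] be the subtrees of [T] over [k1] and [k2]. A vertex [q]
    common to both exists by [common_point]. If the fixed sets of [b] and [c]
    were disjoint then, by [looks_away], [q] would not lie beyond the first edge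
    of the bridge between them, from whichever end the bridge is followed, which
    is impossible. *)
Lemma common_fixed_vertex (S1 S2 : gtree G) (k1 : vert S1) (k2 : vert S2) :
  compatible T S1 -> compatible T S2 ->
  [/\ vact a k1 = k1, vact a' k1 = k1, vact (b * c * b^-1) k1 = k1 & vact b k1 <> k1] ->
  [/\ vact a k2 = k2, vact a' k2 = k2, vact (c * b * c^-1) k2 = k2 & vact c k2 <> k2] ->
  exists v, Fix b v /\ Fix c v.
Proof.
move=> /compatible_cover[Z1 [ne1 cv1 ac1 ov1]] /compatible_cover[Z2 [ne2 cv2 ac2 ov2]].
move=> [ak1 ak1' gk1 bk1] [ak2 ak2' gk2 ck2].
have inv (S : gtree G) (Z : vert S -> vert T -> Prop) k g :
    (forall g k v, Z k v -> Z (vact g k) (vact g v)) -> vact g k = k ->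
    forall v, Z k v -> Z k (vact g v) /\ Z k (vact g^-1 v).
  move=> ac gk v h; split; first by have := ac g _ _ h; rewrite gk.
  by have := ac g^-1 _ _ h; rewrite -{1}gk vactK.
have noov (S : gtree G) (Z : vert S -> vert T -> Prop) k g :
    (forall g k v, Z k v -> Z (vact g k) (vact g v)) ->
    (forall k k' e, edge_in (Z k) e -> edge_in (Z k') e -> k = k') ->
    vact g k <> k -> forall f, edge_in (Z k) f -> edge_in (Z k) (eact g f) -> False.
  move=> ac ov gk f [f1 f2] h; apply: gk; apply: (ov _ _ (eact g f)) => //.
  by split; rewrite ?orig_eact ?ter_eact; apply: ac.
have [v1 Zv1] := ne1 k1; have [v2 Zv2] := ne2 k2.
have [q [Zq1 Zq2]] : exists q, Z1 k1 q /\ Z2 k2 q.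
  apply: common_point (cv1 k1) (cv2 k2) Zv1 Zv2 _ _ => g v [->|->].
  - exact: (inv _ _ _ _ ac1 ak1).
  - exact: (inv _ _ _ _ ac1 ak1').
  - exact: (inv _ _ _ _ ac2 ak2).
  - exact: (inv _ _ _ _ ac2 ak2').
have [vb fb] := eb; have [vc fc] := ec.
have [be [ga [fbe fga hbe hga]]] := gates (@conv_fix _ T b) (@conv_fix _ T c) fb fc.
case E: (geod tT be ga) => [|e t].
  by exists be; split=> //; rewrite (geod_nil E).
case E': (geod tT ga be) => [|e' t'].
  by exists be; split=> //; rewrite -(geod_nil E').
exfalso.
have n1 : ~ btw tT be (ter e) q.
  apply: (looks_away (cv1 k1) _ _ (noov _ _ _ _ ac1 ov1 bk1) fbe fga hbe hga E Zq1).
    by move=> v /(inv _ _ _ _ ac1 gk1)[].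
  by move=> v /(inv _ _ _ _ ac1 gk1)[].
have n2 : ~ btw tT ga (ter e') q.
  apply: (looks_away (cv2 k2) _ _ (noov _ _ _ _ ac2 ov2 ck2) fga fbe hga hbe E' Zq2).
    by move=> v /(inv _ _ _ _ ac2 gk2)[].
  by move=> v /(inv _ _ _ _ ac2 gk2)[].
have [oe _ be'] := geod_cons E.
have b1 : btw tT (ter e) be q.
  by case: (adj_side tT e q); rewrite oe.
have [oe' _ b2] := geod_cons E'.
have b3 : btw tT ga be q.
  apply: btwC; apply: (btw_join (n := ter e)) (btwC b1) be' _.
  by rewrite -oe; apply: edge_neq tT _.
exact: n2 (btw_trans b3 b2).
Qed.

End CommonFixedVertex.

(** * The group of a list of affine rules *)

(** The data (m, r, s) of the matrix [[m, 0], [r, s]]; for s = 1 it sends (k, 1)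
    to (m k + r, 1). *)
Definition tri_data : Type := (nat * nat * nat)%type.
Definition rule : Type := (tri_data * tri_data)%type.

Definition tri (t : tri_data) : 'M[int]_2 :=
  (\matrix_(i, j) if i == 0 then (if j == 0 then t.1.1%:Z else 0)
                 else (if j == 0 then t.1.2%:Z else t.2%:Z))%R.
Definition cfg (x : int) : 'rV[int]_2 := (\row_j if j == 0 then x else 1)%R.

Lemma row2P (x y : 'rV[int]_2) : x ord0 ord0 = y ord0 ord0 ->
  x ord0 (lift ord0 ord0) = y ord0 (lift ord0 ord0) -> x = y.
Proof.
move=> h0 h1; apply/rowP => j; case: (unliftP ord0 j) => [k ->|->] //.
by rewrite (ord1 k).
Qed.
Lemma mul_tri0 (c : 'rV[int]_2) t :
  ((c *m tri t) ord0 ord0 = c ord0 ord0 * t.1.1%:Z + c ord0 (lift ord0 ord0) * t.1.2%:Z)%R.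
Proof. by rewrite mxE !big_ord_recl big_ord0 !mxE /= addr0. Qed.
Lemma mul_tri1 (c : 'rV[int]_2) t :
  ((c *m tri t) ord0 (lift ord0 ord0) = c ord0 (lift ord0 ord0) * t.2%:Z)%R.
Proof. by rewrite mxE !big_ord_recl big_ord0 !mxE /= mulr0 add0r addr0. Qed.
Lemma cfgE x : (cfg x ord0 ord0 = x /\ cfg x ord0 (lift ord0 ord0) = 1)%R.
Proof. by split; rewrite mxE. Qed.
Lemma mul_cfg (c : 'rV[int]_1) x : (c *m cfg x = c ord0 ord0 *: cfg x)%R.
Proof. by apply/rowP => j; rewrite !mxE big_ord1 !mxE. Qed.

Lemma posz_neq0 n : 0 < n -> (n%:Z != 0)%R.
Proof. by case: n. Qed.

Lemma tri_inj t : 0 < t.1.1 -> 0 < t.2 -> injective (fun c : 'rV[int]_2 => c *m tri t)%R.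
Proof.
move=> t1 t2 c d /= h.
have h1 : c ord0 (lift ord0 ord0) = d ord0 (lift ord0 ord0).
  have := congr1 (fun m : 'rV_2 => m ord0 (lift ord0 ord0)) h.
  by rewrite !mul_tri1; apply/mulIf/posz_neq0.
apply: row2P => //.
have := congr1 (fun m : 'rV_2 => m ord0 ord0) h.
rewrite !mul_tri0 h1 => /addIr; exact/mulIf/posz_neq0.
Qed.

Definition wf_tri (t : tri_data) := [&& odd t.1.1, 1 < t.1.1 & odd t.2].
(** Odd entries keep parities; a diagonal entry different from 1 makes the edge
    groups proper; and the condition on the last entries prevents a rule from
    leaving the vectors (x, 1). *)
Definition wf_rule (r : rule) := [&& wf_tri r.1, wf_tri r.2 & (r.1.2 == 1)%N == (r.2.2 == 1)%N].
(** It identifies 3 u with a conjugate of 5 u for all vectors u, and does not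
    apply to vectors (x, 1). *)
Definition scale_rule : rule := ((3, 0, 3), (5, 0, 5)).

(** The vertex 0 carries Z^2 and the vertices 1 and 2 carry Z. The edges 0 and 1
    join them to the vertex 0; the other edges are loops at 0, one for each
    rule. *)
Definition erk (i : nat) : nat := if i is _.+2 then 2 else 1.
Definition tvn (i : nat) : nat := match i with 0 => 1 | 1 => 2 | _ => 0 end.
Definition vrk (v : nat) : nat := if v is 0 then 2 else 1.
Lemma tvn_lt i : tvn i < 3. Proof. by case: i => [|[|]]. Qed.

Section MachineGroup.
Variables (num : bool -> int) (L : seq rule).
Hypothesis wfL : all wf_rule L.

Lemma wf_nth i : wf_rule (nth scale_rule L i).
Proof.
have [i_lt|i_ge] := ltnP i (size L); last by rewrite nth_default.
exact: (allP wfL) (mem_nth _ _).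
Qed.

Definition iorg (i : nat) : 'M[int]_(erk i, vrk 0) :=
  match i with
  | 0 => cfg (num false) | 1 => cfg (num true) | i.+2 => tri (nth scale_rule L i).1
  end.
Definition iter_ (i : nat) : 'M[int]_(erk i, vrk (tvn i)) :=
  match i with
  | 0 => const_mx 2%R | 1 => const_mx 2%R | i.+2 => tri (nth scale_rule L i).2
  end.

Lemma cfg_inj x : injective (fun c : 'rV[int]_1 => c *m cfg x)%R.
Proof.
move=> c d /= h; apply/rowP => j; rewrite (ord1 j).
have := congr1 (fun m : 'rV_2 => m ord0 (lift ord0 ord0)) h.
by rewrite !mul_cfg !mxE /= !mulr1.
Qed.
Lemma two_inj : injective (fun c : 'rV[int]_1 => c *m (const_mx 2 : 'M_1))%R.
Proof.
move=> c d /= h; apply/rowP => j; rewrite (ord1 j).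
have := congr1 (fun m : 'rV_1 => m ord0 ord0) h.
by rewrite !mxE !big_ord1 !mxE; apply: mulIf.
Qed.
Lemma iorg_inj i : injective (fun c : 'rV[int]_(erk i) => c *m iorg i)%R.
Proof.
case: i => [|[|i]]; try exact: cfg_inj.
have /and3P[/and3P[_ h1 h2] _ _] := wf_nth i.
by apply: tri_inj; [apply: ltnW|apply: odd_gt0].
Qed.
Lemma iter_inj i : injective (fun c : 'rV[int]_(erk i) => c *m iter_ i)%R.
Proof.
case: i => [|[|i]]; try exact: two_inj.
have /and3P[_ /and3P[_ h1 h2] _] := wf_nth i.
by apply: tri_inj; [apply: ltnW|apply: odd_gt0].
Qed.

Definition eterX (e : 'I_(size L).+2) : 'I_3 := Ordinal (tvn_lt e).
Definition ej (j : bool) : 'I_(size L).+2 :=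
  if j then lift ord0 ord0 else ord0.
Definition vj (j : bool) : 'I_3 := if j then ord_max else lift ord0 ord0.

Lemma eter_ej j : eterX (ej j) = vj j.
Proof. by case: j; apply: val_inj. Qed.

Lemma machine_connected (u v : 'I_3) :
  connect (fun u v => [exists e, [|| (ord0 == u :> 'I_3) && (eterX e == v)
                                   | (ord0 == v :> 'I_3) && (eterX e == u)]]) u v.
Proof.
have h0 (w : 'I_3) : connect (fun u v => [exists e, [|| (ord0 == u :> 'I_3) && (eterX e == v)
                                   | (ord0 == v :> 'I_3) && (eterX e == u)]]) ord0 w /\
  connect (fun u v => [exists e, [|| (ord0 == u :> 'I_3) && (eterX e == v)
                                   | (ord0 == v :> 'I_3) && (eterX e == u)]]) w ord0.
  have [->|[j ->]] : w = ord0 \/ exists j, w = vj j.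
  - case: w => [[|[|[|//]]] lt]; first by left; apply: val_inj.
      by right; exists false; apply: val_inj.
    by right; exists true; apply: val_inj.
  - by split; apply: connect0.
  by split; apply: connect1; apply/existsP; exists (ej j); rewrite eter_ej !eqxx ?orbT.
exact: connect_trans (proj2 (h0 u)) (proj1 (h0 v)).
Qed.

Definition machine_vgbs : vgbs :=
  @VGBS 2 (size L).+2 (fun=> ord0) eterX (fun v => vrk v) (fun e => erk e)
    (fun e => iorg e) (fun e => iter_ e) (fun e => iorg_inj (i := e))
    (fun e => iter_inj (i := e)) machine_connected.
Local Notation X := machine_vgbs.
Local Notation G := (pi1 X).

Definition gamX (v : 'I_(nV X).+1) : seq (letter X) :=
  match val v with 0 => [::] | 1 => [:: @elet X (ej false) true]
  | _ => [:: @elet X (ej true) true] end.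

Lemma gamXP v : is_wpath ord0 (gamX v) v.
Proof. by case: v => [[|[|[|//]]] lt] //=; rewrite /ltgt /=; apply/eqP/val_inj. Qed.
Lemma gamX0 : gamX ord0 = [::]. Proof. by []. Qed.

(** The vector (1, 0) is not in the edge group. *)
Lemma tri_proper t (c : 'rV[int]_2) : wf_tri t ->
  (\row_j (if j == 0 then 1 else 0) <> c *m tri t)%R.
Proof.
move=> /and3P[_ t1 /odd_gt0 t2] h.
have := congr1 (fun m : 'rV_2 => m ord0 (lift ord0 ord0)) h.
rewrite mul_tri1 mxE /= => /esym/eqP; rewrite mulf_eq0 (negPf (posz_neq0 t2)) orbF.
move=> /eqP c1; have := congr1 (fun m : 'rV_2 => m ord0 ord0) h.
rewrite mul_tri0 mxE /= c1 mul0r addr0 => /(congr1 absz); rewrite abszM => /esym/eqP.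
by rewrite muln_eq1 => /andP[_ /eqP t1E]; rewrite /= in t1E; rewrite t1E in t1.
Qed.
Lemma cfg_proper (c : 'rV[int]_1) x : (\row_j (if j == 0 then 1 else 0) <> c *m cfg x)%R.
Proof.
move=> h; have := congr1 (fun m : 'rV_2 => m ord0 (lift ord0 ord0)) h.
have := congr1 (fun m : 'rV_2 => m ord0 ord0) h.
by rewrite !mul_cfg !mxE /= mulr1 => + h0; rewrite -h0 mul0r.
Qed.
Lemma two_proper (c : 'rV[int]_1) : (const_mx 1 <> c *m (const_mx 2 : 'M_1))%R.
Proof.
move=> h; have := congr1 (fun m : 'rV_1 => absz (m ord0 ord0)) h.
by rewrite !mxE big_ord1 !mxE abszM => /esym/eqP; rewrite muln_eq1 andbF.
Qed.

Lemma iorg_proper (e : 'I_(nE X)) : exists x : 'rV[int]_(vrank (eorg e)),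
  forall c : 'rV[int]_(erank e), x <> (c *m inc_org e)%R.
Proof.
exists (\row_j (if j == 0 then 1 else 0))%R => c; case: e c => [[|[|i]] lt] c.
- exact: cfg_proper.
- exact: cfg_proper.
by have /and3P[h _ _] := wf_nth i; apply: tri_proper.
Qed.
Lemma iter_proper (e : 'I_(nE X)) : exists x : 'rV[int]_(vrank (eter e)),
  forall c : 'rV[int]_(erank e), x <> (c *m inc_ter e)%R.
Proof.
case: e => [[|[|i]] lt].
- by exists (const_mx 1%R) => c; apply: two_proper.
- by exists (const_mx 1%R) => c; apply: two_proper.
exists (\row_j (if j == 0 then 1 else 0))%R => c.
by have /and3P[_ h _] := wf_nth i; apply: (tri_proper h).
Qed.

Definition TX : gtree G := bass_serre gamXP gamX0 iorg_proper iter_proper.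

End MachineGroup.

(** * Twisting one edge letter by a centralising loop *)

(** The automorphism of the fundamental group that replaces the letter of an
    edge [e0] by [u e0], where [u] is a loop that centralises the edge group. *)
Section Substitution.
Variables (X : vgbs) (e0 : 'I_(nE X)).
Implicit Types (u w : seq (letter X)).

Definition free : pred (letter X) := fun l => if l is inr (e, _) then e != e0 else true.
Definition twl u (l : letter X) : seq (letter X) :=
  if free l then [:: l]
  else if l is inr (_, true) then u ++ [:: l] else l :: winv u.
Definition tw u w := flatten (map (twl u) w).

Lemma tw_cat u w1 w2 : tw u (w1 ++ w2) = tw u w1 ++ tw u w2.
Proof. by rewrite /tw map_cat flatten_cat. Qed.
Lemma tw_free u w : all free w -> tw u w = w.
Proof. by elim: w => [//|l w IHw] /= /andP[fl /IHw h]; rewrite /tw /= /twl fl -/(tw u w) h. Qed.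
Lemma free_winv w : all free (winv w) = all free w.
Proof.
rewrite /winv all_rev all_map; apply: eq_all => -[x|[e b]] //.
Qed.

Section OneLoop.
Variable u : seq (letter X).
Hypothesis uP : is_wpath (eorg e0) u (eorg e0).
Hypothesis uC : forall c : 'rV[int]_(erank e0),
  weq (u ++ [:: vlet (c *m inc_org e0)%R]) (vlet (c *m inc_org e0)%R :: u).

Lemma tw_path a w b : is_wpath a w b -> is_wpath a (tw u w) b.
Proof.
elim: w a => [//|l w IHw] a /= /andP[/eqP la /IHw wb].
rewrite /tw /= -/(tw u w); apply: is_wpath_cat wb.
rewrite -la /twl; case: ifP => fl; first by rewrite /= !eqxx.
case: l {la} fl => [//|[e b']] /negbFE/eqP->; case: b'.
  by apply: is_wpath_cat uP _; rewrite /= !eqxx.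
by rewrite /= eqxx /=; apply: is_wpath_inv.
Qed.

Lemma uV : weq (u ++ winv u) [::].
Proof. by have := weq_inv (winv u); rewrite winvK. Qed.

Lemma tw_weq w1 w2 : weq w1 w2 -> weq (tw u w1) (tw u w2).
Proof.
elim=> {w1 w2}.
- by move=> w; apply: weq_refl.
- by move=> w1 w2 _; apply: weq_sym.
- by move=> w1 w2 w3 _ h1 _ h2; apply: weq_trans h1 h2.
- by move=> w1 w1' w2 w2' _ h1 _ h2; rewrite !tw_cat; apply: weq_cat.
- by move=> v; apply: weq_one.
- by move=> v x y; apply: weq_add.
- move=> e b; rewrite /tw /= /twl /=; case: eqP => [->|_] /=; last exact: weq_edge.
  case: b => /=; rewrite !cats0.
    rewrite -catA; apply: weq_trans uV; apply: weq_catr.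
    exact: (@weq_catl _ (winv u) [:: elet e0 true; elet e0 (~~ true)] [::] (weq_edge e0 true)).
  apply: weq_trans (weq_edge e0 false).
  rewrite -[X in weq X _]/([:: elet e0 false] ++ winv u ++ u ++ [:: elet e0 true]).
  exact: weq_mid.
- move=> e c; rewrite /tw /= /twl /=; case: eqP => [ee|_] /=; last exact: weq_conj.
  subst e; rewrite cats0 -!catA.
  apply: weq_trans (_ : weq (u ++ [:: vlet (c *m inc_org e0)%R] ++ winv u) _).
    apply: weq_catr; rewrite -[X in weq X _]/([:: elet e0 true; vlet (c *m inc_ter e0)%R; elet e0 false] ++ winv u).
    by apply: weq_catl; apply: weq_conj.
  rewrite catA; apply: weq_trans (weq_catl _ (uC c)) _.
  rewrite -[X in weq X _]/([:: vlet (c *m inc_org e0)%R] ++ u ++ winv u).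
  by rewrite -[X in weq _ X]cats0; apply: weq_catr; apply: uV.
Qed.

Definition sigma (g : pi1 X) : pi1 X :=
  to_pi1 (exist _ (tw u (val (repr g))) (tw_path (valP (repr g)))).

Lemma sigma_lof w : is_wpath ord0 w ord0 ->
  sigma (to_pi1 (lof w)) = to_pi1 (lof (tw u w)).
Proof.
move=> wp; apply/to_pi1P; rewrite /= lofE; last exact: tw_path.
by apply: tw_weq; apply: weq_trans (repr_pi1 _) _; rewrite lofE //; apply: weq_refl.
Qed.

Lemma sigmaM g h : sigma (g * h) = sigma g * sigma h.
Proof.
rewrite -[RHS]to_pi1M; apply/to_pi1P; rewrite /= -tw_cat; apply: tw_weq.
exact: repr_pi1.
Qed.

End OneLoop.

Variable u : seq (letter X).
Hypothesis uP : is_wpath (eorg e0) u (eorg e0).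
Hypothesis uC : forall c : 'rV[int]_(erank e0),
  weq (u ++ [:: vlet (c *m inc_org e0)%R]) (vlet (c *m inc_org e0)%R :: u).
Hypothesis uf : all free u.

Let uP' : is_wpath (eorg e0) (winv u) (eorg e0). Proof. exact: is_wpath_inv. Qed.
Let uC' (c : 'rV[int]_(erank e0)) :
  weq (winv u ++ [:: vlet (c *m inc_org e0)%R]) (vlet (c *m inc_org e0)%R :: winv u).
Proof.
set x := vlet _.
apply: weq_trans (_ : weq (winv u ++ (u ++ [:: x]) ++ winv u) _); last first.
  rewrite -!catA -[X in weq _ X]cat0s catA -[x :: winv u]/([:: x] ++ winv u).
  by apply: weq_catl; apply: weq_inv.
apply: weq_catr; apply: weq_sym; apply: weq_trans (weq_catl _ (uC c)) _.
rewrite -/x -[X in weq X _]/([:: x] ++ u ++ winv u) -[X in weq _ X]cats0.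
by apply: weq_catr; apply: uV.
Qed.

Lemma twK w : weq (tw (winv u) (tw u w)) w.
Proof.
elim: w => [|l w IHw]; first exact: weq_refl.
rewrite -[tw u (l :: w)]/(twl u l ++ tw u w) tw_cat.
rewrite -[X in weq _ X]/([:: l] ++ w); apply: weq_cat IHw.
rewrite /twl; case: ifP => fl; first by rewrite tw_free /= ?fl //; apply: weq_refl.
have fw : all free (winv u) by rewrite free_winv.
case: l fl => [//|[e b]] fl; case: b fl => fl.
  rewrite tw_cat (tw_free _ uf) /tw /= /twl fl cats0 catA.
  rewrite -[X in weq _ X]cat0s; apply: weq_catl; apply: uV.
rewrite -[(_, false) in X in weq X _]/((_, false)) -[inr _ :: winv u]/([:: inr (e, false)] ++ winv u).
rewrite tw_cat (tw_free _ fw) /tw /= /twl fl cats0 winvK.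
rewrite -[X in weq X _]/([:: inr (e, false)] ++ u ++ winv u) -[X in weq _ X]cats0.
by apply: weq_catr; apply: uV.
Qed.

Lemma sigmaK g : sigma uP' (sigma uP g) = g.
Proof.
rewrite -[RHS]reprK -/(to_pi1 _); apply/to_pi1P; rewrite /=.
apply: weq_trans (twK _); apply: (tw_weq uC').
exact: repr_pi1.
Qed.

Lemma sigma_inj : injective (sigma uP).
Proof. exact: can_inj sigmaK. Qed.

End Substitution.

Lemma sigma_surj (X : vgbs) (e0 : 'I_(nE X)) (u : seq (letter X))
  (uP : is_wpath (eorg e0) u (eorg e0))
  (uC : forall c : 'rV[int]_(erank e0),
  weq (u ++ [:: vlet (c *m inc_org e0)%R]) (vlet (c *m inc_org e0)%R :: u))
  (uf : all (free e0) u) (g : pi1 X) : exists h, sigma uP h = g.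
Proof.
exists (sigma (is_wpath_inv uP) g).
rewrite -[RHS]reprK -/(to_pi1 _); apply/to_pi1P; rewrite /=.
apply: weq_trans (_ : weq (tw e0 u (tw e0 (winv u) (val (repr g)))) _).
  by apply: (tw_weq uC); apply: repr_pi1.
have := twK (u := winv u) (e0 := e0); rewrite winvK; apply.
by rewrite free_winv.
Qed.

(** * Elements and collapses of the group of a list of rules *)

Section LoopWords.
Variable X : vgbs.
Definition gw (w : seq (letter X)) : pi1 X := to_pi1 (lof w).
Lemma gwM w1 w2 : is_wpath ord0 w1 ord0 -> is_wpath ord0 w2 ord0 ->
  gw (w1 ++ w2) = gw w1 * gw w2.
Proof.
move=> h1 h2; rewrite -[RHS]to_pi1M; apply/to_pi1P; rewrite /= !lofE //.
  exact: weq_refl.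
exact: is_wpath_cat h1 h2.
Qed.
Lemma gwV w : is_wpath ord0 w ord0 -> gw (winv w) = (gw w)^-1.
Proof.
move=> h; rewrite -[RHS]to_pi1V; apply/to_pi1P; rewrite /= !lofE //.
  exact: weq_refl.
exact: is_wpath_inv.
Qed.
Lemma gw_weq w1 w2 : is_wpath ord0 w1 ord0 -> is_wpath ord0 w2 ord0 ->
  gw w1 = gw w2 <-> weq w1 w2.
Proof.
by move=> h1 h2; rewrite /gw; split=> [/to_pi1P|h]; [|apply/to_pi1P]; rewrite !lofE.
Qed.
End LoopWords.

Section MachineFacts.
Variables (num : bool -> int) (L : seq rule).
Hypothesis wfL : all wf_rule L.
Local Notation X := (machine_vgbs num wfL).
Local Notation G := (pi1 X).
Local Notation T := (TX num wfL).
Local Notation gam := (@gamX num L wfL).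
Local Notation gamP := (@gamXP num L wfL).

Definition a_ (x : 'rV[int]_2) : G := @vel X gam ord0 x.
Definition t_ (e : 'I_(nE X)) : G := @sel X gam e.
Definition b_ (j : bool) (n : int) : G := @vel X gam (@eter X (ej L j)) (const_mx n).
Definition er i (lt : i < size L) : 'I_(nE X) := @Ordinal (size L).+2 i.+2 lt.

Definition blet j (n : int) : seq (letter X) :=
  [:: @elet X (ej L j) true; @vlet X (@eter X (ej L j)) (const_mx n); @elet X (ej L j) false].

Lemma t_ej j : t_ (ej L j) = 1.
Proof.
rewrite -(pel_nil gamP ord0); apply/to_pi1P; rewrite !lofE; try exact: (basedP gamP).
  by case: j; apply: (weq_edge (X := X) _ true).
by apply: (basedP gamP); case: j; rewrite /= /ltgt /= !eqxx.
Qed.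

Lemma b_gw j n : b_ j n = gw (blet j n).
Proof. by case: j. Qed.
Lemma a_gw x : a_ x = gw [:: @vlet X ord0 x].
Proof. by []. Qed.
Lemma t_gw i (lt : i < size L) : t_ (er lt) = gw [:: @elet X (er lt) true].
Proof. by []. Qed.

Lemma blet_path j n : is_wpath ord0 (blet j n) ord0.
Proof. by case: j; rewrite /= /ltgt /= !eqxx. Qed.
Lemma av_path x : is_wpath ord0 [:: @vlet X ord0 x] ord0.
Proof. by []. Qed.

Lemma b_D j m n : b_ j (m + n)%R = b_ j m * b_ j n.
Proof.
rewrite /b_ -(velD gamP); congr vel; apply/matrixP => i k; by rewrite !mxE.
Qed.
Lemma a_D x y : a_ (x + y)%R = a_ x * a_ y.
Proof. exact: (velD gamP). Qed.
Lemma a_inj : injective a_.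
Proof. exact: (@vel_inj X gam gamP ord0). Qed.
Lemma b_inj j : injective (b_ j).
Proof.
move=> m n /(vel_inj gamP) h.
have lt : 0 < vrank (@eter X (ej L j)) by case: j {h}.
have := congr1 (fun x : 'rV_(vrank (@eter X (ej L j))) => x ord0 (Ordinal lt)) h.
by rewrite !mxE.
Qed.

Lemma b_even j n : b_ j (n + n)%R = a_ (n *: cfg (num j))%R.
Proof.
have := @sel_conj X gam gamP (ej L j) (const_mx n).
rewrite -/(t_ _) t_ej mul1g mulg1.
have -> : vel gam (const_mx n *m @inc_org X (ej L j)) = a_ (n *: cfg (num j))%R.
  by case: j; congr (@vel X gam ord0 _); rewrite /= mul_cfg mxE.
move=> <-; congr vel; case: j; apply/rowP => k; rewrite mxE (ord1 k).
  by rewrite /= [RHS]mxE big_ord1 !mxE mulrDr mulr1.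
by rewrite /= [RHS]mxE big_ord1 !mxE mulrDr mulr1.
Qed.

Lemma t_conj i (lt : i < size L) c :
  t_ (er lt) * a_ (c *m tri (nth scale_rule L i).2)%R =
  a_ (c *m tri (nth scale_rule L i).1)%R * t_ (er lt).
Proof.
have := @sel_conj X gam gamP (er lt) c.
have -> : vel gam (c *m inc_ter (er lt)) = a_ (c *m tri (nth scale_rule L i).2)%R.
  rewrite -[LHS]/(@vel X gam (@Ordinal 3 0 (tvn_lt i.+2)) (c *m tri (nth scale_rule L i).2)%R).
  by rewrite (bool_irrelevance (tvn_lt i.+2) (ltn0Sn 2)).
by [].
Qed.

Lemma vstab_vtx v g h : vact h (vtx gam v g : vert T) = vtx gam v g <-> Gr gam v (g^-1 * h * g).
Proof.
rewrite vact_vtx; split=> [/esym/(vtx_eq gamP)|h']; first by rewrite mulgA.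
by apply/esym/(vtx_eq gamP); rewrite mulgA.
Qed.
Lemma estab_edg e b g h : eact h (edg gam e b g : edge T) = edg gam e b g <->
  Ce gam e (g^-1 * h * g).
Proof.
rewrite eact_edg; split=> [/esym/(edg_eq gamP)|h']; first by rewrite mulgA.
by apply/esym/(edg_eq gamP); rewrite mulgA.
Qed.

Definition lab (E : edge T) : 'I_(nE X) := (sval E).1.1.
Lemma lab_edg e b g : lab (edg gam e b g) = e. Proof. by []. Qed.
Lemma lab_act g E : lab (eact g E) = lab E.
Proof. by have [e [b [h ->]]] := edgP E; rewrite eact_edg. Qed.

Lemma TX_abelian : abelian_gtree T.
Proof.
move=> E g h; have [e [b [k ->]]] := edgP E => /estab_edg[c hc] /estab_edg[d hd].
have conj x y : k^-1 * x * k = y -> x = k * y * k^-1.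
  by move=> <-; rewrite !mulgA mulgV mul1g mulgK.
rewrite (conj _ _ hc) (conj _ _ hd) /commute !mulgA !mulgVK.
by rewrite -[in LHS](mulgA k) (velC gamP) !mulgA.
Qed.

Definition keep (Q : pred 'I_(nE X)) (E : edge T) : Prop := Q (lab E).
Lemma keep_rev Q E : keep Q E -> keep Q (erev E). Proof. by []. Qed.
Lemma keep_act Q g E : keep Q E -> keep Q (eact g E).
Proof. by rewrite /keep lab_act. Qed.

(** Only the edges with label in [Q] remain. *)
Definition CT Q : gtree G := collapse (@keep_rev Q) (@keep_act Q).

Lemma CT_abelian Q : abelian_gtree (CT Q).
Proof.
move=> [E KE] g h hg hh; apply: (@TX_abelian E).
  by have := congr1 sval hg.
by have := congr1 sval hh.
Qed.

Lemma cls_step Q e b g : ~~ Q e -> ccls (keep Q) (orig (edg gam e b g : edge T)) (ter (edg gam e b g : edge T)).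
Proof.
by move=> Qe; exists [:: edg gam e b g : edge T] => /=; split=> //; rewrite /keep lab_edg; apply/negP.
Qed.

Lemma cls_t Q e g : ~~ Q e ->
  ccls (keep Q) (vtx gam ord0 g : vert T) (vtx gam (eter e) (g * t_ e) : vert T).
Proof.
move=> Qe; have := cls_step true g Qe.
by rewrite /ter [erev _]brevE [orig _](borigE gamP) [orig _](borigE gamP).
Qed.

(** Words that involve neither of the elements b_j. *)
Definition mlet (l : letter X) : bool :=
  match l with inl x => tag x == ord0 | inr (e, _) => 1 < val e end.

Lemma mlet_cases l : mlet l -> lsrc l = ord0 /\ ltgt l = ord0.
Proof.
case: l => [[v x]|[[[|[|i]] lt] b]] //=; first by move=> /eqP h; rewrite /ltgt /= h.
by move=> _; case: b; split; rewrite /ltgt //=; apply: val_inj.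
Qed.

Lemma gw_mind (P : G -> Prop) : P 1 -> (forall g x, P g -> P (g * a_ x)) ->
  (forall g i (lt : i < size L), P g -> P (g * t_ (er lt))) ->
  (forall g i (lt : i < size L), P g -> P (g * (t_ (er lt))^-1)) ->
  forall w, all mlet w -> is_wpath ord0 w ord0 /\ P (gw w).
Proof.
move=> P1 Pa Pt Pt' w; elim/last_ind: w => [|w l IHw].
  move=> _; split=> //; suff -> : gw [::] = 1 :> G by [].
  by apply/to_pi1P; rewrite lofE //; apply: weq_refl.
rewrite all_rcons => /andP[ml /IHw[wp Pw]]; have [l1 l2] := mlet_cases ml.
have lp : is_wpath ord0 [:: l] ord0 by rewrite /= l1 l2 eqxx.
rewrite -cats1; split; first exact: is_wpath_cat wp lp.
rewrite gwM //; case: l ml lp {l1 l2} => [[v x]|[e b]] ml lp.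
  have v0 : v = ord0 := eqP ml.
  by clear ml lp; subst v; apply: Pa.
case: e b ml lp => [[|[|i]] lt] b // ml lp.
case: b ml lp => ml lp; first exact: (Pt _ i lt).
have -> : gw [:: inr (Ordinal lt, false)] = (t_ (er (lt : i < size L)))^-1 :> G.
  by rewrite t_gw -gwV.
exact: Pt'.
Qed.

End MachineFacts.

(** * Connected numbers: a fixed vertex in every universally compatible tree *)

Section Elliptic.
Variables (num : bool -> int) (L : seq rule).
Hypothesis wfL : all wf_rule L.
Hypothesis L_gt0 : 0 < size L.
Hypothesis L0 : nth scale_rule L 0 = scale_rule.
Local Notation X := (machine_vgbs num wfL).
Local Notation G := (pi1 X).
Local Notation T := (TX num wfL).
Local Notation gam := (@gamX num L wfL).
Local Notation gamP := (@gamXP num L wfL).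
Local Notation a_ := (a_ num wfL).
Local Notation b_ := (b_ num wfL).

Definition t0 : G := t_ (er num wfL L_gt0).
Definition e1 : 'rV[int]_2 := (\row_j (if j == 0 then 1 else 0))%R.

Lemma mul_scalar_tri (c : 'rV[int]_2) n : (c *m tri (n, 0, n)%N = c *+ n)%R.
Proof.
apply: row2P; rewrite ?mul_tri0 ?mul_tri1 /= mulmxnE; last by rewrite -mulrzz -pmulrn.
by rewrite mulr0 addr0 -mulrzz -pmulrn.
Qed.

Lemma t0_conj (c : 'rV[int]_2) : t0^-1 * a_ c ^+ 3 * t0 = a_ c ^+ 5.
Proof.
have := t_conj num wfL L_gt0 c; rewrite L0 /= !mul_scalar_tri.
by rewrite !(velX gamP) -mulgA => <-; rewrite mulKg.
Qed.

(** The stable letter of the scaling rule conjugates the fifth power of [a_ x]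
    to its third power. *)
Lemma a_elliptic (S : gtree G) (x : 'rV[int]_2) : exists v : vert S, vact (a_ x) v = v.
Proof.
apply: (@elliptic_conj_pow _ S _ (t0^-1) 3 5) => //.
by rewrite invgK t0_conj.
Qed.

Lemma b_elliptic (S : gtree G) j n : exists v : vert S, vact (b_ j n) v = v.
Proof.
have [v hv] := a_elliptic S (n *: cfg (num j))%R.
apply: (@elliptic_root _ S _ 2 v) => //.
by rewrite expg2 -b_D b_even.
Qed.

Lemma conj_elliptic (S : gtree G) (g x : G) :
  (exists v : vert S, vact x v = v) -> exists v : vert S, vact (g * x * g^-1) v = v.
Proof. by move=> [v xv]; exists (vact g v); rewrite !vactM vactK xv. Qed.

Lemma a_fixes x g : vact (g * a_ x * g^-1) (vtx gam ord0 g : vert T) = vtx gam ord0 g.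
Proof.
by apply/vstab_vtx; rewrite !mulgA mulVg mul1g mulgVK; exists x.
Qed.

Definition aa1 : G := a_ e1.
Definition aa2 : G := t0 * aa1 * t0^-1.

(** These elements fix the two ends of an edge that they both move, so they have
    no common fixed vertex; commuting elliptic elements would have one. *)
Lemma aa_not_commute : ~ commute aa1 aa2.
Proof.
move=> com; pose E : edge T := edg gam (er num wfL L_gt0) true 1.
have oE : orig E = vtx gam ord0 1 by rewrite [LHS](borigE gamP).
have tE : ter E = vtx gam ord0 t0.
  rewrite /ter [erev _]brevE [LHS](borigE gamP) /= mul1g.
  by congr (vtx _ _ _); apply: val_inj.
have f1 : vact aa1 (orig E) = orig E.
  by rewrite oE; have := a_fixes e1 1; rewrite invg1 mulg1 mul1g.
have f2 : vact aa2 (ter E) = ter E by rewrite tE; apply: a_fixes.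
have wf1 : wf_tri (nth scale_rule L 0).1 by rewrite L0.
have wf2 : wf_tri (nth scale_rule L 0).2 by rewrite L0.
have n1 : ~ estab E aa1.
  move=> /estab_edg[c]; rewrite invg1 mul1g mulg1 => /(@a_inj num L wfL e1).
  by move=> h; apply: (tri_proper wf1 h).
have n2 : ~ estab E aa2.
  move=> /estab_edg[c]; rewrite invg1 mul1g mulg1.
  rewrite -[vel _ _]/(a_ (c *m tri (nth scale_rule L 0).1)%R) => h.
  have := t_conj num wfL L_gt0 c; rewrite -h /aa2 mulgVK -/t0 => /mulgI/(@a_inj num L wfL).
  by move=> h'; apply: (tri_proper wf2 (esym h')).
have [w [h1 h2]] := elliptic_commute com f1 f2.
by have := sep_fix f1 f2 n1 n2 h1 h2; rewrite geod_id.
Qed.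

Section Halting.
Variable W : bool -> seq (letter X).
Hypothesis Wm : forall j, all (@mlet num L wfL) (W j).
Definition wj j : G := gw (W j).
Definition delta j : G := wj j * a_ (cfg (num j)) * (wj j)^-1.
Hypothesis deltaE : delta false = delta true.
Definition d_ j : G := wj j * b_ j 1 * (wj j)^-1.

Lemma W_path j : is_wpath ord0 (W j) ord0.
Proof. by have [] := @gw_mind num L wfL (fun=> True) I _ _ _ _ (Wm j). Qed.

Lemma d_gw j : d_ j = gw (W j ++ blet num wfL j 1 ++ winv (W j)).
Proof.
have h := W_path j; have h' := is_wpath_inv h; have hb := blet_path num wfL j 1.
rewrite gwM //; last exact: is_wpath_cat hb h'.
by rewrite gwM // gwV // /d_ b_gw mulgA.
Qed.
Lemma d_path j : is_wpath ord0 (W j ++ blet num wfL j 1 ++ winv (W j)) ord0.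
Proof.
apply: is_wpath_cat (W_path j) _; apply: is_wpath_cat (blet_path num wfL j 1) _.
exact: is_wpath_inv (W_path j).
Qed.

Lemma d_sq j : d_ j * d_ j = delta j.
Proof.
rewrite /d_ /delta !mulgA mulgVK -(mulgA (wj j)) -b_D b_even.
by rewrite scale1r.
Qed.
Lemma d_sqE j : d_ j * d_ j = delta (~~ j).
Proof. by rewrite d_sq; case: j; rewrite deltaE. Qed.
Lemma d_delta j : commute (d_ j) (delta (~~ j)).
Proof. by rewrite -d_sqE; apply: commuteM; apply: commute_refl. Qed.

Lemma comm_scale (g : G) x n : commute g (a_ x) -> commute g (a_ (n *: x)%R).
Proof.
have hn m : commute g (a_ x) -> commute g (a_ ((Posz m) *: x)%R).
  move=> h; rewrite -natz scaler_nat [a_ _](esym (velX gamP _ _)).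
  exact: commuteX.
case: n => m h; first exact: hn.
by rewrite NegzE scaleNr [a_ _](velN gamP); apply: commuteV; apply: hn.
Qed.

(** The loop by which the letter of the other edge is twisted: [d_ j] carried
    along the words [W] to the end of this edge. *)
Definition u_ j : seq (letter X) :=
  winv (W (~~ j)) ++ (W j ++ blet num wfL j 1 ++ winv (W j)) ++ W (~~ j).

Lemma u_path j : is_wpath ord0 (u_ j) ord0.
Proof.
apply: is_wpath_cat (is_wpath_inv (W_path (~~ j))) _.
exact: is_wpath_cat (d_path j) (W_path (~~ j)).
Qed.
Lemma u_gw j : gw (u_ j) = (wj (~~ j))^-1 * d_ j * wj (~~ j).
Proof.
have w := W_path (~~ j); have w' := is_wpath_inv w; have d := d_path j.
rewrite gwM //; last exact: is_wpath_cat d w.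
by rewrite gwM // gwV // -d_gw mulgA.
Qed.

(** Both squares [d_ j ^+ 2] are equal, so [d_ j] commutes with the image of the
    other edge group. *)
Lemma u_comm j (c : 'rV[int]_(@erank X (ej L (~~ j)))) :
  weq (u_ j ++ [:: @vlet X ord0 (c *m @inc_org X (ej L (~~ j)))%R])
      (@vlet X ord0 (c *m @inc_org X (ej L (~~ j)))%R :: u_ j).
Proof.
have up := u_path j.
have p1 x : is_wpath ord0 (u_ j ++ [:: @vlet X ord0 x]) ord0.
  exact: is_wpath_cat up (av_path x).
have p2 x : is_wpath ord0 ([:: @vlet X ord0 x] ++ u_ j) ord0.
  exact: is_wpath_cat (av_path x) up.
set x := (c *m _)%R.
apply/(gw_weq (p1 x) (p2 x)); rewrite (gwM up (av_path x)) (gwM (av_path x) up).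
rewrite -!a_gw.
have [n ->] : exists n, x = (n *: cfg (num (~~ j)))%R.
  by rewrite /x; clear; case: j c => c; exists (c ord0 ord0); rewrite mul_cfg.
apply: (@comm_scale (gw (u_ j))); rewrite u_gw.
have -> : a_ (cfg (num (~~ j))) = (wj (~~ j))^-1 * delta (~~ j) * wj (~~ j).
  by rewrite /delta !mulgA mulVg mul1g mulgVK.
rewrite /commute !mulgA !mulgK; congr (_ * _); rewrite -!mulgA; congr (_ * _).
by have := d_delta j; rewrite /commute /d_ /delta -!mulgA.
Qed.

Definition sig j : G -> G := @sigma X (ej L (~~ j)) (u_ j) (u_path j).
Lemma sigM j g h : sig j (g * h) = sig j g * sig j h.
Proof. exact: (@sigmaM X (ej L (~~ j)) (u_ j) (u_path j) (@u_comm j)). Qed.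

Lemma mlet_free j w : all (@mlet num L wfL) w -> all (@free X (ej L j)) w.
Proof.
apply: sub_all => -[x|[e b]] //= h; apply/eqP => ee.
by move: h; rewrite ee; case: (j).
Qed.
Lemma blet_free j : all (@free X (ej L (~~ j))) (blet num wfL j 1).
Proof. by case: j. Qed.
Lemma u_free j : all (@free X (ej L (~~ j))) (u_ j).
Proof.
by rewrite !all_cat !free_winv blet_free !(mlet_free _ (Wm _)).
Qed.
Lemma sig_surj j g : exists h, sig j h = g.
Proof. by exact: (@sigma_surj X (ej L (~~ j)) (u_ j) (u_path j) (@u_comm j) (u_free j) g). Qed.
Lemma sig_inj j : injective (sig j).
Proof. by exact: (@sigma_inj X (ej L (~~ j)) (u_ j) (u_path j) (@u_comm j) (u_free j)). Qed.

Definition Kj (j : bool) : pred 'I_(nE X) := fun e => e == ej L j.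
Definition S_ j : gtree G := twist (CT (Kj j)) (@sigM j) (@sig_surj j).
Lemma S_abelian j : abelian_gtree (S_ j).
Proof.
move=> E g h hg hh; apply: (@sig_inj j); rewrite !sigM.
exact: (@CT_abelian num L wfL (Kj j) E _ _ hg hh).
Qed.
Definition k_ j : vert (CT (Kj j)) := cv _ (vtx gam ord0 1 : vert T).

Lemma sig_free j w : is_wpath ord0 w ord0 -> all (@free X (ej L (~~ j))) w ->
  sig j (gw w) = gw w.
Proof.
by move=> wp fw; rewrite [LHS](sigma_lof _ (@u_comm j) wp) tw_free.
Qed.
Lemma sig_a j x : sig j (a_ x) = a_ x.
Proof. by rewrite a_gw sig_free. Qed.
Lemma sig_aa2 j : sig j aa2 = aa2.
Proof.
have h : is_wpath ord0 [:: @elet X (er num wfL L_gt0) true] ord0.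
  by rewrite /= /ltgt /=; apply/eqP/val_inj.
have -> : aa2 = gw ([:: @elet X (er num wfL L_gt0) true] ++ [:: @vlet X ord0 e1] ++
    winv [:: @elet X (er num wfL L_gt0) true]).
  have h' := is_wpath_inv h; have p := av_path e1.
  by rewrite gwM ?(is_wpath_cat p h') // gwM // gwV // mulgA.
apply: sig_free.
  exact: is_wpath_cat h (is_wpath_cat (av_path e1) (is_wpath_inv h)).
by rewrite !all_cat free_winv; case: (j).
Qed.
Lemma sig_d j : sig j (d_ j) = d_ j.
Proof.
rewrite d_gw sig_free //; first exact: d_path.
by rewrite !all_cat free_winv blet_free !(mlet_free _ (Wm _)).
Qed.
Lemma sig_w j i : sig j (wj i) = wj i.
Proof. by rewrite /wj sig_free // ?W_path // (mlet_free _ (Wm _)). Qed.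

Lemma sigV j g : sig j g^-1 = (sig j g)^-1.
Proof.
have s1 : sig j 1 = 1 by apply: (mulgI (sig j 1)); rewrite -sigM !mulg1.
by apply: (mulIg (sig j g)); rewrite -sigM !mulVg.
Qed.

(** The letter of the other edge picks up the loop [u_ j], which the words [W]
    carry back to [d_ j]. *)
Lemma sig_dN j : sig j (d_ (~~ j)) = d_ j * d_ (~~ j) * (d_ j)^-1.
Proof.
have hb : sig j (b_ (~~ j) 1) = gw (u_ j) * b_ (~~ j) 1 * (gw (u_ j))^-1.
  have up := u_path j; have up' := is_wpath_inv up.
  have bp := blet_path num wfL (~~ j) 1.
  rewrite b_gw [LHS](sigma_lof _ (@u_comm j) bp) -gwV //.
  rewrite -gwM // -gwM //; last exact: is_wpath_cat up bp.
  by congr gw; rewrite /tw /= /twl /= !eqxx /= cats0 -!catA.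
have key (w d b : G) : w * (w^-1 * d * w * b * (w^-1 * d * w)^-1) * w^-1 =
    d * (w * b * w^-1) * d^-1.
  by rewrite !invgM !invgK !mulgA mulgV mul1g mulgK.
by rewrite {1}/d_ !sigM sigV !sig_w hb u_gw key.
Qed.

(** The square of [d_ j] is also the square of [d_ (~~ j)], so that conjugating
    [d_ (~~ j)] twice by [d_ j] does not change it. *)
Lemma sig_conj j : sig j (d_ j * d_ (~~ j) * (d_ j)^-1) = d_ (~~ j).
Proof.
have com : commute (d_ j * d_ j) (d_ (~~ j)).
  rewrite d_sqE -d_sq; apply: commute_sym; apply: commuteM; exact: commute_refl.
have h1 := sig_d j; have h2 := sig_dN j.
move: (d_ j) (d_ (~~ j)) h1 h2 com => x y h1 h2 com.
rewrite !sigM sigV h1 h2; apply: (mulIg (x * x)).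
by rewrite -[RHS]com !mulgA !mulgVK.
Qed.

Lemma kfix Q (g : G) : vact g (cv (keep Q) (vtx gam ord0 1 : vert T) : vert (CT Q)) =
    cv (keep Q) (vtx gam ord0 1 : vert T) <->
  ccls (keep Q) (vtx gam ord0 1 : vert T) (vtx gam ord0 g : vert T).
Proof.
rewrite [vact _ _](cactV_cv (@keep_act num L wfL Q)) vact_vtx mulg1.
split=> [/esym/(cv_eq (@keep_rev num L wfL Q))//|h].
exact/esym/(cv_eq (@keep_rev num L wfL Q)).
Qed.

Lemma a_cls Q g x : ccls (keep Q) (vtx gam ord0 g : vert T) (vtx gam ord0 (g * a_ x) : vert T).
Proof.
have -> : (vtx gam ord0 (g * a_ x) : vert T) = vtx gam ord0 g; last by exists [::].
by apply/esym/(vtx_eq gamP); rewrite mulKg; exists x.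
Qed.
Lemma t_cls (Q : pred 'I_(nE X)) g i (lt : i < size L) : ~~ Q (er num wfL lt) ->
  ccls (keep Q) (vtx gam ord0 g : vert T) (vtx gam ord0 (g * t_ (er num wfL lt)) : vert T).
Proof.
move=> /(cls_t (Q := Q) g); have -> // : eter (er num wfL lt) = ord0 by apply: val_inj.
Qed.
Lemma b_cls (Q : pred 'I_(nE X)) g j n : ~~ Q (ej L j) ->
  ccls (keep Q) (vtx gam ord0 g : vert T) (vtx gam ord0 (g * b_ j n) : vert T).
Proof.
move=> Qj; apply: ccls_trans (cls_t (Q := Q) g Qj) _.
apply: (ccls_sym (@keep_rev num L wfL Q)).
have -> : (vtx gam (@eter X (ej L j)) (g * t_ (ej L j : 'I_(nE X))) : vert T) =
  vtx gam (@eter X (ej L j)) (g * b_ j n * t_ (ej L j : 'I_(nE X))).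
  by apply/(vtx_eq gamP); rewrite t_ej !mulg1 mulKg; exists (const_mx n).
exact: cls_t.
Qed.

Lemma w_cls (Q : pred 'I_(nE X)) w : (forall i (lt : i < size L), ~~ Q (er num wfL lt)) ->
  all (@mlet num L wfL) w ->
  ccls (keep Q) (vtx gam ord0 1 : vert T) (vtx gam ord0 (gw w) : vert T).
Proof.
move=> Qe; pose P (g : G) := ccls (keep Q) (vtx gam ord0 1 : vert T) (vtx gam ord0 g : vert T).
move=> mw; have [] // := @gw_mind num L wfL P _ _ _ _ w mw; rewrite /P.
- exact: ccls_refl.
- by move=> g x h; apply: ccls_trans h (a_cls _ _ _).
- by move=> g i lt h; apply: ccls_trans h (t_cls _ (Qe _ lt)).
- move=> g i lt h; apply: ccls_trans h (ccls_sym (@keep_rev num L wfL Q) _).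
  by have := t_cls (g * (t_ (er num wfL lt))^-1) (Qe _ lt); rewrite mulgVK.
Qed.

(** The geodesic from the base vertex to its image by b_j crosses two kept
    edges. *)
Lemma b_moves j : ~ ccls (keep (Kj j)) (vtx gam ord0 1 : vert T) (vtx gam ord0 (b_ j 1) : vert T).
Proof.
pose E : edge T := edg gam (ej L j : 'I_(nE X)) true 1.
pose F : edge T := edg gam (ej L j : 'I_(nE X)) true (b_ j 1).
have oE : orig E = vtx gam ord0 1 by rewrite [LHS](borigE gamP).
have oF : orig F = vtx gam ord0 (b_ j 1) by rewrite [LHS](borigE gamP).
have tEF : ter F = ter E.
  rewrite /ter [erev F]brevE [erev E]brevE [LHS](borigE gamP) [RHS](borigE gamP).
  apply/(vtx_eq gamP); rewrite -/(t_ _) t_ej !mulg1.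
  by rewrite -(velN gamP); exists (- const_mx 1)%R.
have EF : E <> F.
  move=> /(edg_eq gamP)[c]; rewrite invg1 mul1g.
  have [n ->] : exists n, vel gam (c *m @inc_org X (ej L j)) = b_ j (n + n)%R.
    have [n hn] : exists n, (c *m @inc_org X (ej L j) = n *: cfg (num j))%R.
      by clear; case: j c => c; exists (c ord0 ord0); rewrite mul_cfg.
    by exists n; rewrite b_even hn.
  move=> /b_inj /(congr1 (fun z => odd (absz z))).
  by rewrite -mulr2n -mulr_natr abszM oddM andbF.
move=> [s sP]; have := geod_in (gtree_tree T) sP.
have -> : geod (gtree_tree T) (vtx gam ord0 1) (vtx gam ord0 (b_ j 1)) = [:: E; erev F].
  apply: geod_eq; first by do 2!split=> //; rewrite /= ter_rev.
  by split=> // h; apply: EF; rewrite -[F]erevK h erevK.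
by move=> [_ kE _]; apply: kE; rewrite /keep /Kj lab_edg eqxx.
Qed.

(** The twisted trees [S_ j] satisfy the hypotheses of [common_fixed_vertex] at
    their base vertices, for the non-commuting conjugates [aa1] and [aa2] in two
    vertex groups of rank two. *)
Lemma halting_vertex (T' : gtree G) : universally_compatible T' ->
  exists v : vert T', vact (d_ false) v = v /\ vact (d_ true) v = v.
Proof.
move=> [abT' comp].
have Qer j i (lt : i < size L) : ~~ Kj j (er num wfL lt).
  by rewrite /Kj; apply/eqP => /(congr1 val); case: (j).
have Qej j : ~~ Kj j (ej L (~~ j)) by case: j.
have fixM Q (g h : G) : let k := cv (keep Q) (vtx gam ord0 1 : vert T) : vert (CT Q) in
    vact g k = k -> vact h k = k -> vact (g * h) k = k.
  by move=> k hg hh; rewrite vactM hh.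
have fixV Q (g : G) : let k := cv (keep Q) (vtx gam ord0 1 : vert T) : vert (CT Q) in
    vact g k = k -> vact g^-1 k = k.
  by move=> k hg; rewrite -{1}hg vactK.
(* In a twisted tree an element acts through its image by the automorphism, which
   sig_a, sig_aa2, sig_conj and sig_d compute. *)
have spec j : [/\ vact aa1 (k_ j : vert (S_ j)) = k_ j, vact aa2 (k_ j : vert (S_ j)) = k_ j,
    vact (d_ j * d_ (~~ j) * (d_ j)^-1) (k_ j : vert (S_ j)) = k_ j &
    vact (d_ j) (k_ j : vert (S_ j)) <> k_ j].
  have fw i : vact (wj i) (k_ j) = k_ j.
    by apply/kfix; apply: w_cls; [apply: Qer|apply: Wm].
  have fa : vact aa1 (k_ j) = k_ j.
    by apply/kfix; rewrite -[aa1]mul1g; apply: a_cls.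
  have ft : vact t0 (k_ j) = k_ j.
    by apply/kfix; rewrite -[t0]mul1g; apply: t_cls; apply: Qer.
  split.
  - by rewrite [LHS](_ : _ = vact (sig j aa1) (k_ j)) // sig_a.
  - rewrite [LHS](_ : _ = vact (sig j aa2) (k_ j)) // sig_aa2.
    exact: (fixM _ _ _ (fixM _ _ _ ft fa) (fixV _ _ ft)).
  - rewrite [LHS](_ : _ = vact (sig j (d_ j * d_ (~~ j) * (d_ j)^-1)) (k_ j)) // sig_conj.
    have fb : vact (b_ (~~ j) 1) (k_ j) = k_ j.
      by apply/kfix; rewrite -[b_ _ _]mul1g; apply: b_cls.
    exact: (fixM _ _ _ (fixM _ _ _ (fw _) fb) (fixV _ _ (fw _))).
  - rewrite [vact _ _](_ : _ = vact (sig j (d_ j)) (k_ j)) // sig_d => h.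
    apply: (@b_moves j); apply/kfix.
    have -> : b_ j 1 = (wj j)^-1 * d_ j * wj j.
      by rewrite /d_ !mulgA mulVg mul1g mulgVK.
    exact: (fixM _ _ _ (fixM _ _ _ (fixV _ _ (fw _)) h) (fw _)).
apply: (@common_fixed_vertex _ T' abT' aa1 aa2 (d_ false) (d_ true) aa_not_commute _ _ _ _
  (S_ false) (S_ true) (k_ false) (k_ true)).
- exact: a_elliptic.
- exact/conj_elliptic/a_elliptic.
- exact/conj_elliptic/b_elliptic.
- exact/conj_elliptic/b_elliptic.
- exact/comp/S_abelian.
- exact/comp/S_abelian.
- exact: (spec false).
- exact: (spec true).
Qed.

End Halting.
End Elliptic.

(** * A criterion for the compatibility of two trees *)

Section Rigid.
Variables (G : groupType) (T S : gtree G).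
Local Notation tT := (gtree_tree T).
Local Notation tS := (gtree_tree S).
Implicit Types (x : vert T) (t f : edge T) (s : vert S) (e : edge S) (g h k : G).

(** T is bipartite, and [typ] tells the two kinds of vertices apart. *)
Variable typ : vert T -> bool.
Hypothesis typ_act : forall g x, typ (vact g x) = typ x.
Hypothesis typ_ter : forall t, typ (ter t) = ~~ typ (orig t).
Hypothesis typ_orbit : forall t f, typ (orig t) -> orig f = orig t ->
  exists2 k, vact k (orig t) = orig t & f = eact k t.
Hypothesis typ_stab : forall t f g, typ (orig t) -> orig f = orig t -> estab t g -> estab f g.
Hypothesis incl_orbit : forall t f, typ (orig t) = false -> orig f = orig t ->
  (forall g, estab t g -> estab f g) ->
  (exists2 h, vact h (orig t) = orig t & f = eact h t) /\
  (forall g, estab f g -> estab t g).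
Hypothesis abS : abelian_gtree S.

(** A subgroup of the stabiliser of [x] with this property fixes no other vertex
    of [T]: such a subgroup remembers [x]. *)
Definition big x (P : G -> Prop) := forall t, orig t = x ->
  exists g, [/\ vact g x = x, P g & ~ estab t g].

(** The sets Y0 x are convex cores of the sets Y x defined below. *)
Variable Y0 : vert T -> vert S -> Prop.
Hypothesis Y0_ne : forall x, exists s, Y0 x s.
Hypothesis Y0_conv : forall x, conv tS (Y0 x).
Hypothesis Y0_act : forall g x s, Y0 x s -> Y0 (vact g x) (vact g s).
Hypothesis Y0_big : forall x s, Y0 x s -> big x (fun g => vact g s = s).
Hypothesis Y0_bigE : forall x e, edge_in (Y0 x) e -> big x (estab e).

(** The vertices of [S] whose stabiliser remembers [x]. *)
Definition Y x s := big x (fun g => vact g s = s).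

Lemma Y_act g x s : Y x s -> Y (vact g x) (vact g s).
Proof.
move=> h t ot; have ot' : orig (eact g^-1 t) = x by rewrite orig_eact ot vactK.
have [k [kx ks kt]] := h _ ot'; exists (g * k * g^-1).
split; rewrite ?vactM ?vactK ?kx ?ks //.
move=> hk; apply: kt; rewrite /estab in hk *.
by apply: (@eact_inj _ _ g); rewrite eactVK -{2}hk !eactM.
Qed.

Lemma Y0_inv g x s : vact g x = x -> Y0 x s -> Y0 x (vact g s).
Proof. by move=> gx h; have := @Y0_act g x s h; rewrite gx. Qed.
Lemma Y_inv g x s : vact g x = x -> Y x s -> Y x (vact g s).
Proof. by move=> gx h; have := @Y_act g x s h; rewrite gx. Qed.
Lemma vfixV g x : vact g x = x -> vact g^-1 x = x.
Proof. by move=> h; rewrite -{1}h vactK. Qed.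

Lemma fix_core g x s p : vact g x = x -> vact g s = s -> Y0 x p ->
  (forall z, Y0 x z -> btw tS s p z) -> vact g p = p.
Proof.
move=> gx gs hp hz; apply: fix_proj (hp) hz => // z; first exact: Y0_inv.
by apply: Y0_inv; apply: vfixV.
Qed.

(** An element of the stabiliser of [x] that fixes [s] fixes the projection of
    [s] to [Y0 x], and hence the way to it. *)
Lemma Y_toward x s p z : Y x s -> Y0 x p -> (forall y, Y0 x y -> btw tS s p y) ->
  btw tS s z p -> Y x z.
Proof.
move=> Ys hp hz b t ot; have [g [gx gs gt]] := Ys t ot.
exists g; split=> //.
exact: (conv_fix (u := s) (v := p)) gs (fix_core gx gs hp hz) b.
Qed.

Lemma path_inI (X : graph) (P : edge X -> Prop) (u v : vert X) l :
  walk u l v -> (forall f : edge X, on_walk f l -> P f) -> path_in P u l v.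
Proof. by move=> w h; apply/path_inP. Qed.

Lemma Y_conv x : conv tS (Y x).
Proof.
apply: conv_walk => s s' Ys Ys'; have [y Yy] := Y0_ne x.
have [p hp hpz] := proj_ex s (@Y0_conv x) Yy.
have [p' hp' hpz'] := proj_ex s' (@Y0_conv x) Yy.
exists (geod tS s p ++ geod tS p p' ++ geod tS p' s').
apply: path_inI.
  by apply: walk_catI (geodP _ _ _) _; apply: walk_catI (geodP _ _ _) (geodP _ _ _).
move=> e /on_walk_cat[|/on_walk_cat[|]].
- by move=> /geod_on_walk[b1 b2 _]; split; apply: Y_toward Ys hp hpz _.
- move=> /(geod_conv (@Y0_conv x) hp hp')[h1 h2]; split; exact: Y0_big.
- by move=> /geod_on_walk[b1 b2 _]; split; apply: Y_toward Ys' hp' hpz' _; apply: btwC.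
Qed.

(** An edge of [Y x] either points towards [Y0 x], where the argument of
    [Y_toward] applies to the whole edge, or belongs to [Y0 x]. *)
Lemma Y_big x e : edge_in (Y x) e -> big x (estab e).
Proof.
move=> [Ys Ys'] t ot; have [y Yy] := Y0_ne x.
have [p hp hpz] := proj_ex (orig e) (@Y0_conv x) Yy.
have [p' hp' hpz'] := proj_ex (ter e) (@Y0_conv x) Yy.
have tow : btw tS (orig e) (ter e) p -> exists g, [/\ vact g x = x, estab e g & ~ estab t g].
  move=> b; have [g [gx gs gt]] := Ys t ot; exists g; split=> //.
  apply: (fix_edge gs).
  exact: (conv_fix (u := orig e) (v := p)) gs (fix_core gx gs hp hpz) b.
have tow' : btw tS (ter e) (orig e) p' -> exists g, [/\ vact g x = x, estab e g & ~ estab t g].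
  move=> b; have [g [gx gs gt]] := Ys' t ot; exists g; split=> //.
  apply: (fix_edge _ gs).
  exact: (conv_fix (u := ter e) (v := p')) gs (fix_core gx gs hp' hpz') b.
case: (adj_side tS e p) => [/tow //|b1]; case: (adj_side tS e p') => [b2|/tow' //].
suff [e1 e2] : orig e = p /\ ter e = p'.
  by apply: Y0_bigE => //; split; rewrite ?e1 ?e2.
have e1 : orig e = p.
  case E: (geod tS (orig e) p) => [|f r]; first exact: geod_nil E.
  have := hpz _ hp'; rewrite /btw E b2 geod_edge /= => -[fe _].
  by case: (not_btw_both _ b1); have [_ _] := geod_cons E; rewrite -fe.
split=> //; apply: (btw_antisym b2); apply: btwC; rewrite e1; exact: hpz'.
Qed.

(** The stabiliser of [e] is abelian, so it preserves the set of vertices fixed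
    by the part of it that fixes [x], which is [x] alone. *)
Lemma Y_stab x e g : edge_in (Y x) e -> estab e g -> vact g x = x.
Proof.
move=> he ge; case E: (geod tT x (vact g x)) => [|t r].
  by rewrite -(geod_nil E).
have [ot _ _] := geod_cons E; have [h [hx hh ht]] := Y_big he ot.
case: ht; apply: (fix_geod (u := x) (v := vact g x)) => //; last by rewrite E; left.
by rewrite -vactM (abS hh ge) vactM hx.
Qed.
Lemma Y_only x x' e : edge_in (Y x) e -> (forall g, estab e g -> vact g x' = x') -> x = x'.
Proof.
move=> he hx'; case E: (geod tT x x') => [|t r]; first exact: geod_nil E.
have [ot _ _] := geod_cons E; have [h [hx hh ht]] := Y_big he ot.
by case: ht; apply: (fix_geod (u := x) (v := x')) => //; [apply: hx'|rewrite E; left].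
Qed.

Lemma Y_ne x : exists s, Y x s.
Proof. by have [s h] := Y0_ne x; exists s; apply: Y0_big. Qed.

(** The sets [Y (orig t)] and [Y (ter t)] may be disjoint; their gates are where
    the edge [t] will be attached. *)
Definition is_gate t (bc : vert S * vert S) :=
  [/\ Y (orig t) bc.1, Y (ter t) bc.2,
    forall z, Y (orig t) z -> btw tS bc.2 bc.1 z &
    forall z, Y (ter t) z -> btw tS bc.1 bc.2 z].

Lemma gate_ex t : exists bc, is_gate t bc.
Proof.
have [y h] := Y_ne (orig t); have [y' h'] := Y_ne (ter t).
have [b [c [h1 h2 h3 h4]]] := gates (@Y_conv _) (@Y_conv _) h h'.
by exists (b, c).
Qed.

(** Gates are unique unless the two sets meet in more than one vertex; but a
    common edge would have its stabiliser in the stabiliser of both ends of [t],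
    against [Y_only]. *)
Lemma gate_uniq t bc bc' : is_gate t bc -> is_gate t bc' -> bc = bc'.
Proof.
case: bc bc' => [b c] [b' c'] [/= h1 h2 h3 h4] [/= h1' h2' h3' h4'].
have same a d a' d' : Y (orig t) a -> Y (ter t) a -> a = d ->
    Y (orig t) a' -> Y (ter t) d' ->
    (forall z, Y (orig t) z -> btw tS d' a' z) ->
    (forall z, Y (ter t) z -> btw tS a' d' z) -> (a, d) = (a', d').
  move=> a1 a2 <- a1' d2' k3 k4.
  have e' : a' = d'.
    exact: (btw_antisym (btwC (k3 _ a1)) (btwC (k4 _ a2))).
  suff e : a = a' by rewrite -e' -e.
  rewrite -e' in d2'; case E: (geod tS a a') => [|e r]; first exact: geod_nil E.
  have ee : on_walk e (geod tS a a') by rewrite E; left.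
  have i1 := geod_conv (@Y_conv _) a1 a1' ee.
  have i2 := geod_conv (@Y_conv _) a2 d2' ee.
  by case: (@edge_neq _ tT t); apply: (Y_only i1) => g; apply: Y_stab i2.
case: (EM (b = c)) => [bc|bc].
  by apply: same => //; rewrite bc.
case: (EM (b' = c')) => [bc'|bc'].
  by apply/esym; apply: same => //; rewrite bc'.
have bb : b = b'.
  apply: (btw_antisym (btwC (btw_join (btwC (h3 _ h1')) (h4 _ h2') bc))).
  exact: h3'.
subst b'; congr pair; apply: (btw_antisym (h4 _ h2')); exact: h4'.
Qed.

Definition gp t := (sval (cid (gate_ex t))).1.
Definition gq t := (sval (cid (gate_ex t))).2.

Lemma gateP t : is_gate t (gp t, gq t).
Proof. by rewrite /gp /gq; case: cid => -[b c]. Qed.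

Lemma gate_act g t : gp (eact g t) = vact g (gp t) /\ gq (eact g t) = vact g (gq t).
Proof.
have [h1 h2 h3 h4] := gateP t.
have : is_gate (eact g t) (vact g (gp t), vact g (gq t)).
  split=> /=; rewrite ?orig_eact ?ter_eact; try exact: Y_act.
  - move=> z Yz; rewrite -[z](vactVK g); apply/btw_vactE/h3.
    by have := @Y_act g^-1 _ _ Yz; rewrite vactK.
  - move=> z Yz; rewrite -[z](vactVK g); apply/btw_vactE/h4.
    by have := @Y_act g^-1 _ _ Yz; rewrite vactK.
by move=> /(gate_uniq (gateP _)) [-> ->].
Qed.

Lemma gate_fix g t : estab t g -> vact g (gp t) = gp t /\ vact g (gq t) = gq t.
Proof. by move=> gt; have [<- <-] := gate_act g t; rewrite (gt : eact g t = t). Qed.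

(** The copy of [t] in the refinement lies over its gate at the end of type
    false. *)
Definition pe t := if typ (orig t) then gp (erev t) else gp t.

Lemma pe_act g t : pe (eact g t) = vact g (pe t).
Proof.
rewrite /pe orig_eact typ_act erev_eact.
by case: ifP => _; rewrite (proj1 (gate_act _ _)).
Qed.
Lemma pe_rev t : pe (erev t) = pe t.
Proof.
rewrite /pe -[orig (erev t)]/(ter t) typ_ter erevK.
by case: (typ (orig t)).
Qed.

Definition seg t s := btw tS (gp t) s (gq t).

Lemma seg_fix t s g : seg t s -> estab t g -> vact g s = s.
Proof. by move=> hs /gate_fix[h1 h2]; apply: conv_fix h1 h2 hs. Qed.

Lemma seg_gate t s : seg t s -> Y (orig t) s -> s = gp t.
Proof.
move=> b Ys; have [_ _ h _] := gateP t.
exact: btw_antisym (btwC b) (h _ Ys).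
Qed.
Lemma seg_gate' t s : seg t s -> Y (ter t) s -> s = gq t.
Proof.
move=> b Ys; have [_ _ _ h] := gateP t.
exact: btw_antisym b (h _ Ys).
Qed.
Lemma seg_proj t s z : seg t s -> Y (ter t) z -> btw tS s (gq t) z.
Proof.
by move=> b Yz; have [_ _ _ h] := gateP t; apply: btw_mid (h _ Yz) b.
Qed.

(** To vertices of type true the segments between gates are added, so that the
    sets attached to adjacent vertices meet at [pe]. *)
Definition Z x s := Y x s \/
  typ x /\ exists t, [/\ typ (orig t) = false, ter t = x & seg t s].

Lemma Z_toY x s : Z x s -> exists2 y, Y x y & forall z, btw tS s z y -> Z x z.
Proof.
case=> [Ys|[xT [t [t0 tx b]]]].
  by exists s => // z /btw_same->; left.
exists (gq t); first by rewrite -tx; case: (gateP t).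
move=> z bz; right; split=> //; exists t; split=> //.
by rewrite /seg; apply: btwC; apply: btw_trans (btwC b) (btwC bz).
Qed.

Lemma Z_conv x : conv tS (Z x).
Proof.
apply: conv_walk => s s' /Z_toY[y Yy hy] /Z_toY[y' Yy' hy'].
exists (geod tS s y ++ geod tS y y' ++ geod tS y' s').
apply: path_inI.
  by apply: walk_catI (geodP _ _ _) _; apply: walk_catI (geodP _ _ _) (geodP _ _ _).
move=> e /on_walk_cat[|/on_walk_cat[|]].
- by move=> /geod_on_walk[b1 b2 _]; split; apply: hy.
- by move=> /(geod_conv (@Y_conv x) Yy Yy')[h1 h2]; split; left.
- by move=> /geod_on_walk[b1 b2 _]; split; apply: hy'; apply: btwC.
Qed.

Lemma Z_act g x s : Z x s -> Z (vact g x) (vact g s).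
Proof.
case=> [Ys|[xT [t [t0 tx b]]]]; first by left; apply: Y_act.
right; rewrite typ_act; split=> //; exists (eact g t).
rewrite orig_eact typ_act ter_eact tx; split=> //.
by rewrite /seg !(proj1 (gate_act _ _)) !(proj2 (gate_act _ _)); apply/btw_vactE.
Qed.

Lemma Z_pe t : Z (orig t) (pe t).
Proof.
rewrite /pe; case: ifP => [tT'|tF]; last by left; case: (gateP t).
right; split=> //; exists (erev t).
by rewrite ter_rev -[orig (erev t)]/(ter t) typ_ter tT' /seg; split=> //; apply: btwl.
Qed.

Definition seg_edge x e t := [/\ typ (orig t) = false, ter t = x,
  seg t (orig e) & seg t (ter e)].

(** Two segments at [x] that share a vertex outside [Y x] both run towards [Y x]
    from there on. *)
Lemma Z_edge x e : edge_in (Z x) e -> edge_in (Y x) e \/ exists t, seg_edge x e t.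
Proof.
have key (a : edge S) : edge_in (Z x) a -> ~ Y x (orig a) -> exists t, seg_edge x a t.
  move=> [[//|[xT [t [t0 tx b]]]] Zs'] nY; subst x.
  have hq : Y (ter t) (gq t) by case: (gateP t).
  case: (adj_side tS a (gq t)) => [b1|b1].
    exists t; split=> //; rewrite /seg.
    exact: btwC (btw_trans (btwC b) (btwC b1)).
  case: Zs' => [Ys'|[_ [t' [t0' tx' b']]]].
    case: nY; have -> // : orig a = gq t.
    exact: btw_antisym b1 (btwC (seg_proj b Ys')).
  exists t'; split=> //; rewrite /seg.
  have b2 : btw tS (ter a) (gq t') (gq t) by apply: seg_proj => //; rewrite tx'.
  suff b3 : btw tS (ter a) (orig a) (gq t').
    exact: btwC (btw_trans (btwC b') (btwC b3)).
  case E: (geod tS (ter a) (gq t')) => [|h r].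
    case: nY; have e1 := geod_nil E.
    have Yt : Y (ter t) (ter a) by rewrite e1 -tx'; case: (gateP t').
    have -> // : orig a = gq t.
    exact: btw_antisym b1 (btwC (seg_proj b Yt)).
  have ga : geod tS (ter a) (orig a) = [:: erev a] by rewrite geodC geod_edge.
  have := b1; rewrite /btw b2 E ga => -[he _].
  by have [_ _ b3] := geod_cons E; rewrite he ter_rev in b3; rewrite -E -ga.
move=> he; have [h1 h2] := he.
case: (EM (Y x (orig e))) => [Yo|/(key e he) h]; last by right.
case: (EM (Y x (ter e))) => [Yt|nYt]; first by left.
right; have [t [t0 tx b1 b2]] := key (erev e) (edge_in_rev he) nYt.
by exists t; split=> //; rewrite -(ter_rev e).
Qed.

Lemma seg_stab x e t g : seg_edge x e t -> estab t g -> estab e g.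
Proof.
by move=> [_ _ b1 b2] gt; apply: fix_edge; [apply: seg_fix b1 gt|apply: seg_fix b2 gt].
Qed.

(** An edge of a segment leaves Y (orig t), so its stabiliser meets that of
    [orig t] in a subgroup fixing some edge; by [incl_orbit] this is the stabiliser of [t]. *)
Lemma seg_stab_orig x e t g : seg_edge x e t -> estab e g -> vact g (orig t) = orig t ->
  estab t g.
Proof.
move=> [t0 _ b1 b2] ge gx; have [go gt] := estab_ends ge.
suff [s [bs gs nY]] : exists s, [/\ seg t s, vact g s = s & ~ Y (orig t) s].
  have [f /not_implyP[of_ hf]] : exists f, ~ (orig f = orig t ->
      exists g, [/\ vact g (orig t) = orig t, vact g s = s & ~ estab f g]).
    by apply/existsNP => h; apply: nY.
  have all k : vact k (orig t) = orig t -> vact k s = s -> estab f k.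
    by move=> k1 k2; apply: contrapT => nf; apply: hf; exists k.
  have [_] := incl_orbit t0 of_ (fun k kt => all k (proj1 (estab_ends kt)) (seg_fix bs kt)).
  by apply; apply: all.
case: (EM (Y (orig t) (orig e))) => [Yo|nYo]; last by exists (orig e).
exists (ter e); split=> // Yt; apply: (@edge_neq _ tS e).
by rewrite (seg_gate b1 Yo) (seg_gate b2 Yt).
Qed.

(** A walk crossing a vertex of type true with the same point on both sides has
    this point in Y: the element carrying one side to the other fixes it. *)
Lemma cross t f s : typ (ter t) -> orig f = ter t -> f <> erev t ->
  pe t = s -> pe f = s -> Y (ter t) s.
Proof.
move=> tT of_ nf pt pf.
have [k kx fE] := @typ_orbit (erev t) f tT of_.
have ks : vact k s = s by rewrite -{1}pt -pf fE pe_act pe_rev.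
move=> t' ot'; exists k; split=> // kt'.
have h := @typ_stab t' (erev t) k; rewrite ot' in h.
by apply: nf; rewrite fE; apply: h.
Qed.

Lemma seg_edge_neq x e t : seg_edge x e t -> gp t <> gq t.
Proof.
move=> [_ _ b1 b2] h; apply: (@edge_neq _ tS e).
by move: b1 b2; rewrite /seg h => /btw_same-> /btw_same->.
Qed.

Lemma pe_orig t : typ (orig t) = false -> pe t = gp t.
Proof. by rewrite /pe => ->. Qed.

(** The edge [f] is the reverse of a translate of [t] by an element of the
    stabiliser of [x], by [typ_orbit]. This element fixes the gate in [Y x], so
    both segments have the same length and end there; as both contain [orig e],
    which is the far end of the second one, their far ends agree. *)
Lemma seg_norm x e t f : typ x -> seg_edge x e t -> orig f = x -> pe f = orig e ->
  seg_edge x e (erev f) /\ gp (erev f) = orig e.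
Proof.
move=> xT [t0 tx b1 b2] of_ pf.
have ot : orig (erev t) = x by [].
have ofx : orig f = orig (erev t) by rewrite ot.
have xT' : typ (orig (erev t)) by rewrite ot.
have [k kx fE] := typ_orbit xT' ofx; rewrite ot in kx.
have fE' : erev f = eact k t by rewrite fE erev_eact erevK.
have ofT : typ (orig (erev f)) = false.
  by rewrite -[orig (erev f)]/(ter f) typ_ter of_ xT.
have pk : vact k (gp t) = orig e by rewrite -pf fE pe_act pe_rev pe_orig.
have [gk qk] := gate_act k t.
have Yk : Y x (vact k (gq t)) by apply: Y_inv => //; rewrite -tx; case: (gateP t).
have qq : vact k (gq t) = gq t.
  rewrite -tx in Yk; apply: (btw_antisym (v := orig e)) _ (seg_proj b1 Yk).
  have := seg_proj (t := eact k t) (s := gp (eact k t)) (z := gq t) (btwl _ _ _).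
  rewrite gk qk pk; apply; rewrite ter_eact tx kx -tx; by case: (gateP t).
have ps : gp t = orig e.
  have := btw_dist b1; rewrite -{2}pk -{2}qq dist_vact => /eqP.
  by rewrite -[X in X == _]add0n eqn_add2r => /eqP/esym/dist0.
rewrite fE' gk pk; split=> //; split.
- by rewrite orig_eact typ_act.
- by rewrite ter_eact tx kx.
- by rewrite /seg gk qk qq pk; apply: btwl.
- by rewrite /seg gk qk qq pk -ps.
Qed.

(** By [cross] the gate would be in [Y] of the other end as well, and the
    segment would be trivial. *)
Lemma seg_edge_cross x e t f f' h : seg_edge x e t -> vact h (orig t) = orig t ->
  f = eact h t -> orig f' = ter f -> f' <> erev f -> pe f = orig e -> pe f' = orig e ->
  False.
Proof.
move=> he hx fE of' nf pf pf'; have [t0 tx _ _] := he.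
have f0 : typ (orig f) = false by rewrite fE orig_eact typ_act.
have Yf : Y (ter f) (orig e) by apply: cross of' nf pf pf'; rewrite typ_ter f0.
apply: (seg_edge_neq he).
have pg : gp f = orig e by rewrite -pf pe_orig.
have := seg_gate' (t := f) (s := gp f) (btwl _ _ _); rewrite pg => /(_ Yf).
rewrite -pg fE (proj1 (gate_act _ _)) (proj2 (gate_act _ _)).
by move=> hh; rewrite -[gp t](vactK h) hh vactK.
Qed.

(** The stabiliser of the edge [t1] of [T] carrying [e] fixes [x'], hence the
    way from [x] to [x']. By [incl_orbit] the second edge on this way is a
    translate of [t1]; its segment is then trivial, because its gate at [orig e]
    also belongs to the next vertex. *)
Lemma seg_vs_Y x x' e t : typ x -> x <> x' -> seg_edge x e t -> edge_in (Y x') e ->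
  (forall f, on_walk f (geod tT x x') -> pe f = orig e) -> False.
Proof.
move=> xT xx' he0 Ye all; case E: (geod tT x x') => [|f r]; first by apply: xx'; apply: geod_nil E.
have [of_ gf bf] := geod_cons E; have pf : pe f = orig e by apply: all; rewrite E; left.
have [he gpe] := seg_norm xT he0 of_ pf; set t1 := erev f in he gpe.
have [t0 tx b1 b2] := he.
have o1 : orig t1 = ter f by [].
have fixx' c : estab t1 c -> vact c x' = x'.
  by move=> /(seg_stab he)/(Y_stab Ye).
have fixx c : estab t1 c -> vact c x = x by move=> /estab_ends[_]; rewrite tx.
case: r E gf => [|f2 r] E gf.
  have x'E := geod_nil gf; have [_ Yt] := Ye.
  apply: (@edge_neq _ tS e); rewrite -gpe -(seg_gate b2) // o1 x'E; exact: Yt.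
have [of2 gf2 bf2] := geod_cons gf.
have in2 : on_walk f2 (geod tT x x') by rewrite E /=; tauto.
have ofs : orig f2 = orig t1 by rewrite of2.
have sub c : estab t1 c -> estab f2 c.
  by move=> h; apply: fix_geod (fixx _ h) (fixx' _ h) in2.
have [[h hx f2E] _] := incl_orbit t0 ofs sub.
have pf2 := all _ in2.
case: r E gf gf2 => [|f3 r] E gf gf2.
  have x'E := geod_nil gf2.
  have f20 : typ (orig f2) = false by rewrite f2E orig_eact typ_act.
  have pg : gp f2 = orig e by rewrite -pf2 pe_orig.
  apply: (seg_edge_neq he).
  have := seg_gate' (t := f2) (s := gp f2) (btwl _ _ _).
  rewrite pg x'E => /(_ (proj1 Ye)); rewrite -pg f2E (proj1 (gate_act _ _)) (proj2 (gate_act _ _)).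
  by move=> hh; rewrite -[gp t1](vactK h) hh vactK.
have [of3 _ _] := geod_cons gf2.
have in3 : on_walk f3 (geod tT x x') by rewrite E /=; tauto.
apply: (seg_edge_cross he hx f2E of3 _ pf2 (all _ in3)).
by have := geod_red tT x x'; rewrite E => -[_ [h32 _]].
Qed.

(** The stabiliser of [t] cannot fix [g1], otherwise [incl_orbit] and
    [seg_edge_cross] apply. An element [y] fixing [t'] fixes [x'] and [e], hence
    commutes with the stabiliser of [t]; if it moved [orig t] then the latter
    would fix [g1]. *)
Lemma seg_far x x' e t t' (g1 : edge T) mid : x <> x' -> seg_edge x e t -> seg_edge x' e t' ->
  (forall f, on_walk f (geod tT x x') -> pe f = orig e) ->
  geod tT x x' = erev t :: g1 :: mid ++ [:: t'] ->
  (forall y, estab t' y -> estab t y) /\ exists2 c, estab t c & ~ estab g1 c.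
Proof.
move=> xx' he he' all E.
have [t0 tx b1 b2] := he; have [t0' tx' b1' b2'] := he'.
have [_ gE _] := geod_cons E; rewrite ter_rev in gE.
have [og gg1 bg] := geod_cons gE.
have in1 : on_walk g1 (geod tT x x') by rewrite E /=; tauto.
have nfix : exists2 c, estab t c & ~ estab g1 c.
  apply: contrapT => no.
  have sub c : estab t c -> estab g1 c.
    by move=> h; apply: contrapT => n; apply: no; exists c.
  have [[h hx g1E] _] := incl_orbit t0 og sub.
  have [f3 [r mE]] : exists f3 r, mid ++ [:: t'] = f3 :: r.
    by case: (mid) => [|a l]; [exists t', [::]|exists a, (l ++ [:: t'])].
  rewrite mE in E gg1.
  have [of3 _ _] := geod_cons gg1.
  have in3 : on_walk f3 (geod tT x x') by rewrite E /=; tauto.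
  apply: (seg_edge_cross he hx g1E of3 _ (all _ in1) (all _ in3)).
  by have := geod_red tT x x'; rewrite E => -[_ [h32 _]].
split=> // y ty; have [c ct cg] := nfix.
have ye : estab e y := seg_stab he' ty.
apply: (seg_stab_orig he ye); set x1 := orig t in gE og *.
have yx' : vact y x' = x' by have [_] := estab_ends ty; rewrite tx'.
have [m [m1 m2 m3]] := median tT x1 (vact y x1) x'.
case Em: (geod tT x1 m) => [|a l].
  have mx := geod_nil Em; rewrite -mx in m3.
  have := btw_dist m3; rewrite -{1}yx' dist_vact -{1}[dist _ _ _]add0n => /eqP.
  by rewrite eqn_add2r => /eqP/esym/dist0.
case: cg; have cx1 : vact c x1 = x1 by have [] := estab_ends ct.
have cy : vact c (vact y x1) = vact y x1.
  by rewrite -vactM (abS (seg_stab he ct) ye) vactM cx1.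
apply: (fix_geod (u := x1) (v := vact y x1)) => //.
have ag : a = g1 by move: m2; rewrite /btw Em gE => -[].
by rewrite m1 Em ag; left.
Qed.

Lemma wrev_mid (l : seq (edge T)) (a b : edge T) :
  wrev (a :: l ++ [:: b]) = erev b :: wrev l ++ [:: erev a].
Proof. by rewrite wrev_cons wrev_cat. Qed.

(** When the way has two edges, they carry the same edge of [S], so one is the
    translate of the other by an element of the stabiliser of [e], which is that
    of both edges: the edges agree. On longer ways [seg_far] applies from both
    ends, and the two edge stabilisers contain each other; they fix both ends of
    the way, but not its second edge. *)
Lemma seg_vs_seg x x' e t t' : typ x -> typ x' -> x <> x' -> seg_edge x e t ->
  seg_edge x' e t' -> (forall f, on_walk f (geod tT x x') -> pe f = orig e) -> False.
Proof.
move=> xT xT' xx' he0 he0' all; case E: (geod tT x x') => [|f r].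
  by apply: xx'; apply: geod_nil E.
have [of_ gf bf] := geod_cons E; have pf : pe f = orig e by apply: all; rewrite E; left.
have [f' [l rE]] : exists f' l, r = l ++ [:: f'].
  case: (lastP r) gf => [|l f'] gf; last by exists f', l; rewrite cats1.
  by have := typ_ter f; rewrite (geod_nil gf) of_ xT xT'.
rewrite rE in E gf; clear r rE.
have E' : geod tT x' x = erev f' :: wrev l ++ [:: erev f] by rewrite geodC E wrev_mid.
have [of' gf' _] := geod_cons E'.
have inf' : on_walk f' (geod tT x x') by rewrite E /= on_walk_cat /=; tauto.
have [he gpe] := seg_norm xT he0 of_ pf.
have [he' gpe'] : seg_edge x' e f' /\ gp f' = orig e.
  have := seg_norm xT' he0' of'; rewrite erevK pe_rev; apply; exact: all.
have [t0 tx b1 b2] := he; have [t0' tx' b1' b2'] := he'.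
case: l E E' gf gf' => [|g1 l] E E' gf gf'.
  have [o1 g2 _] := geod_cons gf.
  have o1' : orig f' = orig (erev f) by rewrite o1.
  have sub c : estab (erev f) c -> estab f' c.
    move=> h; apply: seg_stab_orig he' (seg_stab he h) _.
    by rewrite o1'; have [] := estab_ends h.
  have [[h hx f'E] _] := incl_orbit t0 o1' sub.
  have fst u : gp u = orig e -> seg u (ter e) -> exists r, geod tS (gp u) (gq u) = e :: r.
    by move=> pu; rewrite /seg /btw pu geod_edge => ->; exists (geod tS (ter e) (gq u)).
  have [r1 e1] := fst _ gpe b2; have [r2 e2] := fst _ gpe' b2'.
  have he1 : eact h e = e.
    have [hg hq] := gate_act h (erev f).
    by move: e2; rewrite f'E hg hq geod_eact e1 => -[].
  have ht : estab (erev f) h by apply: seg_stab_orig he he1 hx.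
  by apply: xx'; rewrite -tx -tx' f'E (ht : eact h _ = _).
have E1 : geod tT x x' = erev (erev f) :: g1 :: l ++ [:: f'] by rewrite erevK E.
have [_ [c ct cg]] := seg_far xx' he he' all E1.
have [g2 [l2 lE]] : exists (g2 : edge T) l2, wrev (g1 :: l) = g2 :: l2.
  case W: (wrev (g1 :: l)) => [|g2 l2]; last by exists g2, l2.
  by have := size_wrev (g1 :: l); rewrite W.
rewrite lE in E'.
have all' u : on_walk u (geod tT x' x) -> pe u = orig e.
  by rewrite geodC on_walk_wrev => /all; rewrite pe_rev.
have [sub _] := seg_far (nesym xx') he' he all' E'.
case: cg; apply: (fix_geod (u := x) (v := x')).
- by have [_] := estab_ends ct; rewrite tx.
- by have [_] := estab_ends (sub _ ct); rewrite tx'.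
- by rewrite E /=; tauto.
Qed.

(** If all points attached to the edges between [x] and [x'] were the origin of
    the common edge [e], then one of the preceding lemmas would apply, according
    to the kind of [e] in the two sets. *)
Lemma Z_nofold x x' e : x <> x' -> edge_in (Z x) e -> edge_in (Z x') e ->
  exists2 t, on_walk t (geod tT x x') & pe t <> orig e.
Proof.
move=> xx' /Z_edge hx /Z_edge hx'; apply: contrapT => no.
have all f : on_walk f (geod tT x x') -> pe f = orig e.
  by move=> h; apply: contrapT => n; apply: no; exists f.
have all' f : on_walk f (geod tT x' x) -> pe f = orig e.
  by rewrite geodC on_walk_wrev => /all; rewrite pe_rev.
have segT z t : seg_edge z e t -> typ z by move=> [t0 <- _ _]; rewrite typ_ter t0.
case: hx => [Yx|[t ht]]; case: hx' => [Yx'|[t' ht']].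
- by apply: xx'; apply: (Y_only Yx) => g; apply: Y_stab Yx'.
- exact: (seg_vs_Y (segT _ _ ht') (nesym xx') ht' Yx all').
- exact: (seg_vs_Y (segT _ _ ht) xx' ht Yx' all).
- exact: (seg_vs_seg (segT _ _ ht) (segT _ _ ht') xx' ht ht' all).
Qed.

(** By minimality of [S]: the union of the sets [Z x] is an invariant subtree.
    *)
Lemma Z_cover e : exists x, edge_in (Z x) e.
Proof.
suff inv : invariant_subtree (gtree_act S) (fun s => exists x, Z x s)
    (fun e => exists x, edge_in (Z x) e).
  by have [_] := @gtree_min _ S _ _ inv; apply.
split.
- split; first by case: tT => -[x] _ _; have [s h] := Y_ne x; exists s, x; left.
  by move=> a [x h]; split; [exists x; apply: edge_in_rev|exists x; case: h].
- move=> s s' [x h] [x' h']; have := geodP tT x x'.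
  move: (geod _ _ _) => l; elim: l x s h => [|t l IHl] x s h /=.
    move=> xx; rewrite -xx in h'; exists (geod tS s s').
    apply: path_inI; first exact: geodP.
    by move=> a /(geod_conv (@Z_conv x) h h') ?; exists x.
  move=> [ot _ wl].
  have hp : Z x (pe t) by rewrite -ot; apply: Z_pe.
  have hp' : Z (ter t) (pe t) by rewrite -pe_rev; apply: Z_pe.
  have [l2 /path_inP[w2 i2]] := IHl _ _ hp' wl.
  exists (geod tS s (pe t) ++ l2); apply: path_inI.
    exact: walk_catI (geodP _ _ _) w2.
  move=> a /on_walk_cat[/(geod_conv (@Z_conv x) h hp) ?|/i2 //]; by exists x.
- by move=> g s [x h]; exists (vact g x); apply: Z_act.
- move=> g a [x [h1 h2]]; exists (vact g x).
  by split; rewrite [_ (actE _ _ _)](orig_eact, ter_eact); apply: Z_act.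
Qed.

Lemma rigid_compatible : compatible T S.
Proof.
apply: (@compatible_of_cover _ T S Z pe).
- by move=> x; have [s h] := Y_ne x; exists s; left.
- exact: Z_conv.
- exact: Z_act.
- exact: Z_pe.
- exact: pe_rev.
- exact: pe_act.
- exact: Z_nofold.
- exact: Z_cover.
Qed.

End Rigid.

(** * Moves between configurations, and parities *)

Lemma odd_abszD (x y : int) : odd (absz (x + y)%R) = odd (absz x) (+) odd (absz y).
Proof. by lia. Qed.

Section Reach.
Variable L : seq rule.
Definition vstep (x y : 'rV[int]_2) := exists i c, i < size L /\
  (x = c *m tri (nth scale_rule L i).1 /\ y = c *m tri (nth scale_rule L i).2)%R.
Inductive vconn (x : 'rV[int]_2) : 'rV[int]_2 -> Prop :=
| vconn_refl : vconn x x
| vconn_fwd y z : vconn x y -> vstep y z -> vconn x z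
| vconn_bwd y z : vconn x y -> vstep z y -> vconn x z.

(** The last coordinate 1 forces the last diagonal entry of the rule to be 1, on
    both sides at once. *)
Lemma vconn_cfg x y : all wf_rule L -> vconn (cfg x) y -> exists m, y = cfg m.
Proof.
move=> wfL; have key (c : 'rV[int]_2) (t t' : tri_data) m : wf_tri t -> wf_tri t' -> (t.2 == 1)%N == (t'.2 == 1)%N ->
    (cfg m = c *m tri t -> exists m', c *m tri t' = cfg m')%R.
  move=> wt wt' tt h; exists ((c *m tri t') ord0 ord0)%R.
  have h1 : (c ord0 (lift ord0 ord0) * t.2%:Z = 1)%R.
    by rewrite -mul_tri1 -h; case: (cfgE m).
  have t2 : t.2 = 1%N.
    move: (congr1 absz h1); rewrite abszM => /eqP.
    by rewrite muln_eq1 => /andP[_ /eqP].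
  have c1 : (c ord0 (lift ord0 ord0) = 1)%R by rewrite t2 mulr1 in h1.
  have t2' : t'.2 = 1%N by apply/eqP; rewrite -(eqP tt) t2.
  apply: row2P; first by case: (cfgE ((c *m tri t') ord0 ord0)%R) => ->.
  by rewrite mul_tri1 c1 t2' mulr1; case: (cfgE ((c *m tri t') ord0 ord0)%R).
elim=> [|y' z _ [m ->] [i [c [lt [h ->]]]]|y' z _ [m ->] [i [c [lt [-> h]]]]].
- by exists x.
- have /and3P[w1 w2 w3] := wf_nth wfL i; exact: key w1 w2 w3 h.
- have /and3P[w1 w2 w3] := wf_nth wfL i; apply: key w2 w1 _ h.
  by rewrite eq_sym.
Qed.
End Reach.

Section Parity.
Variables (num : bool -> int) (L : seq rule).
Hypothesis wfL : all wf_rule L.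
Local Notation X := (machine_vgbs num wfL).
Local Notation G := (pi1 X).
Local Notation T := (TX num wfL).
Local Notation gam := (@gamX num L wfL).
Local Notation gamP := (@gamXP num L wfL).
Local Notation a_ := (a_ num wfL).
Local Notation b_ := (b_ num wfL).

(** The first coordinate, and 0 in rank 0. *)
Definition vfst (v : 'I_(nV X).+1) (x : 'rV[int]_(vrank v)) : int :=
  if insub 0%N is Some i then x ord0 i else 0%R.
Definition parl (j : bool) (l : letter X) : bool :=
  if l is inl x then (val (tag x) == j.+1)%N && odd (absz (vfst (tagged x))) else false.
Definition par j (w : seq (letter X)) : bool := foldr (fun l b => parl j l (+) b) false w.

Lemma par_cat j w1 w2 : par j (w1 ++ w2) = par j w1 (+) par j w2.
Proof. by elim: w1 => [//|l w1 IH] /=; rewrite IH addbA. Qed.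
Lemma par1 j l : par j [:: l] = parl j l.
Proof. by rewrite /par /= addbF. Qed.
Lemma par2 j l l' : par j [:: l; l'] = parl j l (+) parl j l'.
Proof. by rewrite /par /= addbF. Qed.
Lemma vfstD v (x y : 'rV[int]_(vrank v)) : vfst (x + y)%R = (vfst x + vfst y)%R.
Proof. by rewrite /vfst; case: insub => [i|]; rewrite ?mxE ?addr0. Qed.

(** The edge relations involve only even multiples of the generators of the
    groups of rank one. *)
Lemma par_weq j w1 w2 : weq w1 w2 -> par j w1 = par j w2.
Proof.
elim=> {w1 w2}.
- by [].
- by move=> w1 w2 _ ->.
- by move=> w1 w2 w3 _ -> _ ->.
- by move=> w1 w1' w2 w2' _ h1 _ h2; rewrite !par_cat h1 h2.
- move=> v; rewrite par1 /parl /= (_ : vfst _ = 0%R) ?andbF //=.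
  by rewrite /vfst; case: insub => [i|]; rewrite ?mxE.
- move=> v x y; rewrite par2 par1 /parl /= vfstD odd_abszD.
  by case: (_ == _).
- by move=> e b; rewrite par2.
- move=> [[|[|i]] lt] c; rewrite par1 -cat1s par_cat par2 par1 /parl //= addbF.
  + rewrite /vfst insubT //= mxE big_ord1 !mxE abszM oddM andbF.
    by rewrite andbF.
  + rewrite /vfst insubT //= mxE big_ord1 !mxE abszM oddM andbF.
    by rewrite andbF.
Qed.

Definition parG j (g : G) : bool := par j (val (repr g)).
Lemma parG_to j p : parG j (to_pi1 p) = par j (val p).
Proof. exact/par_weq/repr_pi1. Qed.
Lemma parG_gw j w : is_wpath ord0 w ord0 -> parG j (gw w) = par j w.
Proof. by move=> h; rewrite parG_to lofE. Qed.
Lemma parGM j g h : parG j (g * h) = parG j g (+) parG j h.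
Proof. by rewrite -par_cat; apply: par_weq; apply: repr_pi1. Qed.
Lemma parG1 j : parG j 1 = false.
Proof. by have := parGM j 1 1; rewrite mulg1; case: (parG j 1). Qed.
Lemma parGV j g : parG j g^-1 = parG j g.
Proof. by have := parGM j g g^-1; rewrite mulgV parG1; case: (parG j g); case: (parG _ _). Qed.
Lemma parGX j g n : parG j (g ^+ n) = odd n && parG j g.
Proof.
elim: n => [|n IHn]; first by rewrite expg0 parG1.
by rewrite expgS parGM IHn /=; case: (odd n); case: (parG j g).
Qed.
Lemma parGJ j g h : parG j (g * h * g^-1) = parG j h.
Proof. by rewrite !parGM parGV; case: (parG j g); case: (parG j h). Qed.
Lemma parG_a j x : parG j (a_ x) = false.
Proof. by rewrite a_gw parG_gw. Qed.
Lemma parG_b j i n : parG j (b_ i n) = (i == j) && odd (absz n).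
Proof.
rewrite b_gw parG_gw ?blet_path //; case: i; rewrite /= /parl /= addbF /vfst insubT //= mxE.
  by case: j.
by case: j.
Qed.
Lemma parG_t j i (lt : i < size L) : parG j (t_ (er num wfL lt)) = false.
Proof.
by rewrite t_gw parG_gw.
Qed.

(** The edges of the elements b_j; the others are the loops of the rules. *)
Definition num_edge : pred 'I_(nE X) := fun e => (val e < 2)%N.
Definition tg (p : vert T) : 'I_3 := (sval p).1.

Lemma machine_step (E : edge T) g : ~ keep num_edge E -> orig E = vtx gam ord0 g ->
  exists i (lt : i < size L) x, 
    (E = edg gam (er num wfL lt) true (g * a_ x) /\
     ter E = vtx gam ord0 (g * a_ x * t_ (er num wfL lt))) \/
    (E = edg gam (er num wfL lt) false (g * a_ x * (t_ (er num wfL lt))^-1) /\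
     ter E = vtx gam ord0 (g * a_ x * (t_ (er num wfL lt))^-1)).
Proof.
move=> nK oE; have [[[[|[|i]] lt] b] [x [ov EE]]] := @oed_surj X gam gamP ord0 g E oE.
- by case: nK; rewrite EE /keep /oed; case: b {ov EE}.
- by case: nK; rewrite EE /keep /oed; case: b {ov EE}.
exists i, lt, x.
rewrite EE; case: b {ov EE}; [left|right]; split=> //.
  by rewrite (ter_oed gamP); congr (vtx gam _ _); apply: val_inj.
by rewrite (ter_oed gamP).
Qed.

Lemma ccls_tg p q : ccls (keep num_edge) p q -> p = q \/ tg p = ord0 /\ tg q = ord0.
Proof.
move=> [s sP]; elim: s p sP => [|E s IHs] p; first by left.
move=> [oE nK sP]; right.
have tags : tg (orig E) = ord0 /\ tg (ter E) = ord0.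
  have [e [b [g EE]]] := edgP E; subst E.
  have eT : eter e = ord0.
    apply: val_inj; case: e nK {oE sP} => [[|[|i]] lt] //= [] //.
  by rewrite /ter [erev _]brevE [orig _](borigE gamP) [orig _](borigE gamP); case: (b).
rewrite -oE; split; first by case: tags.
have [<-|[_ ->]] := IHs _ sP => //; by case: tags.
Qed.

Lemma ccls_ind (P : G -> Prop) h h' :
  (forall k x, P k -> P (k * a_ x)) ->
  (forall k i (lt : i < size L), P k -> P (k * t_ (er num wfL lt))) ->
  (forall k i (lt : i < size L), P k -> P (k * (t_ (er num wfL lt))^-1)) ->
  ccls (keep num_edge) (vtx gam ord0 h : vert T) (vtx gam ord0 h' : vert T) -> P h -> P h'.
Proof.
move=> Pa Pt Pt' [s sP]; elim: s h sP => [|E s IHs] h.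
  by move=> /(vtx_eq gamP)[x hx] Ph; rewrite -[h'](mulVKg h) hx; apply: Pa.
move=> [oE nK sP] Ph.
have [i [lt [x [[_ tE]|[_ tE]]]]] := machine_step nK oE; rewrite tE in sP.
  by apply: IHs sP _; apply: Pt; apply: Pa.
by apply: IHs sP _; apply: Pt'; apply: Pa.
Qed.

Lemma ccls_par j h h' : ccls (keep num_edge) (vtx gam ord0 h : vert T) (vtx gam ord0 h' : vert T) ->
  parG j h = parG j h'.
Proof.
move=> c; apply: (ccls_ind (P := fun k => parG j h = parG j k)) c _ => //.
- by move=> k x ->; rewrite parGM parG_a addbF.
- by move=> k i lt ->; rewrite parGM parG_t addbF.
- by move=> k i lt ->; rewrite parGM parGV parG_t addbF.
Qed.

(** Along a class of vertices of rank two, parities are constant, so its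
    stabiliser is even for both j; the stabiliser of a vertex of rank one
    consists of conjugates of powers of one element b_j, which are even for the
    other one. *)
Lemma stab_par (x : vert (CT num_edge)) : exists j, forall g, vact g x = x -> parG j g = false.
Proof.
have [p xE] := cv_surj x; have [v [h pE]] := vtxP p.
have stab g : vact g x = x -> ccls (keep num_edge) (vtx gam v (g * h) : vert T) (vtx gam v h : vert T).
  rewrite xE [vact _ _](cactV_cv (@keep_act num L wfL num_edge)) pE => /(cv_eq (@keep_rev num L wfL num_edge)).
  by rewrite vact_vtx.
case: (EM (v = ord0)) => [v0|v0].
  subst v; exists false => g /stab/(@ccls_par false); rewrite parGM.
  by case: (parG false g); case: (parG _ _).
have [i vE] : exists i : bool, v = eter (ej L i : 'I_(nE X)).
  case: v v0 {pE stab} => [[|[|[|//]]] lt] v0; first by case: v0; apply: val_inj.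
    by exists false; apply: val_inj.
  by exists true; apply: val_inj.
subst v; exists (~~ i) => g /stab/ccls_tg[/esym/(vtx_eq gamP)[y hy]|[/v0]//].
have [n yE] : exists n, y = const_mx n.
  exists (vfst y); rewrite /vfst; clear; case: i y => y; rewrite insubT //=;
  by apply/rowP => k; rewrite mxE; congr (y _ _); apply/val_inj; case: k => [[]].
have gE : g = h * b_ i n * h^-1.
  by rewrite /b_ -yE -hy !mulgA mulgV mul1g mulgK.
by rewrite gE parGJ parG_b; case: (i).
Qed.

End Parity.

(** * Disconnected numbers: a universally compatible tree *)

Section NonHalting.
Variables (num : bool -> int) (L : seq rule).
Hypothesis wfL : all wf_rule L.
Local Notation X := (machine_vgbs num wfL).
Local Notation G := (pi1 X).
Local Notation T := (TX num wfL).
Local Notation gam := (@gamX num L wfL).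
Local Notation gamP := (@gamXP num L wfL).
Local Notation a_ := (a_ num wfL).
Local Notation b_ := (b_ num wfL).
Local Notation er := (er num wfL).
Local Notation num_edge := (@num_edge num L wfL).
Local Notation C := (CT num_edge).
Local Notation tg := (@tg num L wfL).
Local Notation cv := (@cv _ T (keep num_edge)).

Definition vt0 (g : G) : vert T := vtx gam ord0 g.
Definition vtj j (g : G) : vert T := vtx gam (@eter X (ej L j)) g.

Lemma vt0E g h : vt0 g = vt0 h <-> exists x, h = g * a_ x.
Proof.
split=> [/(vtx_eq gamP)[x hx]|[x ->]]; last by apply/(vtx_eq gamP); exists x; rewrite mulKg.
by exists x; rewrite -[h](mulVKg g) hx.
Qed.
Lemma vtjE j g h : vtj j g = vtj j h <-> exists n, h = g * b_ j n.
Proof.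
split=> [/(vtx_eq gamP)[x hx]|[n ->]]; last by apply/(vtx_eq gamP); exists (const_mx n); rewrite mulKg.
have [n xE] : exists n, x = const_mx n.
  exists (vfst x); rewrite /vfst; clear; case: j x => x; rewrite insubT //=;
  by apply/rowP => k; rewrite mxE; congr (x _ _); apply/val_inj; case: k => [[]].
by exists n; rewrite -[h](mulVKg g) hx xE.
Qed.
Lemma vt_act g h : vact g (vt0 h) = vt0 (g * h). Proof. exact: vact_vtx. Qed.
Lemma vtj_act j g h : vact g (vtj j h) = vtj j (g * h). Proof. exact: vact_vtx. Qed.
Lemma vt_cases p : (exists h, p = vt0 h) \/ exists j h, p = vtj j h.
Proof.
have [v [h ->]] := vtxP p; case: v => [[|[|[|//]]] lt].
- by left; exists h; rewrite /vt0; congr (vtx gam _ _); apply: val_inj.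
- by right; exists false, h; rewrite /vtj; congr (vtx gam _ _); apply: val_inj.
- by right; exists true, h; rewrite /vtj; congr (vtx gam _ _); apply: val_inj.
Qed.
Lemma tg_vt0 g : tg (vt0 g) = ord0. Proof. by []. Qed.
Lemma tg_vtj j g : tg (vtj j g) <> ord0. Proof. by case: j. Qed.
Lemma tg_act g p : tg (vact g p) = tg p.
Proof. by case: (vt_cases p) => [[h ->]|[j [h ->]]]; rewrite ?vt_act ?vtj_act. Qed.
Lemma vtj_tag j j' g h : vtj j g = vtj j' h -> j = j'.
Proof. by move=> /(congr1 (fun p => val (tg p))); case: j; case: j'. Qed.

Lemma num_edge_ej j : num_edge (ej L j). Proof. by case: j. Qed.
Definition ke j g : edge C := exist _ (edg gam (ej L j) true g : edge T) (num_edge_ej j).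

Lemma keP (t : edge C) : exists j g, t = ke j g \/ t = erev (ke j g).
Proof.
case: t => E Qe; have [e [b [g EE]]] := edgP E; subst E.
have [j eE] : exists j, e = ej L j.
  case: e Qe => [[|[|i]] lt] // _; first by exists false; apply: val_inj.
  by exists true; apply: val_inj.
exists j, g; subst e; case: b Qe => Qe; [left|right]; apply: eq_exist => //.
Qed.
Lemma ke_act h j g : eact h (ke j g) = ke j (h * g).
Proof. by apply: eq_exist; apply: eact_edg. Qed.
Lemma orig_ke j g : orig (ke j g) = cv (vt0 g).
Proof. by rewrite [LHS]/(cv _) [orig _](borigE gamP). Qed.
Lemma ter_ke j g : ter (ke j g) = cv (vtj j g).
Proof.
rewrite [LHS]/(cv (borig (brev (edg gam (ej L j) true g)))) brevE (borigE gamP) /=.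
by rewrite -/(t_ _) t_ej mulg1.
Qed.
Lemma estab_ke j g h : estab (ke j g) h <-> exists n, h = g * a_ (n *: cfg (num j))%R * g^-1.
Proof.
have cE i (c : 'rV[int]_1) : a_ (c *m cfg (num i))%R = a_ (c ord0 ord0 *: cfg (num i))%R.
  by rewrite mul_cfg.
split=> [/(congr1 sval)/estab_edg[c hc]|[n ->]].
  have -> : h = g * (g^-1 * h * g) * g^-1 by rewrite !mulgA mulgV mul1g mulgK.
  rewrite {}hc; case: j c => c; exists (c ord0 ord0); congr (_ * _ * _); exact: cE.
apply: eq_exist; apply/estab_edg; rewrite !mulgA mulVg mul1g mulgVK.
by case: (j); exists (const_mx n); rewrite [in RHS]/= [in RHS]mul_cfg mxE.
Qed.

Lemma conj_scale k x y (n : int) : a_ x = k * a_ y * k^-1 ->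
  a_ (n *: x)%R = k * a_ (n *: y)%R * k^-1.
Proof.
have hn m z : a_ ((Posz m) *: z)%R = a_ z ^+ m by rewrite -natz scaler_nat [LHS](esym (velX gamP _ _)).
have cX m : (k * a_ y * k^-1) ^+ m = k * a_ y ^+ m * k^-1.
  elim: m => [|m IHm]; first by rewrite !expg0 mulg1 mulgV.
  by rewrite !expgS IHm !mulgA mulgVK.
move=> h; case: n => m; first by rewrite !hn h cX.
rewrite NegzE !scaleNr ![a_ (- _)%R](velN gamP) -!/(a_ _) !hn h cX.
by rewrite !invgM invgK mulgA.
Qed.

Lemma ccls_kept p q : cv p = cv q :> vert C <-> ccls (keep num_edge) p q.
Proof. exact: (cv_eq (@keep_rev num L wfL num_edge)). Qed.
Lemma cv_act g p : vact g (cv p : vert C) = cv (vact g p).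
Proof. exact: cactV_cv. Qed.

Definition typ (x : vert C) : bool := `[< exists p, x = cv p /\ tg p <> ord0 >].
Lemma typE p : typ (cv p) = (tg p != ord0).
Proof.
apply/idP/idP => [/asboolP[q [/ccls_kept/ccls_tg h nq]]|/eqP h].
  by apply/eqP; case: h nq => [<-|[_ ->]].
by apply/asboolP; exists p.
Qed.
Lemma typ_act g x : typ (vact g x) = typ x.
Proof. by have [p ->] := cv_surj x; rewrite cv_act !typE tg_act. Qed.
Lemma typ_orig_ke j g : typ (orig (ke j g)) = false.
Proof. by rewrite orig_ke typE tg_vt0 eqxx. Qed.
Lemma typ_ter_ke j g : typ (ter (ke j g)) = true.
Proof. by rewrite ter_ke typE; apply/eqP/tg_vtj. Qed.
Lemma typ_ter (t : edge C) : typ (ter t) = ~~ typ (orig t).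
Proof.
have [j [g [->|->]]] := keP t; first by rewrite typ_ter_ke typ_orig_ke.
by rewrite ter_rev -[orig (erev _)]/(ter (ke j g)) typ_ter_ke typ_orig_ke.
Qed.

Lemma edges_true (t f : edge C) : typ (orig t) -> orig f = orig t ->
  exists j g n, t = erev (ke j g) /\ f = erev (ke j (g * b_ j n)).
Proof.
have [j [g [->|->]]] := keP t; first by rewrite typ_orig_ke.
have [j' [g' [->|->]]] := keP f => _.
  by move/(congr1 typ); rewrite typ_orig_ke -[orig (erev _)]/(ter (ke j g)) typ_ter_ke.
rewrite -[orig (erev (ke j g))]/(ter (ke j g)) -[orig (erev (ke j' g'))]/(ter (ke j' g')).
rewrite !ter_ke => /esym/ccls_kept/ccls_tg[|[/tg_vtj //]].
move=> h; have jj := vtj_tag h; subst j'; move/vtjE: h => [n ->].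
by exists j, g, n.
Qed.

Lemma edge_orbit_true (t f : edge C) : typ (orig t) -> orig f = orig t ->
  exists2 k, vact k (orig t) = orig t & f = eact k t.
Proof.
move=> tT /(edges_true tT)[j [g [n [-> ->]]]]; exists (g * b_ j n * g^-1).
  rewrite -[orig (erev _)]/(ter (ke j g)) ter_ke cv_act vtj_act mulgVK.
  by congr cv; apply/esym/vtjE; exists n.
by rewrite -erev_eact ke_act mulgVK.
Qed.

Lemma b_comm_a j n m : commute (b_ j n) (a_ (m *: cfg (num j))%R).
Proof. by rewrite -b_even /commute -!b_D addrC. Qed.

Lemma estab_rev (t : edge C) g : estab (erev t) g <-> estab t g.
Proof.
by rewrite /estab -erev_eact; split=> [/(congr1 (@erev C))|->]; rewrite ?erevK.
Qed.

Lemma edge_stab_true (t f : edge C) g : typ (orig t) -> orig f = orig t -> estab t g -> estab f g.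
Proof.
move=> tT /(edges_true tT)[j [k [n [-> ->]]]] /estab_rev/estab_ke[m ->].
apply/estab_rev/estab_ke; exists m.
by rewrite invgM -!mulgA; congr (_ * _); rewrite !mulgA b_comm_a mulgK.
Qed.

Lemma cjM (g h x : G) : g * h * x * (g * h)^-1 = g * (h * x * h^-1) * g^-1.
Proof. by rewrite invgM !mulgA. Qed.
Lemma cj_a d x : a_ d * a_ x * (a_ d)^-1 = a_ x.
Proof. by rewrite (velC gamP) mulgK. Qed.
Lemma cj_t i (lt : i < size L) c :
  t_ (er lt) * a_ (c *m tri (nth scale_rule L i).2)%R * (t_ (er lt))^-1 =
  a_ (c *m tri (nth scale_rule L i).1)%R.
Proof. by rewrite t_conj mulgK. Qed.
Lemma cj_tV i (lt : i < size L) c :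
  (t_ (er lt))^-1 * a_ (c *m tri (nth scale_rule L i).1)%R * (t_ (er lt))^-1^-1 =
  a_ (c *m tri (nth scale_rule L i).2)%R.
Proof. by rewrite -cj_t invgK !mulgA mulVg mul1g mulgVK. Qed.

(** An element that fixes both ends of a path of rule edges fixes every edge of
    it; crossing an edge conjugates it by the stable letter of a rule, that is,
    its coordinates make a move of [vconn]. *)
Lemma transport g g' x : ccls (keep num_edge) (vt0 g) (vt0 g') ->
  vact (g * a_ x * g^-1) (vt0 g') = vt0 g' ->
  exists2 y, g * a_ x * g^-1 = g' * a_ y * g'^-1 & vconn L x y.
Proof.
set z := _ * _ => [[s sP0]] zg'; have {s sP0} sP := geod_in (gtree_tree T) sP0.
have zg : vact z (vt0 g) = vt0 g by apply: a_fixes.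
have zE e : on_walk e (geod (gtree_tree T) (vt0 g) (vt0 g')) -> estab e z by apply: fix_geod.
have {zE} sP : path_in (fun e : edge T => ~ keep num_edge e /\ estab e z) (vt0 g) (geod (gtree_tree T) (vt0 g) (vt0 g')) (vt0 g').
  move: sP zE; move: (geod _ _ _) => l; elim: l (vt0 g) => [|E l IHl] u; first by move=> uv _.
  move=> [oE nE lP] zl; split=> //; first by split=> //; apply: zl; left.
  by apply: IHl => // e el; apply: zl; right.
have : exists2 y, z = g * a_ y * g^-1 & vconn L x y by exists x => //; apply: vconn_refl.
move: (geod _ _ _) sP => l; clearbody z; clear zg zg'; move: g.
suff: forall g, path_in (fun e : edge T => ~ keep num_edge e /\ estab e z) (vt0 g) l (vt0 g') ->
  (exists2 y, z = g * a_ y * g^-1 & vconn L x y) -> exists2 y, z = g' * a_ y * g'^-1 & vconn L x y by move=> h g; apply: h.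
elim: l => [|E l IHl] g.
  move=> /vt0E[c ->] [y zE xy]; exists y => //.
  by rewrite zE invgM -!mulgA; congr (_ * _); rewrite !mulgA (velC gamP) mulgK.
move=> [oE [nK zEE] lP] [y zE xy].
have key (b : bool) i (lt : i < size L) k : E = edg gam (er lt) b k ->
    exists c, z = k * a_ (c *m tri (nth scale_rule L i).1)%R * k^-1.
  move=> EE; move: zEE; rewrite EE => /estab_edg[c hc]; exists c.
  by rewrite -[a_ _]/(vel gam (c *m inc_org (er lt))) -hc !mulgA mulgV mul1g mulgK.
have inj (u v : 'rV[int]_2) k : k * a_ u * k^-1 = k * a_ v * k^-1 -> u = v.
  by move=> /mulIg/mulgI/(@a_inj num L wfL).
have [i [lt [d [[EE tE]|[EE tE]]]]] := machine_step nK oE; rewrite tE in lP.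
  have [c zc] := key _ _ _ _ EE; apply: IHl lP _.
  have yE : y = (c *m tri (nth scale_rule L i).1)%R.
    by apply: (inj _ _ g); rewrite -zE zc cjM cj_a.
  exists (c *m tri (nth scale_rule L i).2)%R; last first.
    by apply: vconn_fwd xy _; exists i, c.
  by rewrite zc [RHS]cjM cj_t.
have [c zc] := key _ _ _ _ EE; apply: IHl lP _.
exists (c *m tri (nth scale_rule L i).1)%R => //.
have yE : y = (c *m tri (nth scale_rule L i).2)%R.
  by apply: (inj _ _ g); rewrite -zE zc cjM cj_tV cjM cj_a.
by apply: vconn_bwd xy _; exists i, c.
Qed.

Lemma vstepV x y : vstep L x y -> vconn L y x.
Proof. by move=> h; apply: vconn_bwd h; apply: vconn_refl. Qed.
Lemma vconn_trans x y z : vconn L x y -> vconn L y z -> vconn L x z.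
Proof.
move=> xy; elim=> [|u v _ h uv|u v _ h uv] //; first exact: vconn_fwd h uv.
exact: vconn_bwd h uv.
Qed.
Lemma vconn_sym x y : vconn L x y -> vconn L y x.
Proof.
elim=> [|u v _ h uv|u v _ h uv]; first exact: vconn_refl.
  exact: vconn_trans (vstepV uv) h.
by apply: vconn_trans _ h; apply: vconn_fwd uv; apply: vconn_refl.
Qed.

Hypothesis nonhalt : ~ vconn L (cfg (num false)) (cfg (num true)).

Lemma vconn_num j j' : vconn L (cfg (num j)) (cfg (num j')) -> j = j'.
Proof. by case: j; case: j' => // h; case: nonhalt; first [exact: h|exact: vconn_sym]. Qed.

(** The stabiliser of [t] is generated by a conjugate of (v_j, 1). If it fixes
    [f] then, by [transport], (v_j, 1) is connected with a multiple of the
    vector (v_j', 1) of [f]. Connected vectors keep last coordinate 1, so the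
    multiple is 1, and j = j' since the two numbers are not connected. *)
Lemma edge_incl_false (t f : edge C) : typ (orig t) = false -> orig f = orig t ->
  (forall g, estab t g -> estab f g) ->
  (exists2 h, vact h (orig t) = orig t & f = eact h t) /\ (forall g, estab f g -> estab t g).
Proof.
have [j [g [->|->]]] := keP t; last by rewrite -[orig (erev _)]/(ter (ke j g)) typ_ter_ke.
have [j' [g' [->|->]]] := keP f; last first.
  by move=> h1 /(congr1 typ); rewrite h1 -[orig (erev _)]/(ter (ke j' g')) typ_ter_ke.
rewrite !orig_ke => _ /esym/ccls_kept gg' incl.
have [|n zE] := (proj1 (estab_ke j' g' _)) (incl (g * a_ (cfg (num j)) * g^-1) _).
  by apply/estab_ke; exists 1%R; rewrite scale1r.
have [|y zy xy] := transport (x := cfg (num j)) gg'.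
  by rewrite zE; apply: a_fixes.
have yE : y = (n *: cfg (num j'))%R.
  by move: zy; rewrite zE => /mulIg/mulgI/(@a_inj num L wfL).
have [m ym] := vconn_cfg wfL xy.
have n1 : n = 1%R.
  have := congr1 (fun v : 'rV_2 => v ord0 (lift ord0 ord0)) ym.
  by rewrite yE !mxE /= mulr1.
rewrite n1 scale1r in yE; rewrite yE in xy zy.
have jj := vconn_num xy; subst j'.
split; last first.
  move=> h /estab_ke[k ->]; apply/estab_ke; exists k.
  have : a_ (cfg (num j)) = (g^-1 * g') * a_ (cfg (num j)) * (g^-1 * g')^-1.
    by rewrite cjM -zy invgK !mulgA mulVg mul1g mulgVK.
  move=> /(conj_scale k) hk; rewrite [in RHS]hk cjM invgK.
  by rewrite !mulgA mulgV mul1g mulgK.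
exists (g' * g^-1); last by rewrite ke_act mulgVK.
by rewrite cv_act vt_act mulgVK; apply/esym/ccls_kept.
Qed.

(** The determinant of a triangular matrix annihilates its cokernel. *)
Lemma tri_multiple (t : tri_data) (y : 'rV[int]_2) : exists c, ((t.1.1 * t.2)%N%:Z *: y = c *m tri t)%R.
Proof.
pose y0 := y ord0 ord0; pose y1 := y ord0 (lift ord0 ord0).
exists (\row_j if j == 0 then t.2%:Z * y0 - y1 * t.1.2%:Z else t.1.1%:Z * y1)%R.
by apply: row2P; rewrite ?mul_tri0 ?mul_tri1 !mxE /=; rewrite ?PoszM; ring.
Qed.

Lemma odd_tri (t : tri_data) : wf_tri t -> odd (t.1.1 * t.2)%N.
Proof. by rewrite oddM => /and3P[-> _ ->]. Qed.

(** Crossing a rule edge costs at most the index m s of the edge group in the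
    vertex group, which is odd. *)
Lemma odd_index p p' : cv p = cv p' :> vert C ->
  exists2 M, odd M & forall g, vact g p' = p' -> vact (g ^+ M) p = p.
Proof.
move=> /ccls_kept pp'; case: (vt_cases p') pp' => [[h' ->]|[j [h' ->]]] pp'; last first.
  have [<-|[_ /tg_vtj //]] := ccls_tg pp'.
  by exists 1%N => // g; rewrite expg1.
have {pp'} /ccls_sym pp' := pp'; have {pp'} pp' := pp' (@keep_rev num L wfL num_edge).
case: (vt_cases p) pp' => [[h ->]|[j [h ->]]] pp'; last first.
  by have [/(congr1 tg)/esym|[_]] := ccls_tg pp'; move/tg_vtj.
(* Along a walk from h' to k, some odd power of the stabiliser at h' fixes k. *)
pose P k := exists2 M, odd M & forall x, exists y, h' * a_ (M%:Z *: x)%R * h'^-1 = k * a_ y * k^-1.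
have step k k' M' : odd M' -> (forall y, exists y', a_ (M'%:Z *: y)%R = k' * a_ y' * k'^-1) -> P k -> P (k * k').
  move=> oM' hk' [M oM hP]; exists (M' * M)%N; first by rewrite oddM oM'.
  move=> x; have [y hy] := hP x; have [y' hy'] := hk' y; exists y'.
  rewrite PoszM -scalerA cjM -hy'.
  have := conj_scale M'%:Z (k := h'^-1 * k) (x := (M%:Z *: x)%R) (y := y).
  rewrite !cjM -hy invgK !mulgA mulVg mul1g mulgVK => /(_ erefl) ->.
  by rewrite !mulgA mulgV mul1g mulgK.
have [M oM hM] : P h.
  apply: (ccls_ind (P := P)) pp' _.
  - move=> k x; apply: (step k _ 1%N) => // y; exists y; by rewrite scale1r cj_a.
  - move=> k i lt; have /and3P[w1 _ _] := wf_nth wfL i.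
    apply: (step k _ _ (odd_tri w1)) => y; have [c ->] := tri_multiple (nth scale_rule L i).1 y.
    by exists (c *m tri (nth scale_rule L i).2)%R; rewrite cj_t.
  - move=> k i lt; have /and3P[_ w2 _] := wf_nth wfL i.
    apply: (step k _ _ (odd_tri w2)) => y; have [c ->] := tri_multiple (nth scale_rule L i).2 y.
    by exists (c *m tri (nth scale_rule L i).1)%R; rewrite cj_tV.
  by exists 1%N => // x; exists x; rewrite scale1r.
exists M => // g /vstab_vtx[x gx].
have gE : g = h' * a_ x * h'^-1 by rewrite -[a_ x]gx !mulgA mulgV mul1g mulgK.
have -> : g ^+ M = h' * a_ (M%:Z *: x)%R * h'^-1.
  have cX m : (h' * a_ x * h'^-1) ^+ m = h' * a_ x ^+ m * h'^-1.
    elim: m => [|m IHm]; first by rewrite !expg0 mulg1 mulgV.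
    by rewrite !expgS IHm !mulgA mulgVK.
  by rewrite gE cX -natz scaler_nat [a_ (_ *+ _)%R](esym (velX gamP _ _)).
by have [y ->] := hM x; apply: a_fixes.
Qed.

(** At a vertex of rank two, the N-th multiples of two independent vectors do
    not both lie in a cyclic group; at a vertex of rank one, an odd power of b_j
    is not in the edge group, which consists of even powers. *)
Lemma power_moves p N (t : edge C) : odd N -> orig t = cv p ->
  exists g, vact g p = p /\ ~ estab t (g ^+ N).
Proof.
move=> oN; have [j [g [->|->]]] := keP t; last first.
  rewrite -[orig (erev _)]/(ter (ke j g)) ter_ke => /ccls_kept/ccls_tg[<-|[/tg_vtj //]].
  exists (g * b_ j 1 * g^-1); split.
    by rewrite vtj_act mulgVK; apply/esym/vtjE; exists 1%R.
  move=> /estab_rev/estab_ke[n] /(congr1 (parG j)).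
  by rewrite parGX !parGJ parG_a parG_b eqxx oN.
rewrite orig_ke => /ccls_kept/ccls_tg; case: (vt_cases p) => [[h ->]|[i [h ->]]] gh; last first.
  by case: gh => [/(congr1 tg)/esym|[_]] /tg_vtj.
pose e (i : bool) : 'rV[int]_2 := (\row_k (if (k == 0) == i then 1 else 0))%R.
pose u i := h * a_ (e i) * h^-1.
apply: contrapT => no.
have key i : exists n, a_ (N%:Z *: e i)%R = (h^-1 * g) * a_ (n *: cfg (num j))%R * (h^-1 * g)^-1.
  have : estab (ke j g) (u i ^+ N).
    apply: contrapT => n; apply: no; exists (u i); split=> //; exact: a_fixes.
  move=> /estab_ke[n hn]; exists n; rewrite cjM -hn.
  have -> : u i ^+ N = h * a_ (e i) ^+ N * h^-1.
    elim: (N) => [|m IHm]; first by rewrite !expg0 mulg1 mulgV.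
    by rewrite !expgS IHm /u !mulgA mulgVK.
  rewrite invgK !mulgA mulVg mul1g mulgVK.
  by rewrite -natz scaler_nat [LHS](esym (velX gamP _ _)).
have [n0 h0] := key false; have [n1 h1] := key true.
have : (n1 *: (N%:Z *: e false) = n0 *: (N%:Z *: e true))%R.
  apply: (@a_inj num L wfL); rewrite (conj_scale n1 h0) (conj_scale n0 h1).
  by rewrite !scalerA mulrC.
have nN : (N%:Z != 0)%R by apply: posz_neq0; apply: odd_gt0.
move=> /(congr1 (fun v : 'rV_2 => v ord0 ord0)); rewrite !mxE /= !mulr0 mulr1.
move=> /esym/eqP; rewrite mulf_eq0 (negPf nN) orbF => /eqP n00.
move: h0; rewrite n00 scale0r [a_ 0%R](vel0 gamP) mulg1 mulgV -(vel0 gamP ord0).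
move/(vel_inj gamP)/(congr1 (fun v : 'rV_2 => v ord0 (lift ord0 ord0))).
by rewrite !mxE /= mulr1 => /eqP; rewrite (negPf nN).
Qed.

Hypothesis L_gt0 : 0 < size L.
Hypothesis L0 : nth scale_rule L 0 = scale_rule.

(** A vertex group of rank two is generated by two commuting elliptic elements,
    which have a common fixed vertex. *)
Lemma vertex_elliptic (S : gtree G) (p : vert T) : exists s : vert S, forall g, vact g p = p -> vact g s = s.
Proof.
have fixX (x : G) (s : vert S) : vact x s = s -> forall n : nat, vact (x ^+ n) s = s.
  by move=> xs; elim=> [|n IHn]; rewrite ?expg0 ?vact1 // expgS vactM IHn.
have fixV (x : G) (s : vert S) : vact x s = s -> vact x^-1 s = s.
  by move=> xs; rewrite -{1}xs vactK.
case: (vt_cases p) => [[h ->]|[j [h ->]]]; last first.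
  have [s sb] := @b_elliptic num L wfL L_gt0 L0 S j 1; exists (vact h s) => g.
  rewrite vtj_act => /esym/vtjE[n gh].
  have -> : g = h * b_ j n * h^-1 by rewrite -gh mulgK.
  rewrite !vactM vactK; congr vact; case: n {gh} => n.
    have -> : b_ j n = b_ j 1 ^+ n.
      elim: n => [|n IHn]; last by rewrite expgS -IHn -b_D.
      by rewrite expg0; apply: (mulgI (b_ j 0)); rewrite -b_D mulg1 addr0.
    exact: fixX.
  have -> : b_ j (Negz n) = (b_ j 1 ^+ n.+1)^-1.
    have bX (m : nat) : b_ j m = b_ j 1 ^+ m.
      elim: m => [|m IHm]; last by rewrite expgS -IHm -b_D.
      by rewrite expg0; apply: (mulgI (b_ j 0)); rewrite -b_D mulg1 addr0.
    rewrite -bX; apply: (mulgI (b_ j n.+1)); rewrite mulgV -b_D NegzE subrr.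
    by have := bX 0%N; rewrite expg0.
  exact/fixV/fixX.
pose e (i : bool) : 'rV[int]_2 := (\row_k (if (k == 0) == i then 1 else 0))%R.
have [s0 h0] := @a_elliptic num L wfL L_gt0 L0 S (e true).
have [s1 h1] := @a_elliptic num L wfL L_gt0 L0 S (e false).
have [s [hs0 hs1]] := elliptic_commute (@velC X gam gamP ord0 (e true) (e false)) h0 h1.
exists (vact h s) => g; rewrite vt_act => /esym/vt0E[x gh].
have -> : g = h * a_ x * h^-1 by rewrite -gh mulgK.
rewrite !vactM vactK; congr vact.
have xE : x = (x ord0 ord0 *: e true + x ord0 (lift ord0 ord0) *: e false)%R.
  by apply: row2P; rewrite !mxE /= ?mulr1 ?mulr0 ?addr0 ?add0r.
have fixn (n : int) u : vact (a_ u) s = s -> vact (a_ (n *: u)%R) s = s.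
  move=> us; case: n => n.
    by rewrite -natz scaler_nat [a_ _](esym (velX gamP _ _)); apply: fixX.
  rewrite NegzE scaleNr [a_ _](velN gamP) -natz scaler_nat; apply: fixV.
  by rewrite -(velX gamP); apply: fixX.
by rewrite xE a_D vactM !fixn.
Qed.

(** In [rigid_compatible], take for [Y0 x] the vertices fixed by the N-th powers
    of the stabiliser of some vertex in the class [x], for some odd N. Odd
    powers absorb the change of representative in the class, by [odd_index], and
    still remember [x], by [power_moves]. *)
Lemma nonhalting_compatible : universally_compatible C.
Proof.
split; first exact: CT_abelian.
move=> S abS.
pose Y0 (x : vert C) (s : vert S) := exists p N, [/\ x = cv p, odd N &
  forall g, vact g p = p -> vact (g ^+ N) s = s].
have fixX (x : G) (V : gtree G) (s : vert V) : vact x s = s -> forall n : nat, vact (x ^+ n) s = s.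
  by move=> xs; elim=> [|n IHn]; rewrite ?expg0 ?vact1 // expgS vactM IHn.
have join x s s' : Y0 x s -> Y0 x s' -> exists p N, [/\ x = cv p, odd N &
    forall g, vact g p = p -> vact (g ^+ N) s = s /\ vact (g ^+ N) s' = s'].
  move=> [p [N [-> oN hp]]] [p' [N' [pp' oN' hp']]].
  have [M oM hM] := odd_index pp'; exists p', (M * N * N')%N; split=> //.
    by rewrite !oddM oM oN oN'.
  move=> g gp'; split; first by rewrite !expgnA; apply: fixX; apply: hp; apply: hM.
  by rewrite mulnC expgnA; apply: fixX; apply: hp'.
have stab_cv p g : vact g p = p -> vact g (cv p : vert C) = cv p by rewrite cv_act => ->.
apply: (@rigid_compatible _ C S typ typ_act typ_ter edge_orbit_true edge_stab_true
  edge_incl_false abS Y0).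
- move=> x; have [p ->] := cv_surj x; have [s hs] := vertex_elliptic S p.
  by exists s, p, 1%N; split=> // g; rewrite expg1; apply: hs.
- move=> x s s' w /join h /h[p [N [xp oN hp]]] b; exists p, N; split=> // g /hp[h1 h2].
  exact: (conv_fix (u := s) (v := s')) h1 h2 b.
- move=> g x s [p [N [-> oN hp]]]; exists (vact g p), N; split=> //; first exact: cv_act.
  move=> h hgp; have := hp (g^-1 * h * g).
  rewrite !vactM hgp vactK => /(_ erefl) hs.
  have -> : h ^+ N = g * (g^-1 * h * g) ^+ N * g^-1.
    have -> : (g^-1 * h * g) ^+ N = g^-1 * h ^+ N * g.
      elim: (N) => [|m IHm]; first by rewrite !expg0 mulg1 mulVg.
      by rewrite !expgS IHm !mulgA mulgK.
    by rewrite !mulgA mulgV mul1g mulgK.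
  by rewrite !vactM vactK hs.
- move=> x s [p [N [-> oN hp]]] t ot; have [g [gp gt]] := power_moves oN ot.
  by exists (g ^+ N); split=> //; [apply: stab_cv; apply: fixX|apply: hp].
- move=> x e [/join h /h[p [N [-> oN hp]]]] t ot.
  have [g [gp gt]] := power_moves oN ot; have [h1 h2] := hp _ gp.
  exists (g ^+ N); split=> //; first by apply: stab_cv; apply: fixX.
  exact: fix_edge.
Qed.

End NonHalting.

(** * Reading connectedness off a JSJ decomposition *)

Section Reading.
Variables (num : bool -> int) (L : seq rule).
Hypothesis wfL : all wf_rule L.
Hypothesis L_gt0 : 0 < size L.
Hypothesis L0 : nth scale_rule L 0 = scale_rule.
Local Notation X := (machine_vgbs num wfL).
Local Notation G := (pi1 X).
Local Notation a_ := (a_ num wfL).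
Local Notation mlet := (@mlet num L wfL).

Lemma gw_nil : gw [::] = 1 :> G.
Proof. by apply/to_pi1P; rewrite lofE //; apply: weq_refl. Qed.

(** A move of [vconn] is a conjugation by a stable letter. *)
Lemma vconn_word x y : vconn L x y ->
  exists2 w, all mlet w & gw w * a_ y * (gw w)^-1 = a_ x.
Proof.
have wpath w : all mlet w -> is_wpath ord0 w ord0.
  by move=> /(@gw_mind num L wfL (fun=> True) I)[].
have step w l z z' : all mlet w -> mlet l -> gw [:: l] * a_ z' * (gw [:: l])^-1 = a_ z ->
    gw w * a_ z * (gw w)^-1 = a_ x ->
    exists2 w, all mlet w & gw w * a_ z' * (gw w)^-1 = a_ x.
  move=> wm lm lz wz; exists (w ++ [:: l]); first by rewrite all_cat wm /= lm.
  rewrite gwM ?wpath //= ?lm // cjM lz; exact: wz.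
elim=> [|y' z _ [w wm wy] [i [c [lt [y'E zE]]]]|y' z _ [w wm wy] [i [c [lt [zE y'E]]]]].
- by exists [::] => //; rewrite gw_nil mul1g invg1 mulg1.
- apply: (step w (@elet X (er num wfL lt) true) y') => //.
  by rewrite -t_gw y'E zE cj_t.
- apply: (step w (@elet X (er num wfL lt) false) y') => //.
  rewrite y'E zE -(cj_tV num wfL lt); congr (_ * _ * _^-1); by rewrite t_gw -gwV.
Qed.

Definition reads (D : decomposition X) :=
  [exists i : 'I_(dV D), has (fun p : loop X => @par num L wfL false (val p)) (dvgen i) &&
                         has (fun p : loop X => @par num L wfL true (val p)) (dvgen i)].

(** Parities are conjugation invariant homomorphisms, so a vertex group has an
    odd element exactly when one of its generators is odd. In the connected
    case, apply this to the vertex fixed by both elements [d_ j]; in the other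
    case, the vertex groups are elliptic in a tree whose vertex stabilisers miss
    one parity. *)
Lemma readsP (D : decomposition X) (T : gtree G) : decomposition_of D T ->
  abelian_compatibility_JSJ T -> reads D <-> vconn L (cfg (num false)) (cfg (num true)).
Proof.
move=> [lv [le q]] [uT domT]; split=> [rD|conn].
  apply: contrapT => no.
  case/existsP: rD => i /andP[/hasP[p pD pp] /hasP[p' pD' pp']].
  have sub : is_subgroup (vstab (lv i)).
    split; first exact: vact1.
    by move=> x y hx hy; rewrite /vstab vactM -{1}hy vactK.
  have fixi : fixes_vertex T (vstab (lv i)) by exists (lv i).
  have [x hx] := domT _ (nonhalting_compatible wfL no L_gt0 L0) _ sub fixi.
  have [j hj] := stab_par x.
  have key (r : loop X) : r \in dvgen i -> par j (val r) = false.
    move=> rD; rewrite -parG_to; apply/hj/hx/(quo_vstab q) => H _; apply; exact: map_f.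
  by case: j hj key => _ key; [rewrite key in pp'|rewrite key in pp].
have [w wm wE] := vconn_word conn.
pose W (j : bool) := if j then w else [::].
have Wm j : all mlet (W j) by case: j.
have dE : @delta num L wfL W false = @delta num L wfL W true.
  by rewrite /delta /wj /W gw_nil mul1g invg1 mulg1 wE.
have [v [v0 v1]] := halting_vertex L_gt0 L0 Wm dE uT.
have [g [i vE]] := quo_surjV q v.
have key j : has (fun p : loop X => @par num L wfL j (val p)) (dvgen i).
  have hd : vstab (lv i) (g^-1 * @d_ num L wfL W j * g).
    have dv : vact (@d_ num L wfL W j) v = v by case: j.
    by move: (d_ W j) dv => d dv; rewrite /vstab !vactM -vE dv vE vactK.
  move/(quo_vstab q): hd => hd; apply: contrapT => /negP/hasPn none.
  have : parG j (g^-1 * @d_ num L wfL W j * g) = true.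
    have : parG j (@d_ num L wfL W j) = true by rewrite parGJ parG_b eqxx.
    move: (d_ W j) => d pd; by rewrite !parGM parGV pd; case: (parG j g).
  rewrite (hd (fun g => parG j g = false)) //.
    by split=> [|x y hx hy]; rewrite ?parG1 // parGM parGV hx hy.
  by move=> _ /mapP[p /none/negbTE hp ->]; rewrite parG_to.
by apply/existsP; exists i; rewrite !key.
Qed.
End Reading.

Local Close Scope group_scope.

(** * Computable functions and coded sequences *)

(** A total function is computable if some recursive function terminates on all
    arguments with its values. Arguments are read in a sequence by [nth], which
    avoids dependent arities. *)
Definition computable n (F : seq nat -> nat) :=
  exists f : rec_fun n, forall x : n.-tuple nat, rec_eval f x (F x).

Lemma computable_ext n F G : (forall x, size x = n -> F x = G x) -> computable n F -> computable n G.
Proof.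
by move=> FG [f hf]; exists f => x; rewrite -FG ?size_tuple //; apply: hf.
Qed.
Lemma computable_nth n i : i < n -> computable n (fun x => nth 0 x i).
Proof. by move=> i_lt; exists (rec_proj (Ordinal i_lt)) => x /=; rewrite (tnth_nth 0). Qed.

Lemma computable_comp k n F (G : nat -> seq nat -> nat) : computable k F ->
  (forall i, i < k -> computable n (G i)) -> computable n (fun x => F (mkseq (G^~ x) k)).
Proof.
move=> [f hf] hG.
have /choice[g hg] : forall i : 'I_k, exists f : rec_fun n, forall x, rec_eval f x (G i x).
  by move=> i; have [g] := hG i (ltn_ord i); exists g.
exists (rec_comp f g) => x /=.
have sz : size (mkseq (G^~ x) k) == k by rewrite size_mkseq.
exists (Tuple sz); split; last exact: hf.
by move=> i; rewrite (tnth_nth 0) nth_mkseq.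
Qed.

Lemma computable_prim n A B : computable n A -> computable n.+2 B ->
  computable n.+1 (fun x => nat_rect (fun=> nat) (A (behead x))
                      (fun m r => B [:: m, r & behead x]) (head 0 x)).
Proof.
move=> [f hf] [g hg]; exists (rec_prim f g) => x /=.
exists (nat_rect (fun=> nat) (A (behead x)) (fun m r => B [:: m, r & behead x])).
split=> [|m _|]; first exact: hf [tuple of behead x].
  exact: (hg [tuple of _ :: _ :: _]).
by rewrite /thead (tnth_nth 0) nth0.
Qed.

(** Closure under substitution in any context, the form in which composite
    functions are shown to be computable. *)
Definition computable1 g := forall n A, computable n A -> computable n (fun x => g (A x)).
Definition computable2 g := forall n A B, computable n A -> computable n B -> computable n (fun x => g (A x) (B x)).
Definition computable3 g := forall n A B C, computable n A -> computable n B -> computable n C ->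
  computable n (fun x => g (A x) (B x) (C x)).

Lemma computable1_intro g : computable 1 (fun x => g (nth 0 x 0)) -> computable1 g.
Proof. by move=> hg n A hA; apply: (computable_comp (G := fun _ => A)) hg _. Qed.
Lemma computable2_intro g : computable 2 (fun x => g (nth 0 x 0) (nth 0 x 1)) -> computable2 g.
Proof.
move=> hg n A B hA hB.
by apply: (computable_comp (G := fun i => if i is 0 then A else B)) hg _ => -[|[]].
Qed.

Lemma computable_const n k : computable n (fun=> k).
Proof.
elim: k => [|k IHk]; first by exists (rec_zero n).
by apply: (@computable1_intro succn) IHk; exists rec_succ => x /=; rewrite /thead (tnth_nth 0).
Qed.
Lemma computable1_succ : computable1 succn.
Proof. by apply: computable1_intro; exists rec_succ => x /=; rewrite /thead (tnth_nth 0). Qed.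

Lemma computable2_rec g a b : computable1 a -> computable3 b -> (forall y, g 0 y = a y) ->
  (forall m y, g m.+1 y = b m (g m y) y) -> computable2 g.
Proof.
move=> ha hb g0 gS; apply: computable2_intro.
have hA : computable 1 (fun x => a (nth 0 x 0)) by apply: ha; apply: computable_nth.
have hB : computable 3 (fun x => b (nth 0 x 0) (nth 0 x 1) (nth 0 x 2)) by apply: hb; apply: computable_nth.
apply: computable_ext (computable_prim hA hB) => x _ /=; rewrite -nth0 nth_behead.
by elim: (nth 0 x 0) => [|m IHm] /=; rewrite ?g0 // gS IHm.
Qed.
Lemma computable1_rec g k b : computable2 b -> g 0 = k -> (forall m, g m.+1 = b m (g m)) -> computable1 g.
Proof.
move=> hb g0 gS n A hA.
have hg : computable2 (fun m _ => g m).
  apply: (@computable2_rec _ (fun=> k) (fun m r _ => b m r)) => //.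
    by move=> ? ? _; apply: computable_const.
  by move=> ? ? ? ? h1 h2 _; apply: hb.
exact: (hg n A (fun=> 0) hA (computable_const _ 0)).
Qed.

Lemma computable2_add : computable2 addn.
Proof. by apply: (@computable2_rec _ id (fun _ r _ => r.+1)) => // ? ? ? ? _ h _; apply: computable1_succ. Qed.
Lemma computable2_mul : computable2 muln.
Proof.
apply: (@computable2_rec _ (fun=> 0) (fun _ r y => y + r)) => [? ? _|? ? ? ? _ h h'|//|//].
  exact: computable_const.
exact: computable2_add.
Qed.
Lemma computable2_flip g : computable2 g -> computable2 (fun x y => g y x).
Proof. by move=> hg ? ? ? h h'; apply: hg. Qed.
Lemma computable2_exp : computable2 expn.
Proof.
apply: (@computable2_flip (fun m y => y ^ m)).
apply: (@computable2_rec _ (fun=> 1) (fun _ r y => y * r)) => [? ? _|? ? ? ? _ h h'|//|m y].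
- exact: computable_const.
- exact: computable2_mul.
- exact: expnS.
Qed.
Lemma computable1_pred : computable1 predn.
Proof. by apply: (@computable1_rec _ 0 (fun m _ => m)). Qed.
Lemma computable2_sub : computable2 subn.
Proof.
apply: (@computable2_flip (fun m y => y - m)).
apply: (@computable2_rec _ id (fun _ r _ => r.-1)) => [//|? ? ? ? _ h _|y|m y].
- exact: computable1_pred.
- exact: subn0.
- exact: subnS.
Qed.
Lemma computable2_leq : computable2 (fun m n => (m <= n : nat)).
Proof.
move=> n A B hA hB; apply: (@computable_ext _ (fun x => 1 - (A x - B x))) => [x _|].
  by rewrite -subn_eq0; case: (A x - B x).
by apply: computable2_sub; [apply: computable_const|apply: computable2_sub].
Qed.
Lemma computable2_eq : computable2 (fun m n => (m == n : nat)).
Proof.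
move=> n A B hA hB; apply: (@computable_ext _ (fun x => (A x <= B x) * (B x <= A x))) => [x _|].
  by rewrite eqn_leq mulnb.
by apply: computable2_mul; apply: computable2_leq.
Qed.
(** A bounded sum is a primitive recursion whose step adds one term; the indices
    are shifted to skip the accumulator. *)
Lemma computable_sum n N P : computable n N -> computable n.+1 P -> computable n (fun x => \sum_(i < N x) P ((i : nat) :: x)).
Proof.
move=> hN hP.
have h0 : computable n.+1 (fun x => \sum_(i < head 0 x) P ((i : nat) :: behead x)).
  apply: computable_ext (computable_prim (computable_const n 0) (B := fun z => nth 0 z 1 + P (mkseq (fun i => nth 0 z (bump 1 i)) n.+1)) _).
    case=> [//|k x] /= [sx]; elim: k => [|k IHk] /=; first by rewrite big_ord0.
    rewrite IHk big_ord_recr /=; congr (_ + P (_ :: _)).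
    apply: (@eq_from_nth _ 0); rewrite size_map size_iota // => i i_lt.
    by rewrite (nth_map 0) ?size_iota // nth_iota.
  apply: computable2_add; first exact: computable_nth.
  by apply: (computable_comp (G := fun i z => nth 0 z (bump 1 i))) hP _ => i i_lt; apply: computable_nth; rewrite /bump; case: i i_lt.
apply: computable_ext (computable_comp (G := fun i => if i is j.+1 then (fun x => nth 0 x j) else N) h0 _).
  move=> x sx /=; apply: eq_bigr => i _; congr (P (_ :: _)).
  apply: (@eq_from_nth _ 0); rewrite size_map size_iota // => k k_lt.
  by rewrite (nth_map 0) ?size_iota // nth_iota.
by case=> [|i] i_lt //; apply: computable_nth.
Qed.

(** Quotients, heads and tails of coded sequences are counted by bounded sums of
    decidable tests, hence are computable; the head of a code is its 2-adic
    valuation. *)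
Definition dv n d := \sum_(i < n) (d * i.+1 <= n : nat).
Definition hd n := \sum_(i < n) (dv n (2 ^ i.+1) * 2 ^ i.+1 == n : nat).
Definition tl n := dv (dv n (2 ^ hd n)) 2.

Lemma sum_leq_ord n k : k <= n -> \sum_(i < n) (i < k : nat) = k.
Proof.
move=> kn; rewrite -(big_mkord xpredT (fun i => (i < k : nat))) /=.
rewrite (@big_cat_nat _ _ _ k) //= big_nat (eq_bigr (fun=> 1)) => [|i /andP[_ ->] //].
rewrite -big_nat sum_nat_const_nat subn0 muln1 big_nat big1 ?addn0 // => i /andP[ki _].
by rewrite ltnNge ki.
Qed.
Lemma dvE n d : 0 < d -> dv n d = n %/ d.
Proof.
move=> d_gt0; rewrite -[RHS](@sum_leq_ord n) ?leq_div //.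
by apply: eq_bigr => i _; rewrite leq_divRL // mulnC.
Qed.
Lemma hdE n : hd n = logn 2 n.
Proof.
case: (posnP n) => [->|n_gt0]; first by rewrite /hd big_ord0.
have le : logn 2 n <= n by apply: ltnW; apply: ltn_logl.
rewrite -(sum_leq_ord le); apply: eq_bigr => i _.
by rewrite dvE ?expn_gt0 // -pfactor_dvdn // dvdn_eq.
Qed.

Definition cons_code x s := 2 ^ x * (2 * s).+1.
Lemma code_cons x s : CodeSeq.code (x :: s) = cons_code x (CodeSeq.code s).
Proof. by rewrite /cons_code mul2n. Qed.
Lemma hd_cons x s : hd (cons_code x s) = x.
Proof.
rewrite hdE lognM ?expn_gt0 // pfactorK //.
have -> : logn 2 (2 * s).+1 = 0; last by rewrite addn0.
by apply/eqP; rewrite lognE dvdn2 /= oddM.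
Qed.
Lemma tl_cons x s : tl (cons_code x s) = s.
Proof.
rewrite /tl hd_cons !dvE ?expn_gt0 // mulKn ?expn_gt0 //.
by rewrite -addn1 mulnC divnMDl // addn0.
Qed.
Lemma tl0 : tl 0 = 0. Proof. by rewrite /tl !dvE ?div0n // expn_gt0. Qed.
Lemma hd0 : hd 0 = 0. Proof. by rewrite hdE. Qed.

Lemma computable2_dv : computable2 dv.
Proof.
apply: computable2_intro; apply: (@computable_sum _ (fun x => nth 0 x 0)
  (fun z => (nth 0 z 2 * (nth 0 z 0).+1 <= nth 0 z 1 : nat))); first exact: computable_nth.
apply: computable2_leq; last exact: computable_nth.
by apply: computable2_mul; [apply: computable_nth|apply: computable1_succ; apply: computable_nth].
Qed.
Lemma computable1_hd : computable1 hd.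
Proof.
have pw : computable 2 (fun z => 2 ^ (nth 0 z 0).+1).
  by apply: computable2_exp; [apply: computable_const|apply: computable1_succ; apply: computable_nth].
apply: computable1_intro; apply: (@computable_sum _ (fun x => nth 0 x 0)
  (fun z => (dv (nth 0 z 1) (2 ^ (nth 0 z 0).+1) * 2 ^ (nth 0 z 0).+1 == nth 0 z 1 : nat)));
  first exact: computable_nth.
apply: computable2_eq; last exact: computable_nth.
by apply: computable2_mul => //; apply: computable2_dv => //; apply: computable_nth.
Qed.
Lemma computable1_tl : computable1 tl.
Proof.
move=> n A hA; apply: computable2_dv (computable_const _ 2); apply: computable2_dv => //.
by apply: computable2_exp; [apply: computable_const|apply: computable1_hd].
Qed.
Lemma computable2_cons : computable2 cons_code.
Proof.
move=> n A B hA hB; apply: computable2_mul; first exact: computable2_exp (computable_const _ 2) hA.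
by apply: computable1_succ; apply: computable2_mul (computable_const _ 2) hB.
Qed.

(** A code is not smaller than the length of the sequence, so summing as many
    terms as the code itself reaches all entries; the extra terms are [p 0]. *)
Definition lsum p n := \sum_(i < n) p (hd (iter i tl n)).

Lemma size_code s : size s <= CodeSeq.code s.
Proof.
elim: s => [//|x s IHs]; rewrite code_cons /cons_code /=.
by apply: leq_trans (leq_pmull _ (expn_gt0 2 x)); rewrite ltnS mul2n -addnn; apply: leq_trans IHs (leq_addr _ _).
Qed.
Lemma lsumE p s : p 0 = 0 -> lsum p (CodeSeq.code s) = \sum_(x <- s) p x.
Proof.
move=> p0; have nthE i : hd (iter i tl (CodeSeq.code s)) = nth 0 s i.
  elim: i s => [|i IHi] [|x s]; rewrite ?hd0 //; first by rewrite code_cons hd_cons.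
    by rewrite iterSr -[CodeSeq.code [::]]/0 tl0 -[0]/(CodeSeq.code [::]) IHi !nth_nil.
  by rewrite iterSr code_cons tl_cons IHi.
suff key n : size s <= n -> \sum_(i < n) p (hd (iter i tl (CodeSeq.code s))) = \sum_(x <- s) p x.
  exact: key (size_code s).
move=> sn; transitivity (\sum_(i < n) p (nth 0 s i)); first by apply: eq_bigr => i _; rewrite nthE.
rewrite (big_nth 0) big_mkord (big_ord_widen _ (fun i => p (nth 0 s i)) sn) [RHS]big_mkcond /=.
apply: eq_bigr => i _; case: ltnP => // h.
by rewrite nth_default.
Qed.
Lemma computable1_lsum p : computable1 p -> computable1 (lsum p).
Proof.
move=> hp; apply: computable1_intro; apply: (@computable_sum _ (fun x => nth 0 x 0)
  (fun z => p (hd (iter (nth 0 z 0) tl (nth 0 z 1))))); first exact: computable_nth.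
have hi : computable2 (fun m y => iter m tl y).
  by apply: (@computable2_rec _ id (fun _ r _ => tl r)) => // ? ? ? ? _ h _; apply: computable1_tl.
by apply: hp; apply: computable1_hd; apply: hi; apply: computable_nth.
Qed.

(** * Codes of the input groups and of the output decompositions *)

Definition oddn n := n - dv n 2 * 2.
Lemma oddnE n : oddn n = odd n.
Proof. by rewrite /oddn dvE //; lia. Qed.
Lemma computable1_oddn : computable1 oddn.
Proof. by move=> n A hA; apply: computable2_sub => //; apply: computable2_mul (computable_const _ 2); apply: computable2_dv (computable_const _ 2). Qed.

Lemma sum_gt0 (A : Type) (p : A -> nat) s : (0 < \sum_(x <- s) p x) = has (fun x => 0 < p x) s.
Proof. by elim: s => [|x s IHs]; rewrite ?big_nil // big_cons addn_gt0 IHs. Qed.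
Lemma odd_sum (A : Type) (p : A -> nat) s : odd (\sum_(x <- s) p x) = foldr (fun x b => odd (p x) (+) b) false s.
Proof. by elim: s => [|x s IHs]; rewrite ?big_nil // big_cons oddD IHs. Qed.

Lemma odd_enc_int z : odd (uphalf (enc_int z)) = odd (absz z).
Proof. by case: z => n; rewrite /= ?uphalf_double //= doubleK. Qed.

Lemma enc_famS n (f : 'I_n.+1 -> nat) :
  enc_fam f = cons_code (f ord0) (enc_fam (fun i => f (lift ord0 i))).
Proof. by rewrite /enc_fam /enc_seq enum_ordSl map_cons code_cons -map_comp. Qed.
Lemma enc_fam0 (f : 'I_0 -> nat) : enc_fam f = 0.
Proof.
by rewrite /enc_fam /enc_seq (_ : enum _ = [::]) //; apply: size0nil; rewrite size_enum_ord.
Qed.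

Lemma hd_enc_row n (x : 'rV[int]_n) : hd (hd (enc_mx x)) = enc_int (if insub 0 is Some i then x ord0 i else 0%R).
Proof.
rewrite /enc_mx enc_famS hd_cons; case: n x => [|n] x.
  by rewrite enc_fam0 hd0 insubF.
by rewrite enc_famS hd_cons insubT //=; congr (enc_int (x _ _)); apply: val_inj.
Qed.

(** The counterpart of [reads] on codes; [uphalf] of the code of an integer has
    the parity of this integer. *)
Definition letter_par j A := (hd A == 0) * (hd (tl A) == j) * oddn (dv (hd (hd (hd (tl (tl A))))).+1 2).
Definition word_par j w := oddn (lsum (letter_par j) w).
Definition gens_par g := (0 < lsum (word_par 1) g) * (0 < lsum (word_par 2) g).
Definition read_code d := lsum gens_par (hd (tl (tl (tl (tl d))))).

Lemma letter_par0 j : 0 < j -> letter_par j 0 = 0.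
Proof. by case: j => // j _; rewrite /letter_par tl0 hd0. Qed.
Lemma computable1_letter_par j : computable1 (letter_par j).
Proof.
move=> n A hA; apply: computable2_mul; first apply: computable2_mul.
- by apply: computable2_eq (computable_const _ 0); apply: computable1_hd.
- by apply: computable2_eq (computable_const _ j); apply: computable1_hd; apply: computable1_tl.
apply: computable1_oddn; apply: computable2_dv (computable_const _ 2); apply: computable1_succ; do 3!apply: computable1_hd.
by do 2!apply: computable1_tl.
Qed.
Lemma word_par0 j : word_par j 0 = 0.
Proof. by rewrite /word_par /lsum big_ord0. Qed.
Lemma gens_par0 : gens_par 0 = 0.
Proof. by rewrite /gens_par /lsum !big_ord0. Qed.
Lemma computable1_word_par j : computable1 (word_par j).
Proof. by move=> n A hA; apply: computable1_oddn; apply: computable1_lsum => //; apply: computable1_letter_par. Qed.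
Lemma computable1_gens_par : computable1 gens_par.
Proof.
have pos n A : computable n A -> computable n (fun x => (0 < A x : nat)).
  by move=> hA; apply: computable2_leq => //; apply: computable_const.
by move=> n A hA; apply: computable2_mul; apply: pos; apply: computable1_lsum => //; apply: computable1_word_par.
Qed.
Lemma computable1_read_code : computable1 read_code.
Proof.
move=> n A hA; apply: computable1_lsum; first exact: computable1_gens_par.
by apply: computable1_hd; do 4!apply: computable1_tl.
Qed.

Section ReadCode.
Variables (num : bool -> int) (L : seq rule).
Hypothesis wfL : all wf_rule L.
Local Notation X := (machine_vgbs num wfL).

Lemma letter_parE (j : bool) (l : letter X) : letter_par j.+1 (enc_letter l) = parl j l.
Proof.
case: l => [[v x]|[e b]]; rewrite /letter_par /enc_letter !code_cons !tl_cons !hd_cons //=.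
rewrite hd_enc_row oddnE dvE // divn2 -[_.+1./2]/(uphalf _) odd_enc_int mul1n mulnb.
by rewrite /parl /vfst /=.
Qed.
Lemma word_parE (j : bool) (p : loop X) : word_par j.+1 (enc_loop p) = par j (val p).
Proof.
rewrite /word_par /enc_loop /enc_seq lsumE ?letter_par0 // oddnE big_map odd_sum.
by congr nat_of_bool; rewrite /par; elim: (val p) => [//|l w /= ->]; rewrite letter_parE oddb.
Qed.
Lemma gens_parE (s : seq (loop X)) : (0 < gens_par (enc_seq (@enc_loop X) s)) =
  has (fun p : loop X => @par num L wfL false (val p)) s && has (fun p : loop X => @par num L wfL true (val p)) s.
Proof.
rewrite /gens_par muln_gt0 !lt0b /enc_seq !lsumE ?word_par0 // !sum_gt0 !has_map.
by congr (_ && _); apply: eq_has => p; rewrite /= ?(word_parE false) ?(word_parE true) lt0b.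
Qed.
Lemma read_codeE (D : decomposition X) : (0 < read_code (enc_decomposition D)) = reads D.
Proof.
rewrite /read_code /enc_decomposition !code_cons !tl_cons hd_cons /enc_fam.
rewrite [X in lsum _ X]/enc_seq lsumE ?gens_par0 // sum_gt0 has_map.
apply/hasP/existsP => [[i _ hi]|[i hi]]; exists i; rewrite ?mem_enum //.
  by rewrite -gens_parE.
by rewrite /= gens_parE.
Qed.
End ReadCode.

(** The integer attached to b_0 is the starting number and the one attached to
    b_1 the halting number. *)
Definition nums (halt start : nat) (b : bool) : int := Posz (if b then halt else start).

(** All the data of the group except its starting number, with the modulus [S]
    in front. *)
Definition parts (L : seq rule) (halt S : nat) : seq nat :=
  [:: S; (size L).+2; enc_fam (fun e : 'I_(size L).+2 => 0);
      enc_fam (fun e : 'I_(size L).+2 => eterX e : nat);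
      enc_fam (fun v : 'I_3 => vrk v); enc_fam (fun e : 'I_(size L).+2 => erk e);
      enc_fam (fun e : 'I_(size L).+1 => enc_mx (iorg (nums halt 0) L (lift ord0 e)));
      enc_fam (fun e : 'I_(size L).+2 => enc_mx (iter_ L e))].

(** From the code [m] of [parts], the code of the group whose starting number is
    [S * 3 ^ m]: self-reference is possible since the starting number occurs in
    one entry only. *)
Definition group_code m :=
  let p i := hd (iter i tl m) in
  cons_code 2 (cons_code (p 1) (cons_code (p 2) (cons_code (p 3) (cons_code (p 4) (cons_code (p 5)
  (cons_code (cons_code (cons_code (cons_code (2 * (p 0 * 3 ^ m)) (cons_code 2 0)) 0) (p 6))
  (cons_code (p 7) 0))))))).

Lemma computable1_group_code : computable1 group_code.
Proof.
move=> n A hA; rewrite /group_code.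
have hp i : computable n (fun x => hd (iter i tl (A x))).
  by apply: computable1_hd; elim: i => [//|i IHi]; apply: (computable1_tl IHi).
do !(apply: computable2_cons; rewrite //; try exact: computable_const; try exact: hp).
by apply: computable2_mul (computable_const _ 2) _; apply: computable2_mul (hp 0) _; apply: computable2_exp (computable_const _ 3) hA.
Qed.

Lemma group_codeE L halt S (wfL : all wf_rule L) : let m := CodeSeq.code (parts L halt S) in
  group_code m = enc_vgbs (machine_vgbs (nums halt (S * 3 ^ m)) wfL).
Proof.
move=> m; rewrite /group_code.
have p i : hd (iter i tl m) = nth 0 (parts L halt S) i.
  rewrite /m; elim: i (parts L halt S) => [|i IHi] [|x s]; rewrite ?hd0 //; first by rewrite code_cons hd_cons.
    by rewrite iterSr -[CodeSeq.code [::]]/0 tl0 -[0]/(CodeSeq.code [::]) IHi !nth_nil.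
  by rewrite iterSr code_cons tl_cons IHi.
rewrite !p /enc_vgbs !code_cons; do 6!congr cons_code.
rewrite [enc_fam (fun e => enc_mx (inc_org e))]enc_famS.
congr (cons_code (cons_code _ _) _).
  by rewrite /enc_mx !enc_famS !enc_fam0 /= !mxE /= -muln2 mulnC.
Qed.

(** * Counter programs for recursive functions *)

Definition regs := nat -> nat.
Definition upd (s : regs) r v : regs := fun i => if i == r then v else s i.

Inductive cmd := Skip | Inc of nat | Seq of cmd & cmd | Loop of nat & cmd.

Inductive run : cmd -> regs -> regs -> Prop :=
| run_skip s : run Skip s s
| run_inc r s : run (Inc r) s (upd s r (s r).+1)
| run_seq c d s t u : run c s t -> run d t u -> run (Seq c d) s u
| run_loop0 r c s : s r = 0 -> run (Loop r c) s s
| run_loopS r c s t u n : s r = n.+1 -> run c (upd s r n) t -> run (Loop r c) t u ->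
    run (Loop r c) s u.

Lemma run_eq c s t u : run c s t -> t = u -> run c s u. Proof. by move=> h <-. Qed.

Ltac upd_cases := repeat match goal with
  | |- context [?a == ?b] => case: (@eqP _ a b) => ?
  end.
Ltac upd_ext := apply: funext => ?; rewrite /upd; upd_cases; subst; try lia.

Definition clr r := Loop r Skip.
Lemma run_clr r s : run (clr r) s (upd s r 0).
Proof.
move E: (s r) => n; elim: n s E => [|n IHn] s E.
  by apply: run_eq (run_loop0 _ E) _; upd_ext.
apply: run_loopS E (run_skip _) _; apply: run_eq (IHn _ _) _; last by upd_ext.
by rewrite /upd eqxx.
Qed.

Definition move r o := Loop r (Inc o).
Lemma run_move r o s : r <> o -> run (move r o) s (upd (upd s o (s o + s r)) r 0).
Proof.
move=> ro; move E: (s r) => n; elim: n s E => [|n IHn] s E.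
  by apply: run_eq (run_loop0 _ E) _; upd_ext.
apply: run_loopS E (run_inc _ _) _; apply: run_eq (IHn _ _) _.
  by rewrite /upd; upd_cases; lia.
by upd_ext.
Qed.

Definition copy r o t := Seq (Loop r (Seq (Inc t) (Inc o))) (move t r).
Lemma run_copy r o t s : r <> o -> r <> t -> o <> t -> s t = 0 ->
  run (copy r o t) s (upd s o (s o + s r)).
Proof.
move=> ro rt ot st.
have key n s' : s' r = n -> run (Loop r (Seq (Inc t) (Inc o))) s'
    (upd (upd (upd s' o (s' o + n)) t (s' t + n)) r 0).
  elim: n s' => [|n IHn] s' E.
    by apply: run_eq (run_loop0 _ E) _; upd_ext.
  apply: run_loopS E (run_seq (run_inc _ _) (run_inc _ _)) _.
  apply: run_eq (IHn _ _) _; first by rewrite /upd; upd_cases; lia.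
  by upd_ext.
apply: run_seq (key _ _ erefl) _; apply: run_eq (run_move _ _) _; first lia.
by upd_ext.
Qed.

Definition block (cs : seq cmd) := foldr Seq Skip cs.
Lemma run_block n (F : 'I_n -> cmd) (st : nat -> regs) :
  (forall i : 'I_n, run (F i) (st i) (st i.+1)) ->
  run (block [seq F i | i <- enum 'I_n]) (st 0) (st n).
Proof.
elim: n F st => [|n IHn] F st h.
  by rewrite (_ : enum _ = [::]); [apply: run_skip|apply: size0nil; rewrite size_enum_ord].
rewrite enum_ordSl map_cons -map_comp; apply: run_seq (h ord0) _.
by apply: (IHn _ (fun i => st i.+1)) => i; apply: h.
Qed.

(** Registers from [k] on are free: they contain 0 before and after. The
    arguments are in the registers [xs] and the result is left in [o]. *)
Fixpoint compile n (f : rec_fun n) (xs : seq nat) (o k : nat) : cmd :=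
  match f with
  | rec_zero _ => Skip
  | rec_succ => Seq (copy (nth 0 xs 0) o k) (Inc o)
  | rec_proj _ i => copy (nth 0 xs i) o k
  | rec_comp l _ f g =>
      Seq (block [seq compile (g i) xs (k + i) (k + l) | i <- enum 'I_l])
     (Seq (compile f (iota k l) o (k + l))
          (block [seq clr (k + (i : 'I_l)) | i <- enum 'I_l]))
  | rec_prim _ f g =>
      Seq (compile f (behead xs) k.+2 k.+4)
     (Seq (copy (nth 0 xs 0) k k.+4)
     (Seq (Loop k (Seq (compile g [:: k.+1, k.+2 & behead xs] k.+3 k.+4)
                  (Seq (clr k.+2) (Seq (move k.+3 k.+2) (Inc k.+1)))))
     (Seq (move k.+2 o) (clr k.+1))))
  | rec_min _ f =>
      Seq (compile f (k :: xs) k.+1 k.+2)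
     (Seq (Loop k.+1 (Seq (clr k.+1) (Seq (Inc k) (compile f (k :: xs) k.+1 k.+2))))
          (move k o))
  end.

Lemma map_upd s r v xs : r \notin xs -> map (upd s r v) xs = map s xs.
Proof.
move=> nr; apply/eq_in_map => i i_in; rewrite /upd; case: eqP => // e.
by rewrite -e i_in in nr.
Qed.
Lemma notin_ge k r xs : all (fun i => i < k) xs -> k <= r -> r \notin xs.
Proof. by move=> /allP h kr; apply/negP => /h; lia. Qed.
Lemma all_ltW k l xs : all (fun i => i < k) xs -> k <= l -> all (fun i => i < l) xs.
Proof. by move=> h kl; apply: sub_all h => i /=; lia. Qed.

Lemma compileP n (f : rec_fun n) : forall (x : n.-tuple nat) y, rec_eval f x y ->
  forall s xs o k, map s xs = x -> all (fun i => i < k) xs -> o < k -> o \notin xs ->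
  s o = 0 -> (forall r, k <= r -> s r = 0) -> run (compile f xs o k) s (upd s o y).
Proof.
elim: f => {n}.
- move=> n x y /= -> s xs o k _ _ _ _ so _.
  by apply: run_eq (run_skip _) _; upd_ext.
- move=> x y /= -> s xs o k sx xk ok oxs so free.
  case: xs sx xk oxs => [|r xs] /= sx xk oxs; first by have := congr1 size sx; rewrite size_tuple.
  have hr : thead x = s r by rewrite /thead (tnth_nth 0) -sx.
  rewrite in_cons negb_or in oxs.
  apply: run_seq (run_copy _ _ _ (free _ _)) _; try lia.
  apply: run_eq (run_inc _ _) _; rewrite hr; by upd_ext.
- move=> n i x y /= -> s xs o k sx xk ok oxs so free.
  have sz : size xs = n by have := congr1 size sx; rewrite size_map size_tuple.
  have ixs : nth 0 xs i \in xs by rewrite mem_nth ?sz.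
  have hi : tnth x i = s (nth 0 xs i) by rewrite (tnth_nth 0) -sx (nth_map 0) ?sz.
  have ik := allP xk _ ixs.
  have oi : nth 0 xs i <> o by move=> e; rewrite -e ixs in oxs.
  apply: run_eq (run_copy _ _ _ (free _ _)) _; try lia.
  by rewrite hi so.
- move=> l n f IHf g IHg x y /= [z [gz fz]] s xs o k sx xk ok oxs so free.
  pose st j : regs := fun r => if (k <= r) && (r < k + j) then nth 0 z (r - k) else s r.
  have s0 : st 0 = s by apply: funext => r; rewrite /st; case: ifP => //; lia.
  have sz : size z = l by rewrite size_tuple.
  apply: (run_seq (t := st l)).
    rewrite -{1}s0; apply: run_block => i; have il := ltn_ord i.
    apply: run_eq (IHg i x _ (gz i) (st i) _ _ _ _ _ _ _ _ _) _.
    + rewrite -sx; apply/eq_in_map => r /(allP xk); rewrite /st; case: ifP => //; lia.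
    + by apply: all_ltW xk _; lia.
    + lia.
    + by apply: notin_ge xk _; lia.
    + by rewrite /st; case: ifP => [|_]; [lia|apply: free; lia].
    + by move=> r hr; rewrite /st; case: ifP => [|_]; [lia|apply: free; lia].
    apply: funext => r; rewrite /upd /st (tnth_nth 0).
    by case: eqP => [->|h]; case: ifP => h1; try case: ifP => h2; rewrite ?addKn //; lia.
  apply: run_seq (IHf z y fz (st l) (iota k l) o (k + l) _ _ _ _ _ _) _.
  + apply: (@eq_from_nth _ 0); rewrite size_map size_iota ?sz // => i il.
    by rewrite (nth_map 0) ?size_iota // nth_iota // /st leq_addr ltn_add2l il addKn.
  + by apply/allP => r; rewrite mem_iota; lia.
  + lia.
  + by rewrite mem_iota; lia.
  + by rewrite /st; case: ifP => [|_ //]; lia.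
  + by move=> r hr; rewrite /st; case: ifP => [|_]; [lia|apply: free; lia].
  pose ts j : regs := fun r => if (k + j <= r) && (r < k + l) then nth 0 z (r - k) else upd s o y r.
  have -> : upd (st l) o y = ts 0.
    apply: funext => r; rewrite /upd /ts /st addn0 /upd; upd_cases; case: ifP => //; lia.
  have -> : upd s o y = ts l.
    by apply: funext => r; rewrite /ts; case: ifP => //; lia.
  apply: run_block => i; have il := ltn_ord i; apply: run_eq (run_clr _ _) _.
  apply: funext => r; rewrite /ts /upd; case: eqP => [->|h].
    case: ifP => [|_]; first lia.
    by case: eqP => [|_]; [lia|rewrite free //; lia].
  by do ?[case: ifP => ?] => //; lia.
- move=> n f IHf g IHg x y /= [v [fv gv ->]] s xs o k sx xk ok oxs so free.
  case: xs sx xk oxs => [|r xs] /= sx xk oxs; first by have := congr1 size sx; rewrite size_tuple.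
  have [rk xk'] := andP xk; rewrite in_cons negb_or in oxs; have [ro oxs'] := andP oxs.
  have hr : thead x = s r by rewrite /thead (tnth_nth 0) -sx.
  have bx : behead x = map s xs :> seq nat by rewrite -sx.
  pose st c m a : regs := upd (upd (upd s k c) k.+1 m) k.+2 a.
  apply: (run_seq (t := st 0 0 (v 0))).
    apply: run_eq (IHf _ _ fv s xs k.+2 k.+4 _ _ _ _ _ _) _.
    + by rewrite -bx.
    + by apply: all_ltW xk' _; lia.
    + lia.
    + by apply: notin_ge xk' _; lia.
    + by apply: free; lia.
    + by move=> i hi; apply: free; lia.
    by rewrite /st; upd_ext; rewrite free //; lia.
  apply: (run_seq (t := st (thead x) 0 (v 0))).
    apply: run_eq (run_copy _ _ _ _) _; try lia.
      by rewrite /st /upd; upd_cases; rewrite ?free //; lia.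
    by rewrite /st hr; upd_ext.
  apply: (run_seq (t := st 0 (thead x) (v (thead x)))).
    (* After m rounds: the counter c, the index m and the intermediate value v m. *)
    suff key c m : c + m = thead x -> run (Loop k (Seq (compile g [:: k.+1, k.+2 & xs] k.+3 k.+4)
        (Seq (clr k.+2) (Seq (move k.+3 k.+2) (Inc k.+1))))) (st c m (v m)) (st 0 (thead x) (v (thead x))).
      by apply: key; rewrite addn0.
    elim: c m => [|c IHc] m cm.
      by rewrite -cm; apply: run_loop0; rewrite /st /upd; upd_cases; lia.
    apply: (run_loopS (n := c) (t := st c m.+1 (v m.+1))); last by apply: IHc; lia.
      by rewrite /st /upd; upd_cases; lia.
    have -> : upd (st c.+1 m (v m)) k c = st c m (v m) by rewrite /st; upd_ext.
    apply: run_seq (IHg _ _ (gv m _) _ _ _ _ _ _ _ _ _ _) _.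
    + lia.
    + rewrite /= bx; congr [:: _, _ & _]; try by rewrite /st /upd; upd_cases; lia.
      by rewrite /st !map_upd //; apply: notin_ge xk' _; lia.
    + by rewrite /= (all_ltW xk'); lia.
    + lia.
    + rewrite !in_cons !negb_or (notin_ge xk') ?andbT; lia.
    + by rewrite /st /upd; upd_cases; try lia; apply: free; lia.
    + by move=> i hi; rewrite /st /upd; upd_cases; try lia; apply: free; lia.
    apply: run_seq (run_clr _ _) _; apply: run_seq (run_move _ _) _; first lia.
    apply: run_eq (run_inc _ _) _; rewrite /st; upd_ext; rewrite free //; lia.
  apply: run_seq (run_move _ _) _; first lia.
  apply: run_eq (run_clr _ _) _; rewrite /st; upd_ext; rewrite ?free //; lia.
- move=> n f IHf x y /= [fy fm] s xs o k sx xk ok oxs so free.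
  pose st i v : regs := upd (upd s k i) k.+1 v.
  have frun i v (xt : n.+1.-tuple nat) : rec_eval f xt v -> xt = i :: x :> seq nat ->
      run (compile f (k :: xs) k.+1 k.+2) (st i 0) (st i v).
    move=> fv xtE; apply: run_eq (IHf _ _ fv _ _ _ _ _ _ _ _ _ _) _.
    + rewrite /= xtE; congr (_ :: _); first by rewrite /st /upd; upd_cases; lia.
      by rewrite /st !map_upd //; apply: notin_ge xk _; lia.
    + by rewrite /= (all_ltW xk); lia.
    + lia.
    + rewrite !in_cons !negb_or (notin_ge xk) ?andbT; lia.
    + by rewrite /st /upd; upd_cases; lia.
    + by move=> j hj; rewrite /st /upd; upd_cases; try lia; apply: free; lia.
    by rewrite /st; upd_ext.
  set lp := Loop _ _.
  have key d i : d + i = y -> exists2 v, run (compile f (k :: xs) k.+1 k.+2) (st i 0) (st i v) &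
      run lp (st i v) (st y 0).
    elim: d i => [|d IHd] i di.
      exists 0; first by apply: (frun _ _ _ fy); rewrite -di.
      by rewrite -di; apply: run_loop0; rewrite /st /upd; upd_cases; lia.
    have [w h1 h2] := IHd i.+1 ltac:(lia).
    have [v fv] := fm i ltac:(lia); exists v.+1; first exact: frun fv _.
    apply: (run_loopS (n := v) (t := st i.+1 w)) => //; first by rewrite /st /upd; upd_cases; lia.
    apply: run_seq (run_clr _ _) _; apply: run_seq (run_inc _ _) _.
    by rewrite [X in run _ X _](_ : _ = st i.+1 0) //; rewrite /st; upd_ext.
  have [v h1 h2] := key y 0 (addn0 y).
  have s0 : st 0 0 = s by rewrite /st; upd_ext; rewrite free //; lia.
  rewrite -[X in run _ X _]s0; clear s0; apply: run_seq h1 _; apply: run_seq h2 _.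
  apply: run_eq (run_move _ _) _; first lia.
  by rewrite /st; upd_ext; rewrite ?free //; lia.
Qed.

(** * From counter programs to affine rules *)

Inductive instr := IInc of nat & nat | IJmp of nat | IDec of nat & nat & nat.

Fixpoint csize c := match c with
  | Skip => 0 | Inc _ => 1 | Seq c d => csize c + csize d | Loop _ c => (csize c).+2 end.
(** The code of a command placed at the address [a]; it is left at the address
    [a + csize c]. *)
Fixpoint flat c a : seq instr := match c with
  | Skip => [::]
  | Inc r => [:: IInc r a.+1]
  | Seq c d => flat c a ++ flat d (a + csize c)
  | Loop r c => IDec r a.+1 (a + (csize c).+2) :: flat c a.+1 ++ [:: IJmp a]
  end.
Fixpoint maxr c := match c with
  | Skip => 0 | Inc r => r.+1 | Seq c d => maxn (maxr c) (maxr d) | Loop r c => maxn r.+1 (maxr c) end.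
Lemma size_flat c a : size (flat c a) = csize c.
Proof.
by elim: c a => //= [c IHc d IHd|r c IHc] a; rewrite size_cat ?IHc ?IHd //= addn1.
Qed.

(** Distinct odd primes; the register [r] is the exponent of [pr r]. *)
Fixpoint pr (r : nat) : nat := if r is r'.+1 then s2val (prime_above (pr r')) else 3.
Lemma prS r : pr r < pr r.+1. Proof. by rewrite /=; case: prime_above. Qed.
Lemma pr_prime r : prime (pr r). Proof. by case: r => //= r; case: prime_above. Qed.
Lemma pr_lt r r' : r < r' -> pr r < pr r'.
Proof.
elim: r' => // r' IHr; rewrite ltnS leq_eqVlt => /orP[/eqP->|/IHr h]; first exact: prS.
exact: ltn_trans h (prS r').
Qed.
Lemma pr_inj : injective pr.
Proof. by move=> r r' e; case: (ltngtP r r') => // /pr_lt; rewrite e ltnn. Qed.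
Lemma pr_gt2 r : 2 < pr r.
Proof. by elim: r => // r IHr; apply: ltn_trans IHr (prS r). Qed.
Lemma pr_odd r : odd (pr r).
Proof. by have [e|//] := even_prime (pr_prime r); have := pr_gt2 r; rewrite e. Qed.
Lemma pr_gt1 r : 1 < pr r. Proof. exact: prime_gt1 (pr_prime r). Qed.

Definition enc_regs K (s : regs) := \prod_(r < K) pr r ^ s r.
Lemma enc_regs_inc K s r : r < K -> enc_regs K (upd s r (s r).+1) = pr r * enc_regs K s.
Proof.
move=> rK; rewrite /enc_regs (bigD1 (Ordinal rK)) //= [in RHS](bigD1 (Ordinal rK)) //=.
rewrite /upd eqxx expnS -mulnA; congr (_ * (_ * _)); apply: eq_bigr => i ir.
by rewrite -val_eqE /= in ir; rewrite (negbTE ir).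
Qed.
Lemma enc_regs_dvd K s r : r < K -> (pr r %| enc_regs K s) = (0 < s r).
Proof.
move=> rK; rewrite /enc_regs (bigD1 (Ordinal rK)) //= Euclid_dvdM ?pr_prime //.
rewrite Euclid_dvdX ?pr_prime // dvdnn /=; case: posnP => //= _.
elim/big_rec: _ => [|i x ir IHx]; first by rewrite Euclid_dvd1 // pr_prime.
rewrite Euclid_dvdM ?pr_prime // IHx orbF Euclid_dvdX ?pr_prime // dvdn_prime2 ?pr_prime //.
apply/negP => /andP[/eqP/pr_inj e _].
by move: ir; rewrite -val_eqE /= e eqxx.
Qed.

Definition ieff (I : instr) (w : int) : nat * int := match I with
  | IInc r s' => (s', (pr r)%:Z * w)%R
  | IJmp s' => (s', w)
  | IDec r s' s'' => if ((pr r)%:Z %| w)%Z then (s', (w %/ (pr r)%:Z)%Z) else (s'', w)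
  end.

Section Machine.
Variables (prog : seq instr) (S : nat).
Hypothesis S_gt : size prog < S.
Hypothesis S_odd : odd S.
Hypothesis S_gt1 : 1 < S.
Local Notation ith := (nth (IJmp 0) prog).

(** The instruction pointer is the residue modulo [S], and the quotient contains
    the registers. *)
Definition num_of (s : nat) (w : int) : int := (S%:Z * w + s%:Z)%R.
Definition nstep (x y : int) := exists s w, [/\ s < size prog, x = num_of s w &
  y = num_of (ieff (ith s) w).1 (ieff (ith s) w).2].

Lemma num_of_inj s w s' w' : s < S -> s' < S -> num_of s w = num_of s' w' -> s = s' /\ w = w'.
Proof. clear S_gt S_odd S_gt1; rewrite /num_of => h h' e; suff: w = w' by split => //; lia. nia. Qed.

Lemma nstep_det x y z : nstep x y -> nstep x z -> y = z.
Proof.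
move=> [s [w [hs -> ->]]] [s' [w' [hs' e ->]]].
by have [<- <-] := num_of_inj (ltn_trans hs S_gt) (ltn_trans hs' S_gt) e.
Qed.

(** A test of divisibility by [pr r] takes one rule for the multiples and one
    for each other residue class. *)
Definition irules (s : nat) (I : instr) : seq rule := match I with
  | IInc r s' => [:: ((S, s, 1), (S * pr r, s', 1))]
  | IJmp s' => [:: ((S, s, 1), (S, s', 1))]
  | IDec r s' s'' => ((S * pr r, s, 1), (S, s', 1)) ::
      [seq ((S * pr r, S * c + s, 1), (S * pr r, S * c + s'', 1)) | c <- iota 1 (pr r).-1]
  end.
Definition rules := scale_rule :: flatten [seq irules s (ith s) | s <- iota 0 (size prog)].

Lemma irules_wf s I R : R \in irules s I -> wf_rule R /\ R.1.2 = 1.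
Proof.
have oS r : odd (S * pr r) by rewrite oddM S_odd pr_odd.
have S1 r : 1 < S * pr r by apply: leq_trans (leq_pmulr _ _) => //; apply: ltnW (pr_gt1 r).
case: I => [r s'|s'|r s' s''] /=.
- by rewrite inE => /eqP->; rewrite /wf_rule /wf_tri /= S_odd S_gt1 oS S1.
- by rewrite inE => /eqP->; rewrite /wf_rule /wf_tri /= S_odd S_gt1.
rewrite inE => /orP[/eqP->|/mapP[c _ ->]]; rewrite /wf_rule /wf_tri /=.
  by rewrite S_odd S_gt1 oS S1.
by rewrite oS S1.
Qed.
Lemma rules_wf : all wf_rule rules.
Proof.
apply/allP => R; rewrite inE => /orP[/eqP-> //|/flattenP[l /mapP[s _ ->]]].
by move=> /irules_wf[].
Qed.

(** The numbers on the two sides of an instance of [R]. *)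
Definition rstep (R : rule) (x y : int) := exists k : int,
  x = (k * R.1.1.1%:Z + R.1.1.2%:Z)%R /\ y = (k * R.2.1.1%:Z + R.2.1.2%:Z)%R.

Lemma rstep_tri R x v c : R.1.2 = 1 -> R.2.2 = 1 -> cfg x = (c *m tri R.1)%R ->
  v = (c *m tri R.2)%R -> exists2 y, v = cfg y & rstep R x y.
Proof.
move=> R1 R2 cx ->; have [x0 x1] := cfgE x.
have c1 : c ord0 (lift ord0 ord0) = 1%R by rewrite cx mul_tri1 R1 mulr1 in x1.
exists (c ord0 ord0 * R.2.1.1%:Z + R.2.1.2%:Z)%R.
  apply: row2P; rewrite ?mul_tri0 ?mul_tri1 c1 ?R2 !(proj1 (cfgE _), proj2 (cfgE _)) ?mul1r //.
exists (c ord0 ord0); split=> //.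
by rewrite -x0 cx mul_tri0 c1 mul1r.
Qed.
Lemma tri_rstep R x y : R.1.2 = 1 -> R.2.2 = 1 -> rstep R x y ->
  exists c, (cfg x = c *m tri R.1 /\ cfg y = c *m tri R.2)%R.
Proof.
move=> R1 R2 [k [-> ->]]; exists (cfg k).
by split; apply: row2P; rewrite ?mul_tri0 ?mul_tri1 !(proj1 (cfgE _), proj2 (cfgE _)) ?R1 ?R2 mul1r.
Qed.

(** Writing the quotient as k p + c with c < p identifies the rule that applies.
    *)
Lemma irules_step s I x y : (exists2 R, R \in irules s I & rstep R x y) <->
  exists w, x = num_of s w /\ y = num_of (ieff I w).1 (ieff I w).2.
Proof.
have p0 r : ((pr r)%:Z != 0)%R by apply: posz_neq0; apply: prime_gt0 (pr_prime r).
rewrite /num_of; case: I => [r s'|s'|r s' s''] /=.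
- split=> [[R]|[w [-> ->]]].
    rewrite inE => /eqP-> [k /= [-> ->]]; exists k; rewrite PoszM; split; ring.
  eexists; first exact: mem_head.
  exists w => /=; rewrite PoszM; split; ring.
- split=> [[R]|[w [-> ->]]].
    rewrite inE => /eqP-> [k /= [-> ->]]; exists k; split; ring.
  eexists; first exact: mem_head.
  exists w => /=; split; ring.
split=> [[R]|[w [-> ->]]].
  rewrite inE => /orP[/eqP->|/mapP[c ci ->]] [k /= [-> ->]].
    exists (k * (pr r)%:Z)%R; rewrite dvdz_mull ?dvdzz // mulzK ?p0 // PoszM; split; ring.
  exists (k * (pr r)%:Z + c%:Z)%R; rewrite mem_iota in ci.
  have -> : ((pr r)%:Z %| (k * (pr r)%:Z + c%:Z)%R)%Z = false.
    by apply/negbTE/negP => /dvdz_mod0P; rewrite modzMDl modz_small; lia.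
  rewrite /= !PoszD !PoszM; split; ring.
case: ifP => h /=.
  eexists; first exact: mem_head.
  exists (w %/ (pr r)%:Z)%Z => /=; split; last by ring.
  by rewrite -[in LHS](divzK h) PoszM; ring.
pose c := absz (w %% (pr r)%:Z)%Z.
have cE : (c%:Z = w %% (pr r)%:Z)%Z by rewrite gez0_abs // modz_ge0.
have c_lt : c < pr r by have := ltz_mod w (p0 r); rewrite -cE; lia.
have c_gt : 0 < c.
  rewrite lt0n; apply/eqP => c0; move: h; rewrite dvdz_eq.
  by have := divz_eq w (pr r)%:Z; rewrite -cE c0 addr0 => <-; rewrite eqxx.
exists ((S * pr r, S * c + s, 1), (S * pr r, S * c + s'', 1)).
  rewrite inE; apply/orP; right; apply/mapP; exists c => //; rewrite mem_iota; lia.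
exists (w %/ (pr r)%:Z)%Z => /=; rewrite !PoszD !PoszM cE.
by split; rewrite {1}(divz_eq w (pr r)%:Z); ring.
Qed.

Lemma irules2 s I R : R \in irules s I -> R.1.2 = 1 /\ R.2.2 = 1.
Proof.
by move=> /irules_wf[/and3P[_ _ h] h1]; split=> //; apply/eqP; rewrite -(eqP h) h1.
Qed.

(** The scaling rule does not apply, because the last coordinate is 1. *)
Lemma vstep_cfg x v : vstep rules (cfg x) v -> exists2 y, v = cfg y & nstep x y.
Proof.
move=> [i [c [lt [cx vE]]]]; have := mem_nth scale_rule lt.
move: (nth _ _ _) cx vE => R cx vE; rewrite inE => /orP[/eqP RE|].
  move: cx => /(congr1 (fun m : 'rV_2 => m ord0 (lift ord0 ord0))).
  rewrite RE mul_tri1 (proj2 (cfgE _)) /= => h.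
  by have := congr1 absz h; rewrite abszM /=; lia.
move=> /flattenP[l /mapP[s]]; rewrite mem_iota => hs -> Rin.
have [R1 R2] := irules2 Rin; have [y vy st] := rstep_tri R1 R2 cx vE.
exists y => //; have [|w [-> ->]] := proj1 (irules_step s (ith s) x y); first by exists R.
by exists s, w.
Qed.
Lemma nstep_vstep x y : nstep x y -> vstep rules (cfg x) (cfg y).
Proof.
move=> [s [w [hs xE yE]]].
have [|R Rin st] := proj2 (irules_step s (ith s) x y); first by exists w.
have [R1 R2] := irules2 Rin; have [c [h1 h2]] := tri_rstep R1 R2 st.
have RL : R \in rules.
  rewrite inE; apply/orP; right; apply/flattenP; exists (irules s (ith s)) => //.
  by apply: map_f; rewrite mem_iota.
by exists (index R rules), c; rewrite index_mem nth_index.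
Qed.

Inductive nstar x : int -> Prop :=
| nstar0 : nstar x x
| nstarS y z : nstar x y -> nstep y z -> nstar x z.
Lemma nstar_trans x y z : nstar x y -> nstar y z -> nstar x z.
Proof. by move=> xy; elim=> [//|u v _ h uv]; apply: nstarS h uv. Qed.
Lemma nstar_cons x y z : nstep x y -> nstar y z -> nstar x z.
Proof. by move=> xy; apply: nstar_trans; apply: nstarS xy; apply: nstar0. Qed.
Lemma nstar_inv x z : nstar x z -> x = z \/ exists2 y, nstep x y & nstar y z.
Proof.
elim=> [|y' z' _ [<-|[y xy yz]] yz']; first by left.
  by right; exists z' => //; apply: nstar0.
by right; exists y => //; apply: nstarS yz yz'.
Qed.
Lemma nstar_vconn x y : nstar x y -> vconn rules (cfg x) (cfg y).
Proof.
elim=> [|u v _ h uv]; first exact: vconn_refl.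
exact: vconn_fwd h (nstep_vstep uv).
Qed.

(** The numbers from which the run reaches the cycle of [A] are closed under
    moves in both directions: forwards because moves are deterministic,
    backwards by definition. *)
Lemma vconn_cycle A B x y : nstep A B -> nstar B A -> nstar x A ->
  vconn rules (cfg x) y -> exists2 z, y = cfg z & nstar z A.
Proof.
move=> AB BA xA; elim=> [|u v _ [z -> zA] uv|u v _ [z -> zA] vu].
- by exists x.
- have [w -> zw] := vstep_cfg uv; exists w => //.
  have [zE|[w' zw' w'A]] := nstar_inv zA.
    by subst z; rewrite (nstep_det zw AB).
  by rewrite (nstep_det zw zw').
- have [m vE] : exists m, v = cfg m.
    by apply: (vconn_cfg (x := z) rules_wf); apply: vconn_bwd vu; apply: vconn_refl.
  subst v; have [w /esym wz mw] := vstep_cfg vu; exists m => //.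
  apply: nstar_cons mw _; suff -> : w = z by [].
  by have := congr1 (fun r : 'rV_2 => r ord0 ord0) wz; rewrite !(proj1 (cfgE _)).
Qed.

Definition code_at a (l : seq instr) :=
  forall i, i < size l -> a + i < size prog /\ ith (a + i) = nth (IJmp 0) l i.
Lemma code_at_cat a l1 l2 : code_at a (l1 ++ l2) -> code_at a l1 /\ code_at (a + size l1) l2.
Proof.
clear S_gt S_odd S_gt1; move=> h; split=> i il.
  by have := h i; rewrite size_cat nth_cat il; apply; lia.
have := h (size l1 + i); rewrite size_cat nth_cat addnA ltn_add2l.
have -> : (size l1 + i < size l1) = false by lia.
by rewrite addKn; apply.
Qed.

Variable K : nat.
Definition config a (s : regs) : int := num_of a (Posz (enc_regs K s)).

Lemma step_inc a r s' s : r < K -> code_at a [:: IInc r s'] ->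
  nstep (config a s) (config s' (upd s r (s r).+1)).
Proof.
move=> rK /(_ 0 isT)[]; rewrite addn0 => alt aE; exists a, (Posz (enc_regs K s)).
by split=> //; rewrite aE /= /config enc_regs_inc // PoszM.
Qed.
Lemma step_jmp a s' s : code_at a [:: IJmp s'] -> nstep (config a s) (config s' s).
Proof.
move=> /(_ 0 isT)[]; rewrite addn0 => alt aE; exists a, (Posz (enc_regs K s)).
by split=> //; rewrite aE.
Qed.
Lemma step_dec0 a r s' s'' s : r < K -> code_at a [:: IDec r s' s''] -> s r = 0 ->
  nstep (config a s) (config s'' s).
Proof.
move=> rK /(_ 0 isT)[]; rewrite addn0 => alt aE sr; exists a, (Posz (enc_regs K s)).
split=> //; rewrite aE /= (_ : (_ %| _)%Z = false) //.
by rewrite -[LHS]/(pr r %| enc_regs K s) enc_regs_dvd // sr.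
Qed.
Lemma step_decS a r s' s'' s n : r < K -> code_at a [:: IDec r s' s''] -> s r = n.+1 ->
  nstep (config a s) (config s' (upd s r n)).
Proof.
move=> rK /(_ 0 isT)[]; rewrite addn0 => alt aE sr; exists a, (Posz (enc_regs K s)).
split=> //; rewrite aE /= (_ : (_ %| _)%Z = true); last first.
  by rewrite -[LHS]/(pr r %| enc_regs K s) enc_regs_dvd // sr.
congr num_of; have := enc_regs_inc (upd s r n) rK.
have -> : upd (upd s r n) r (upd s r n r).+1 = s by clear - sr; upd_ext.
move=> /= ->; rewrite mulnC PoszM mulzK //.
by apply: posz_neq0; apply: prime_gt0 (pr_prime r).
Qed.

Lemma simulate c s t : run c s t -> forall a, maxr c <= K -> code_at a (flat c a) ->
  nstar (config a s) (config (a + csize c) t).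
Proof.
have loop r c0 a : maxr (Loop r c0) <= K -> code_at a (flat (Loop r c0) a) ->
    [/\ r < K, maxr c0 <= K, code_at a [:: IDec r a.+1 (a + (csize c0).+2)],
        code_at a.+1 (flat c0 a.+1) & code_at (a.+1 + csize c0) [:: IJmp a]].
  move=> /=; rewrite geq_max => /andP[h1 h2].
  rewrite -cat1s => /code_at_cat[h3 /code_at_cat[h4 h5]].
  by rewrite size_flat /= addn1 in h4 h5.
elim=> {c s t} [s|r s|c d s t u _ IHc _ IHd|r c s sr|r c s t u n sr _ IHc _ IHl] a.
- by rewrite addn0 => _ _; apply: nstar0.
- move=> /= rK h; rewrite addn1; apply: nstarS (nstar0 _) _; exact: step_inc h.
- rewrite /= geq_max => /andP[h1 h2] /code_at_cat[h3 h4]; rewrite size_flat in h4.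
  by rewrite addnA; apply: nstar_trans (IHc _ h1 h3) (IHd _ h2 h4).
- move=> h1 h2; have [rK _ h3 _ _] := loop _ _ _ h1 h2.
  apply: nstarS (nstar0 _) _; exact: step_dec0 h3 sr.
- move=> h1 h2; have [rK h0 h3 h4 h5] := loop _ _ _ h1 h2.
  apply: nstar_trans (IHl a h1 h2).
  apply: nstar_cons (step_decS rK h3 sr) _.
  by apply: nstarS (IHc _ h0 h4) _; apply: step_jmp.
Qed.

End Machine.

(** This command stops if and only if the result of [c] is 0: a positive result
    is decreased and increased for ever. *)
Definition decide c := Seq c (Seq (Loop 1 (Inc 1)) (clr 0)).

Section Decide.
Variable c : cmd.
Local Notation prog := (flat (decide c) 0).
Definition modulus := (size prog).*2.+1.
Local Notation S := modulus.
Local Notation K := (maxr (decide c)).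
Definition start_regs m : regs := upd (fun=> 0) 0 m.
Definition halt_num : nat := S + size prog.

Lemma modulus_gt : size prog < S. Proof. by rewrite /S; lia. Qed.
Lemma modulus_odd : odd S. Proof. by rewrite /S /= odd_double. Qed.
Lemma modulus_gt1 : 1 < S. Proof. by rewrite /S size_flat /=; lia. Qed.
Lemma code_prog : code_at prog 0 prog. Proof. by move=> i; rewrite add0n. Qed.

Lemma K_gt1 : 1 < K. Proof. by rewrite /=; lia. Qed.

Lemma config_start m : config S K 0 (start_regs m) = (Posz (S * 3 ^ m)).
Proof.
rewrite /config /num_of addr0 -PoszM; congr (Posz (_ * _)).
rewrite /enc_regs; have := K_gt1; case: K => // k _.
rewrite big_ord_recl big1 ?muln1 // => i _.
Qed.
Lemma config_halt : config S K (size prog) (fun=> 0) = (Posz halt_num).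
Proof.
rewrite /config /num_of /enc_regs big1 => [|i _]; last by rewrite expn0.
by rewrite /halt_num mulr1.
Qed.

Lemma halt_stuck y : ~ nstep prog S (Posz halt_num) y.
Proof.
move=> [s [w [hs e _]]]; rewrite -config_halt in e.
have [h _] := num_of_inj modulus_gt (ltn_trans hs modulus_gt) e.
by rewrite -h ltnn in hs.
Qed.

(** A run that stops connects the two numbers. A run that enters the loop is
    periodic from there on, and [vconn_cycle] keeps it apart from the halting
    number, which has no successor. *)
Lemma decideP m y : run c (start_regs m) (upd (start_regs m) 1 y) ->
  vconn (rules prog S) (cfg (Posz (S * 3 ^ m))) (cfg (Posz halt_num)) <-> y = 0.
Proof.
move=> rc; rewrite -config_start.
have code1 := code_prog; have [hc hl] := code_at_cat code1.
rewrite size_flat in hl.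
have [hl1 hl2] := code_at_cat hl.
have hK : maxr c <= K by rewrite /= leq_maxl.
have sim := simulate S rc hK hc; rewrite add0n in sim hl1.
split=> [|y0].
  case: y rc sim => // n rc sim conn.
  set A := config _ _ _ _ in sim.
  have [hd hj] := code_at_cat (l1 := [:: _]) hl1.
  have [hi hj'] := code_at_cat (l1 := [:: _]) hj.
  rewrite /= !addn1 in hi hj'.
  have st1 := step_decS S K_gt1 hd (s := upd (start_regs m) 1 n.+1) erefl.
  have st2 := step_inc S (K := K) (upd (upd (start_regs m) 1 n.+1) 1 n) K_gt1 hi.
  have st3 := step_jmp S K (upd (start_regs m) 1 n.+1) hj'.
  have e : upd (upd (upd (start_regs m) 1 n.+1) 1 n) 1 (upd (upd (start_regs m) 1 n.+1) 1 n 1).+1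
    = upd (start_regs m) 1 n.+1 by upd_ext.
  rewrite e in st2.
  have cyc := nstar_cons st2 (nstar_cons st3 (nstar0 _ _ _)).
  have [z zE zA] := vconn_cycle modulus_gt modulus_odd modulus_gt1 st1 cyc sim conn.
  have {zE} zE : z = (Posz halt_num).
    by have := congr1 (fun r : 'rV_2 => r ord0 ord0) zE; rewrite !(proj1 (cfgE _)).
  subst z; have [hA|[w hw _]] := nstar_inv zA; last by case: (halt_stuck hw).
  by rewrite -hA in st1; case: (halt_stuck st1).
rewrite -config_halt -[size prog]add0n.
have r : run (decide c) (start_regs m) (fun=> 0).
  apply: run_seq rc _; apply: run_seq (run_loop0 _ _) _; first by rewrite /upd y0.
  by apply: run_eq (run_clr _ _) _; rewrite /start_regs y0; upd_ext.
have h := simulate S r (leqnn _) code1; rewrite -(size_flat (decide c) 0) in h.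
exact: (nstar_vconn modulus_gt modulus_odd modulus_gt1 h).
Qed.
End Decide.

(** * The diagonal argument *)

Theorem theorem1p4 :
  ~ exists f : rec_fun 1, forall X : vgbs,
      exists (D : decomposition X) (T : gtree (pi1 X)),
        [/\ rec_eval f [tuple enc_vgbs X] (enc_decomposition D),
            decomposition_of D T
          & abelian_compatibility_JSJ T].
Proof.
move=> [f hf].
have [hcode hcodeP] : computable 1 (fun x => group_code (nth 0 x 0)) by apply: computable1_group_code; apply: computable_nth.
have [rcode rcodeP] : computable 1 (fun x => read_code (nth 0 x 0)) by apply: computable1_read_code; apply: computable_nth.
(* The program under consideration: from m, compute the code of a group, apply f,
   and read off whether the numbers of this group are connected. *)
pose q := rec_comp rcode (fun _ : 'I_1 => rec_comp f (fun _ : 'I_1 => hcode)).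
pose c := compile q [:: 0] 1 2; pose prog := flat (decide c) 0.
pose L := rules prog (modulus c).
have wfL : all wf_rule L := rules_wf prog (modulus_odd c) (modulus_gt1 c).
(* The input for which the group is the one of the program started on this input. *)
pose m := CodeSeq.code (parts L (halt_num c) (modulus c)).
pose num := nums (halt_num c) (modulus c * 3 ^ m).
have [D [T [fD DT JT]]] := hf (machine_vgbs num wfL).
have qE : rec_eval q [tuple m] (read_code (enc_decomposition D)).
  exists [tuple enc_decomposition D]; split; last exact: rcodeP.
  move=> i; rewrite (ord1 i); exists [tuple enc_vgbs (machine_vgbs num wfL)]; split=> // j.
  by rewrite (ord1 j) -[tnth _ _]group_codeE; apply: hcodeP.
have rc : run c (start_regs m) (upd (start_regs m) 1 (read_code (enc_decomposition D))).
  by apply: (compileP qE) => // -[|[|r]].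
have h1 := decideP rc.
have h2 := readsP (isT : 0 < size L) (erefl : nth scale_rule L 0 = scale_rule) DT JT.
rewrite -read_codeE in h2.
case: (posnP (read_code (enc_decomposition D))) => [r0|r_gt0].
  by have := proj2 h2 (proj2 h1 r0); rewrite r0.
by have := proj1 h1 (proj1 h2 r_gt0) => r0; rewrite r0 in r_gt0.
Qed.
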